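(* There exist an absolute constant $\epsilon_0>0$ (small) and a constant $C^*>0$, where $C^*$ depends only on the quantity $\left(\sup_{B_{2R}}K\right)\int_{B_{2R}}e^{4w}\,d\mathrm{vol}_{g_0}$, such that the following holds. Let $R>0$, let $K$ be a function on $B_{2R}\subset\mathbb R^4$ with $0\le\inf_{B_{2R}}K\le\sup_{B_{2R}}K<\infty$, and let $w$ be an admissible solution of $$\sigma_2(g^{-1}\circ A_g)=K(x),\qquad g=e^{2w}g_0,$$ on $B_{2R}$. If $$\int_{B_{2R}}K(x)e^{4w}\,d\mathrm{vol}_{g_0}<\epsilon_0,$$ then $$\sup_{B_R}e^{w}\le C^*\left(\frac1{R^4}\int_{B_{2R}}e^{4w}\,d\mathrm{vol}_{g_0}\right)^{1/4}\qquad\text{and}\qquad \sup_{B_R}e^{w}\le C^*\inf_{B_R}e^{w}.$$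
   Context: The background metric is the flat metric $g_0=|dx|^2$ on $\mathbb R^4$, with volume measure $d\mathrm{vol}_{g_0}$ (Lebesgue measure); $B_r$ denotes a ball of radius $r$, the balls $B_R$ and $B_{2R}$ being concentric. For $g=e^{2w}g_0$, the Weyl-Schouten tensor of $g$ in dimension $n=4$ is $A_g=\frac1{n-2}\{Ric_g-\frac{R_g}{2(n-1)}g\}$ ($Ric_g$ the Ricci tensor and $R_g$ the scalar curvature of $g$), which here equals $$A_g=-\left[\nabla^2w-dw\otimes dw+\tfrac12|\nabla w|^2g_0\right],$$ where $\nabla$ and $|\cdot|$ are taken with respect to $g_0$. For a $1$-$1$ tensor $\Lambda$, $\sigma_k(\Lambda)$ is the $k$-th elementary symmetric function of its eigenvalues. One has $\sigma_2(g^{-1}\circ A_g)=e^{-4w}\sigma_2(g_0^{-1}\circ A_g)$. The condition $A_g\in\Gamma_2^+$ at a point means $\sigma_1(g^{-1}\circ A_g)>0$ and $\sigma_2(g^{-1}\circ A_g)>0$ there. An admissible solution of the equation on $B_{2R}$ is a function $w\in C^2(B_{2R})$ such that at every point $A_g\in\Gamma_2^+$ and the equation holds.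
   Formalization: The quantity (sup K)·∫e^{4w} over B_{2R}, on which C* depends, is assumed finite; for w only C² on the open ball the volume may be infinite, and then no uniform constant C* exists in the second inequality. *)

(* Defs.v *)
From mathcomp Require Import all_boot all_order all_algebra.
From mathcomp Require Import all_classical all_reals all_analysis.

Set Implicit Arguments.
Unset Strict Implicit.
Unset Printing Implicit Defensive.

Import Order.TTheory GRing.Theory Num.Theory.
Import numFieldNormedType.Exports.

Local Open Scope classical_set_scope.
Local Open Scope ring_scope.

Section euclidean_space.
Context {R : realType} {n : nat}.
Implicit Types (x c : 'rV[R]_n) (f : 'rV[R]_n -> R) (U : set 'rV[R]_n).

(* The norm that the library puts on 'rV[R]_n, hence its [ball], is the sup
   norm; it induces the same topology and the same derivatives. *)
Definition enorm x : R := Num.sqrt (\sum_i x 0 i ^+ 2).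

Definition eball c (r : R) : set 'rV[R]_n := [set x | enorm (x - c) < r].

Definition partial (i : 'I_n) f : 'rV[R]_n -> R :=
  fun x => 'D_(delta_mx 0 i) f x.

Definition partially_derivable_on U f :=
  forall (i : 'I_n) x, U x -> derivable f x (delta_mx 0 i).

Definition continuous_on U f := forall x, U x -> {for x, continuous f}.

(* Intended for open U. *)
Definition C2_on U f :=
  [/\ continuous_on U f,
      partially_derivable_on U f,
      forall i, continuous_on U (partial i f) /\
                partially_derivable_on U (partial i f)
    & forall i j, continuous_on U (partial j (partial i f))].

End euclidean_space.

Section curvature.
Context {R : realType} {n : nat}.

(* A metric (or any covariant 2-tensor) is given by its matrix of components
   in the standard coordinates. *)
Implicit Types (g : 'rV[R]_n -> 'M[R]_n) (x : 'rV[R]_n) (L : 'M[R]_n).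

(* Gamma^k_ij *)
Definition christoffel g (k i j : 'I_n) x : R :=
  2^-1 * \sum_l invmx (g x) k l *
    (partial i (fun y => g y j l) x + partial j (fun y => g y i l) x
     - partial l (fun y => g y i j) x).

(* Ric_ij = d_k Gamma^k_ij - d_j Gamma^k_ik
            + Gamma^k_kl Gamma^l_ij - Gamma^k_jl Gamma^l_ik,
   with the sign for which round spheres have positive curvature. *)
Definition ricci g x : 'M[R]_n := \matrix_(i, j)
  (\sum_k (partial k (christoffel g k i j) x
           - partial j (christoffel g k i k) x)
   + \sum_k \sum_l (christoffel g k k l x * christoffel g l i j x
                    - christoffel g k j l x * christoffel g l i k x)).

Definition scalar_curvature g x : R := \tr (invmx (g x) *m ricci g x).

Definition schouten g x : 'M[R]_n :=
  (n%:R - 2)^-1 *: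
    (ricci g x - (scalar_curvature g x / (2 * (n%:R - 1))) *: g x).

(* The eigenvalues of L listed with multiplicity, in some order.  They are used
   for the tensors g^-1 A with A symmetric; such a tensor is self-adjoint with
   respect to g, so that all its eigenvalues are real.  The value is 0 by
   convention when the characteristic polynomial does not split over R. *)
Definition eigenvalues L : 'rV[R]_n :=
  xget 0 [set l : 'rV[R]_n | char_poly L = \prod_i ('X - (l 0 i)%:P)].

Definition sigma (k : nat) L : R :=
  \sum_(I : {set 'I_n} | #|I| == k) \prod_(i in I) eigenvalues L 0 i.

(* The 1-1 tensor g^-1 o A_g. *)
Definition schouten_endo g x : 'M[R]_n := invmx (g x) *m schouten g x.

Definition Gamma2_plus g x :=
  0 < sigma 1 (schouten_endo g x) /\ 0 < sigma 2 (schouten_endo g x).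

(* e^(2w) g_0, with g_0 the flat metric. *)
Definition conformal_flat (w : 'rV[R]_n -> R) : 'rV[R]_n -> 'M[R]_n :=
  fun x => expR (2 * w x) *: 1%:M.

Definition admissible_solution (U : set 'rV[R]_n) (K w : 'rV[R]_n -> R) :=
  C2_on U w /\
  forall x, U x -> Gamma2_plus (conformal_flat w) x /\
                   sigma 2 (schouten_endo (conformal_flat w) x) = K x.

End curvature.

Section integration.
Context {R : realType}.
Local Open Scope ereal_scope.

Local Notation R1 := (measurableTypeR R).

Definition vec4 (p : R1 * R1 * R1 * R1) : 'rV[R]_4 :=
  let: (a, b, c, d) := p in \row_i [:: a; b; c; d]`_i.

Definition lebesgue4 : {measure set (R1 * R1 * R1 * R1) -> \bar R} :=
  @lebesgue_measure R \x @lebesgue_measure R \x @lebesgue_measure R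
    \x @lebesgue_measure R.

(* The integral of f over A with respect to Lebesgue measure on R^4; the
   library has no measurable structure on 'rV[R]_4, so the product measure on
   R * R * R * R is transported along vec4. *)
Definition integral4 (A : set 'rV[R]_4) (f : 'rV[R]_4 -> R) : \bar R :=
  \int[lebesgue4]_(p in vec4 @^-1` A) (f (vec4 p))%:E.

End integration.

Section sup_inf.
Context {R : realType} {T : Type}.

Definition supr_on (A : set T) (f : T -> R) : \bar R :=
  ereal_sup [set (f x)%:E | x in A].

Definition infi_on (A : set T) (f : T -> R) : \bar R :=
  ereal_inf [set (f x)%:E | x in A].

End sup_inf.

(* Main.v *)
(** Put f = - w, so that g = e^(-2f) g_0 and A_g = D^2 f + df (x) df - |df|^2 g_0 / 2, and
    let S = 2 sigma_2(g_0^-1 A_g) = 2 K e^(-4f).  The condition A_g in Gamma_2^+ makes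
    e^(-f) superharmonic and the Newton tensor of A_g positive.  Since sigma_2 has
    divergence structure, testing S against (s + |x - p|^2)^(-kappa) P(f), with P a bounded
    decreasing function, bounds a weighted integral of |df|^2 by the mass of S, so that the
    energy of f over small balls decays like a power of the radius.  Two consequences
    follow: where S is below the scale-invariant threshold, e^(-f) does not oscillate
    around its near-maxima; and where the mass of S is small, the mean of f over balls
    grows at most half as fast in the logarithm of the radius as it would for a bubble.
    At a maximum of e^(-f) dist(., boundary) the first describes f up to the scale at which
    S matters and the second beyond it, so that a large maximum would force the volume to
    be large.  This bounds S, and then a chain of balls gives the Harnack inequality; the
    bound by the volume follows from it. *)

Require Import Defs.
From mathcomp Require Import all_boot all_order all_algebra.
From mathcomp Require Import all_classical all_reals all_analysis.
From mathcomp Require Import measurable_realfun.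
From mathcomp Require Import ring lra.
Set Implicit Arguments.
Unset Strict Implicit.
Unset Printing Implicit Defensive.
Import Order.TTheory GRing.Theory Num.Theory.
Import numFieldNormedType.Exports.
Local Open Scope classical_set_scope.
Local Open Scope ring_scope.

(** * Integration over R^4 *)

Section measure_preserving.
Local Open Scope ereal_scope.

(** Bounds on K control no modulus of continuity, so second derivatives of w are never estimated and
    no rescaled limit is classified: all estimates use only f, its energy and the mass of S. The
    obstacle is the term |df|^2 df . d(eta), which appears when S is tested against P(f) eta; it is
    cubic and has no sign. It is absorbed by the Newton tensor in the direction df, which enters
    with the factor - P'(f) eta and leaves at least half of |df|^4. Hence P must decrease and the
    weight must be a small power. The choice is P(f) = (tau + exp ((f - k) / 4))^-1: tau = 1 serves
    where f >= k, and a small tau, balanced against the mass of S, serves where f <= k. Since w is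
    only C^2, the flux D^2 f df cannot be differentiated; the divergence identity rests on a weak
    symmetry of second derivatives, obtained by translating under the integral. *)

Definition preserves d (T : measurableType d) (R : realType)
    (m : set T -> \bar R) (h : T -> T) :=
  measurable_fun setT h /\ forall A, measurable A -> m (h @^-1` A) = m A.

(** The slice over x of the preimage of A is the preimage under [h2] of the slice of A over [h1 x],
    so the product measure is computed slice by slice. *)
Lemma preserves_prod d1 d2 (T1 : measurableType d1) (T2 : measurableType d2)
    (R : realType) (m1 : {measure set T1 -> \bar R})
    (m2 : {sigma_finite_measure set T2 -> \bar R}) h1 h2 :
  preserves m1 h1 -> preserves m2 h2 ->
  preserves (m1 \x m2) (fun p => (h1 p.1, h2 p.2)).
Proof.
move=> [mh1 p1] [mh2 p2].
have mh : measurable_fun setT (fun p : T1 * T2 => (h1 p.1, h2 p.2)).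
  by apply: measurable_fun_pair; exact: measurableT_comp.
split=> // A mA; rewrite /product_measure1.
have ms : measurable_fun setT (m2 \o xsection A) by exact: measurable_fun_xsection.
transitivity (\int[m1]_x ((m2 \o xsection A) (h1 x))).
  apply: eq_integral => x _ /=; rewrite -[RHS]p2; last exact: measurable_xsection.
  by congr (m2 _); apply/seteqP; split => y; rewrite /xsection/= !inE.
rewrite -(@ge0_integral_pushforward _ _ _ _ R h1 mh1 m1 setT (m2 \o xsection A))//.
by apply: eq_measure_integral => B mB _; rewrite -[RHS]p1.
Qed.

Lemma preserves_translation (R : realType) (a : R) :
  preserves (@lebesgue_measure R) (fun x : measurableTypeR R => (x + a)%R).
Proof.
have mh : measurable_fun setT (fun x : measurableTypeR R => (x + a)%R).
  exact: measurable_funD.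
split=> // A mA.
transitivity (pushforward (@lebesgue_measure R)
  ((fun x => x + a)%R : measurableTypeR R -> measurableTypeR R) A); first by [].
(* Lebesgue measure is determined by its values on half-open intervals, and these only get
   shifted. *)
apply/esym/lebesgue_measure_unique => //= _ [[b c]] _ <-; rewrite /pushforward/=.
rewrite (_ : _ @^-1` _ = `](b - a)%R, (c - a)%R]%classic).
  rewrite !lebesgue_measure_itv/= !lte_fin ltrD2r.
  by case: ifP => // _; congr (_%:E); rewrite opprB addrA subrK.
apply/seteqP; split=> x /=; rewrite !in_itv/= => /andP[? ?]; apply/andP; split.
- by rewrite ltrBlDr.
- by rewrite lerBrDr.
- by rewrite -ltrBlDr.
- by rewrite -lerBrDr.
Qed.

Lemma preserves_integral d (T : measurableType d) (R : realType)
    (m : {measure set T -> \bar R}) (h : T -> T) (f : T -> R) :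
  preserves m h -> m.-integrable setT (EFin \o (f \o h)) ->
  measurable_fun setT f ->
  \int[m]_x (f (h x))%:E = \int[m]_x (f x)%:E.
Proof.
move=> [mh ph] fi mf.
transitivity (\int[pushforward m h]_x (f x)%:E).
  by rewrite (@integral_pushforward _ _ _ _ R h mh m setT (EFin \o f))//;
    exact/measurable_EFinP.
by apply: eq_measure_integral => A mA _; rewrite -[RHS]ph.
Qed.

End measure_preserving.

Section vec4.
Context {R : realType}.
Local Notation R1 := (measurableTypeR R).
Local Notation T4 := (R1 * R1 * R1 * R1)%type.

Definition coord4 (i : 'I_4) (p : T4) : R1 := vec4 p 0 i.

Lemma coord4E (i : 'I_4) (p : T4) :
  coord4 i p = [:: p.1.1.1; p.1.1.2; p.1.2; p.2]`_i.
Proof. by case: p => [[[a b] c] d]; rewrite /coord4 /= mxE. Qed.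

Lemma measurable_coord4 i : measurable_fun setT (coord4 i).
Proof.
rewrite (_ : coord4 i = fun p => [:: p.1.1.1; p.1.1.2; p.1.2; p.2]`_i); last first.
  by apply/funext => p; rewrite coord4E.
case: i => -[|[|[|[|//]]]] /= _.
- by do ?[apply: measurableT_comp => //].
- by do ?[apply: measurableT_comp => //].
- by do ?[apply: measurableT_comp => //].
- by do ?[apply: measurableT_comp => //].
Qed.

Lemma measurable_vec4_ball (c : 'rV[R]_4) (e : R) :
  measurable (vec4 @^-1` (ball c e) : set T4).
Proof.
have [e0|e0] := ltP 0 e; last first.
  rewrite (_ : _ @^-1` _ = set0)//; apply/seteqP; split=> // p /=.
  by rewrite mx_norm_ball /ball_/= => /(le_lt_trans (normr_ge0 _)); rewrite ltNge e0.
rewrite (_ : _ @^-1` _ = \bigcap_(i in [set: 'I_4]) (coord4 i @^-1` (ball (c 0 i) e))).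
  apply: fin_bigcap_measurable => // i _.
  rewrite -[X in measurable X]setTI; apply: measurable_coord4 => //.
  exact: measurable_ball.
apply/seteqP; split => p /=.
  by move=> -[_ h] i _ /=; have := h 0 i.
move=> h; split => // i j; rewrite (ord1 i); exact: h.
Qed.

(** An open set is the union of the balls inside it that have a rational centre and radius 1 / (n +
    1). These are countably many, and each has a product of intervals as its preimage. *)
Lemma measurable_vec4_open (O : set 'rV[R]_4) :
  open O -> measurable (vec4 @^-1` O : set T4).
Proof.
move=> oO.
pose qr (q : 'rV[rat]_4) : 'rV[R]_4 := map_mx ratr q.
pose P (a : 'rV[rat]_4 * nat) := ball (qr a.1) (a.2.+1%:R^-1 : R) `<=` O.
rewrite (_ : vec4 @^-1` O = \bigcup_a
  (if `[< P a >] then vec4 @^-1` (ball (qr a.1) (a.2.+1%:R^-1 : R)) else set0)).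
  apply: countable_bigcupT_measurable => // a.
  by case: ifP => // _; exact: measurable_vec4_ball.
apply/seteqP; split => p /=; last first.
  by move=> [a _]; case: ifP => // /asboolP Pa /= /Pa.
move=> Op.
have /nbhs_ballP [e /= e0 be] := open_nbhs_nbhs (conj oO Op).
have [n ne] : exists n : nat, (n.+1%:R^-1 : R) < e / 2.
  have [n _ hn] := near_infty_natSinv_lt (PosNum (divr_gt0 e0 (ltr0Sn R 1))).
  by exists n; have := hn n; rewrite /= leqnn; apply.
have n0 : (0 : R) < n.+1%:R^-1 by rewrite invr_gt0.
set d := (n.+1%:R^-1 : R) in ne n0.
have /choice [q qP] : forall i, exists q : rat, `|vec4 p 0 i - ratr q| < d.
  move=> i; have [|q] := @rat_in_itvoo R (vec4 p 0 i - d) (vec4 p 0 i + d).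
    by lra.
  by rewrite in_itv/= => /andP[? ?]; exists q; rewrite ltr_norml; lra.
exists (\row_i q i, n) => //=.
have -> : `[< P (\row_i q i, n) >].
  apply/asboolP => /= x [_ hx]; apply: be; split => // i j.
  have := hx i j; rewrite /ball /= -/d !mxE (ord1 i).
  have := qP j; rewrite !ltr_norml; lra.
split => // i j; rewrite /ball /= -/d (ord1 i) distrC; have := qP j; rewrite !mxE //.
Qed.

Lemma measurable_vec4 (g : 'rV[R]_4 -> R) : continuous g ->
  measurable_fun setT (fun p : T4 => g (vec4 p)).
Proof.
move=> cg; apply: (measurability _ (RGenOpens.measurableE R)).
move=> _ [_ [a [b ->] <-]]; rewrite setTI.
apply: (@measurable_vec4_open (g @^-1` `]a, b[%classic)).
by move/continuousP: cg; apply; exact: interval_open.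
Qed.

End vec4.

(** * Integrals of continuous functions of compact support *)

Section continuous_compact_support.
Context {R : realType}.
Local Notation R1 := (measurableTypeR R).
Local Notation T4 := (R1 * R1 * R1 * R1)%type.
Local Notation V := 'rV[R]_4.
Implicit Types (f g : V -> R).

(* Inductive wrappers, so that unification never unfolds continuity when it
   compares two different functions. *)
Variant cont g : Prop := Cont of continuous g.

Variant ccs g : Prop := Ccs of cont g & exists r : R, forall x, r < `|x| -> g x = 0.

Lemma contP g : cont g -> continuous g. Proof. by case. Qed.

Lemma ccs_cont g : ccs g -> cont g. Proof. by case. Qed.

Lemma ccsM f g : cont f -> ccs g -> ccs (fun x => f x * g x).
Proof.
move=> [cf] [[cg] [r gr]]; split.
  by split=> x; apply: continuousM; [exact: cf|exact: cg].
by exists r => x /gr ->; rewrite mulr0.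
Qed.

Lemma ccsD f g : ccs f -> ccs g -> ccs (fun x => f x + g x).
Proof.
move=> [[cf] [s fs]] [[cg] [r gr]]; split.
  by split=> x; apply: continuousD; [exact: cf|exact: cg].
exists (Num.max s r) => x; rewrite gt_max => /andP[/fs -> /gr ->].
by rewrite addr0.
Qed.

Lemma ccsZ (a : R) g : ccs g -> ccs (fun x => a * g x).
Proof. by apply: ccsM; split=> x; exact: cst_continuous. Qed.

Lemma ccs_ext f g : f =1 g -> ccs g -> ccs f.
Proof. by move=> /funext ->. Qed.

Lemma ccsN g : ccs g -> ccs (fun x => - g x).
Proof. by move=> cg; apply: ccs_ext (ccsZ (-1) cg) => x; rewrite mulN1r. Qed.

Lemma ccs_translate g v : ccs g -> ccs (fun x => g (x + v)).
Proof.
move=> [[cg] [r gr]]; split.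
  split=> x; apply: (@continuous_comp V V R (fun x => x + v) g x); last exact: cg.
  by apply: continuousD; [exact: cvg_id|exact: cst_continuous].
exists (r + `|v|) => x rx; apply: gr.
have := ler_normD (x + v) (- v); rewrite addrK normrN; lra.
Qed.

Lemma compact_normball (r : R) : compact [set x : V | `|x| <= r].
Proof.
apply: bounded_closed_compact.
  by exists r; split; [exact: num_real|move=> M rM x /= /le_trans; apply; exact: ltW].
rewrite (_ : mkset _ = Num.norm @^-1` `]-oo, r]%classic); last first.
  by apply/seteqP; split => x /=; rewrite in_itv.
by apply: closed_comp; [move=> x _; exact: norm_continuous|exact: interval_closed].
Qed.

Lemma ccs_max g : ccs g -> exists x, forall y, 0 < g y -> g y <= g x.
Proof.
move=> [[cg] [r gr]].
have [[x0 K0]|K0] := pselect ([set x : V | `|x| <= r] !=set0); last first.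
  exists 0 => y gy; exfalso; apply: K0; exists y => /=; rewrite leNgt.
  by apply/negP => /gr y0; move: gy; rewrite y0 ltxx.
have [x _ hx] := @compact_EVT_max _ _ g _ (ex_intro _ x0 K0) (@compact_normball r)
  (continuous_subspaceT cg).
exists x => y gy; apply: hx; rewrite inE /= leNgt.
by apply/negP => /gr y0; move: gy; rewrite y0 ltxx.
Qed.

Lemma ccs_norm g : ccs g -> ccs (fun x => `|g x|).
Proof.
move=> [[cg] [r gr]]; split; last by exists r => x /gr ->; rewrite normr0.
by split=> x; apply: (@continuous_comp V R R g Num.norm x); [exact: cg|exact: norm_continuous].
Qed.

Lemma ccs_bounded g : ccs g -> exists2 M : R, 0 <= M & forall x, `|g x| <= M.
Proof.
move=> /ccs_norm /ccs_max [x hx]; exists `|g x| => // y.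
have [->//|y0] := eqVneq (g y) 0; first by rewrite normr0.
by apply: hx; rewrite normr_gt0.
Qed.

Local Notation lam := (@lebesgue4 R).

(** The ball is that of the sup norm, hence a cube of side 2 e. *)
Lemma lebesgue4_ballE (c : V) (e : R) : 0 < e ->
  (lam (vec4 @^-1` ball c e) = ((2 * e) ^+ 4)%:E)%E.
Proof.
move=> e0.
pose B i := ball (c 0 i : R1) e : set R1.
have mB i : measurable (B i) by exact: measurable_ball.
have -> : vec4 @^-1` ball c e =
    B (inord 0) `*` B (inord 1) `*` B (inord 2) `*` B (inord 3).
  apply/seteqP; split => -[[[x y] z] t] /=.
    move=> -[_ h]; have := (h 0 (inord 0), h 0 (inord 1), h 0 (inord 2), h 0 (inord 3)).
    by rewrite !mxE !inordK//= => -[[[? ?] ?] ?].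
  move=> -[[[h0 h1] h2] h3]; split => // i j; rewrite (ord1 i) mxE.
  have E k (H : (k < 4)%N) : Ordinal H = inord k by apply/val_inj; rewrite /= inordK.
  by case: j => -[|[|[|[|//]]]] H; rewrite E /= ?inordK.
pose mu : {sigma_finite_measure set R1 -> \bar R} := @lebesgue_measure R.
transitivity ((mu \x mu \x mu \x mu)%E (B (inord 0) `*` B (inord 1) `*` B (inord 2)
  `*` B (inord 3))); first by [].
have m2 : measurable (B (inord 0) `*` B (inord 1)) by exact: measurableX.
have m3 : measurable (B (inord 0) `*` B (inord 1) `*` B (inord 2)) by exact: measurableX.
transitivity (mu (B (inord 0)) * mu (B (inord 1)) * mu (B (inord 2)) * mu (B (inord 3)))%E.
  etransitivity; first exact: (@product_measure1E _ _ _ _ _ (mu \x mu \x mu)%E mu).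
  congr (_ * _)%E; etransitivity; first exact: (@product_measure1E _ _ _ _ _ (mu \x mu)%E mu).
  by congr (_ * _)%E; exact: (@product_measure1E _ _ _ _ _ mu mu).
have muB i : mu (B i) = (e *+ 2)%:E by exact: (lebesgue_measure_ball _ (ltW e0)).
by rewrite !muB -!EFinM; congr (_%:E); ring.
Qed.

Lemma ccs_integrable g : ccs g -> lam.-integrable setT (EFin \o (g \o vec4)).
Proof.
move=> cg; have [M M0 gM] := ccs_bounded cg; case: (cg) => -[cg'] [r gr].
pose B := vec4 @^-1` ball (0 : V) (Num.max 0 r + 1) : set T4.
have r0 : 0 < Num.max 0 r + 1 by rewrite ltr_wpDl// le_max lexx.
have mB : measurable B by exact: measurable_vec4_ball.
have h : lam.-integrable setT ((EFin \o cst M) \_ B).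
  apply: (proj1 (integrable_mkcond _ mB)); apply: (@measurable_bounded_integrable _ _ _ lam (cst M) B) => //.
    by rewrite lebesgue4_ballE// ltry.
  by exists M; split; [exact: num_real|move=> N MN p _ /=; rewrite ger0_norm// ltW].
apply: le_integrable h; first exact: measurableT.
  by apply/measurable_EFinP; exact: measurable_vec4.
move=> p _ /=; rewrite /patch.
case: ifPn; first by move=> _ /=; rewrite lee_fin [leRHS]ger0_norm.
rewrite notin_setE => pB; suff rp : r < `|vec4 p| by rewrite gr// normr0.
move: pB; rewrite /B /= mx_norm_ball /ball_/= sub0r normrN => /negP.
rewrite -leNgt; apply: lt_le_trans.
have : r <= Num.max 0 r by rewrite le_max lexx orbT.
lra.
Qed.

Definition int4 g : R := (\int[lam]_p g (vec4 p))%R.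

End continuous_compact_support.

Section int4_theory.
Context {R : realType}.
Local Notation R1 := (measurableTypeR R).
Local Notation T4 := (R1 * R1 * R1 * R1)%type.
Local Notation V := 'rV[R]_4.
Local Notation lam := (@lebesgue4 R).
Implicit Types (f g : V -> R).

Lemma int4D f g : ccs f -> ccs g -> int4 (fun x => f x + g x) = int4 f + int4 g.
Proof.
move=> cf cg; rewrite /int4 -RintegralD//; exact: ccs_integrable.
Qed.

Lemma int4Z (a : R) g : ccs g -> int4 (fun x => a * g x) = a * int4 g.
Proof. by move=> cg; rewrite /int4 -RintegralZl//; exact: ccs_integrable. Qed.

Lemma int4N g : ccs g -> int4 (fun x => - g x) = - int4 g.
Proof.
move=> cg; rewrite -mulN1r -int4Z//; congr int4.
by apply/funext => x; rewrite mulN1r.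
Qed.

Lemma int4B f g : ccs f -> ccs g -> int4 (fun x => f x - g x) = int4 f - int4 g.
Proof. by move=> cf cg; rewrite int4D ?int4N//; exact: ccsN. Qed.

Lemma int4_le f g : ccs f -> ccs g -> (forall x, f x <= g x) -> int4 f <= int4 g.
Proof. by move=> cf cg fg; apply: le_Rintegral => //; exact: ccs_integrable. Qed.

Lemma int4_ge0 g : (forall x, 0 <= g x) -> 0 <= int4 g.
Proof. by move=> g0; apply: Rintegral_ge0. Qed.

Lemma eq_int4 f g : f =1 g -> int4 f = int4 g.
Proof. by move=> /funext ->. Qed.

Lemma int4_translate g (i : 'I_4) (t : R) : ccs g ->
  int4 (fun x => g (x + t *: delta_mx 0 i)) = int4 g.
Proof.
move=> cg; rewrite /int4 /Rintegral; congr fine.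
pose a j : R := t * (j == i)%:R.
pose h (p : T4) : T4 :=
  (p.1.1.1 + a (inord 0), p.1.1.2 + a (inord 1), p.1.2 + a (inord 2), p.2 + a (inord 3)).
have vh p : vec4 p + t *: delta_mx 0 i = vec4 (h p).
  case: p => [[[x y] z] u]; apply/rowP => j; rewrite !mxE /h/= /a.
  have E k (H : (k < 4)%N) : Ordinal H = inord k by apply/val_inj; rewrite /= inordK.
  by case: j => -[|[|[|[|//]]]] H; rewrite /= E ?eqxx.
transitivity (\int[lam]_p (g (vec4 (h p)))%:E)%E.
  by apply: eq_integral => p _; rewrite vh.
have ph : preserves lam h.
  have p1 k := preserves_translation (a (inord k)).
  have P2 := preserves_prod (p1 0%N) (p1 1%N).
  have P3 := preserves_prod (m1 := (_ \x _)%E) P2 (p1 2%N).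
  exact: (preserves_prod (m1 := (_ \x _ \x _)%E) P3 (p1 3%N)).
apply: (preserves_integral (f := g \o vec4) ph); last first.
  by apply: measurable_vec4; exact/contP/ccs_cont.
have := ccs_integrable (ccs_translate (t *: delta_mx 0 i) cg).
by apply: eq_integrable => // p _ /=; rewrite vh.
Qed.

(** Dominated differentiation: the majorant is the constant [|M|] on a ball outside which every
    [dG t] vanishes. It is applied to translates, which gives integration by parts, and to the scale
    parameter of the means over balls. *)
Lemma is_derive_int4 (G dG : R -> V -> R) (t0 e r M : R) : 0 < e ->
  (forall t, `|t - t0| < e -> ccs (G t)) ->
  (forall t x, `|t - t0| < e -> is_derive t 1 (G ^~ x) (dG t x)) ->
  (forall t x, `|t - t0| < e -> r < `|x| -> dG t x = 0) ->
  (forall t x, `|t - t0| < e -> `|dG t x| <= M) ->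
  is_derive t0 1 (fun t => int4 (G t)) (int4 (dG t0)).
Proof.
move=> e0 cG dGP dG0 dGM.
pose B := vec4 @^-1` ball (0 : V) (Num.max 0 r + 1) : set T4.
have r0 : 0 < Num.max 0 r + 1 by rewrite ltr_wpDl// le_max lexx.
have mB : measurable B by exact: measurable_vec4_ball.
have h : lam.-integrable setT ((EFin \o cst `|M|) \_ B).
  apply: (proj1 (integrable_mkcond _ mB)).
  apply: (@measurable_bounded_integrable _ _ _ lam (cst `|M|) B) => //.
    by rewrite lebesgue4_ballE// ltry.
  by exists `|M|; split; [exact: num_real|move=> N MN p _ /=; rewrite normr_id ltW].
pose H p := if p \in B then `|M| else 0.
have iH : lam.-integrable setT (EFin \o H).
  by apply: eq_integrable h => // p _; rewrite /patch /H /=; case: ifP.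
have near t : t \in `](t0 - e), (t0 + e)[ -> `|t - t0| < e.
  by rewrite in_itv/= ltr_norml => /andP[? ?]; lra.
pose F t (p : T4) := G t (vec4 p).
have It0 : `](t0 - e), (t0 + e)[%classic t0 by rewrite /= in_itv/=; lra.
have h1 t : `](t0 - e), (t0 + e)[%classic t -> lam.-integrable setT (EFin \o F t).
  by move=> /near /cG /ccs_integrable.
have h2 t p : `](t0 - e), (t0 + e)[%classic t -> setT p -> derivable (F ^~ p) t 1.
  by move=> /near tt _; have [] := dGP t (vec4 p) tt.
have pE t p : `](t0 - e), (t0 + e)[%classic t -> partial1of2 F t p = dG t (vec4 p).
  by move=> /near tt; rewrite partial1of2E; have [_] := dGP t (vec4 p) tt.
have h3 t p : `](t0 - e), (t0 + e)[%classic t -> setT p -> `|partial1of2 F t p| <= H p.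
  move=> tt _; rewrite pE// /H; case: ifPn.
    by move=> _; apply: le_trans (ler_norm M); apply: dGM; exact: near.
  rewrite notin_setE => pB; rewrite dG0 ?normr0//; first exact: near.
  move: pB; rewrite /B /= mx_norm_ball /ball_/= sub0r normrN => /negP.
  rewrite -leNgt; apply: lt_le_trans.
  have : r <= Num.max 0 r by rewrite le_max lexx orbT.
  lra.
have H0 p : 0 <= H p by rewrite /H; case: ifP.
split.
  exact: (derivable_under_integral measurableT It0 h1 h2 H0 iH h3).
rewrite -derive1E (differentiation_under_integral measurableT It0 h1 h2 H0 iH h3).
by apply: eq_Rintegral => p _; rewrite pE.
Qed.

End int4_theory.

Section int4_comparison.
Context {R : realType}.
Local Notation R1 := (measurableTypeR R).
Local Notation T4 := (R1 * R1 * R1 * R1)%type.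
Local Notation V := 'rV[R]_4.
Local Notation lam := (@lebesgue4 R).
Implicit Types (g : V -> R).

Lemma int4E g : ccs g -> ((int4 g)%:E = \int[lam]_p (g (vec4 p))%:E)%E.
Proof.
move=> cg; rewrite /int4 /Rintegral fineK//.
have := ccs_integrable cg; exact: integrable_fin_num.
Qed.

(* No measurability of F is needed: the integral of a nonnegative function is a
   supremum over the simple functions below it. *)
Lemma int4_le_integral4 g (A : set V) (F : V -> R) :
  ccs g -> (forall x, 0 <= g x) -> (forall x, A x -> 0 <= F x) ->
  (forall x, g x != 0 -> A x /\ g x <= F x) ->
  ((int4 g)%:E <= integral4 A F)%E.
Proof.
move=> cg g0 F0 gF; rewrite int4E// /integral4 [leRHS]integral_mkcond.
have h0 (p : T4) : (0 <= (g (vec4 p))%:E)%E by rewrite lee_fin.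
have k0 (p : T4) : (0 <= ((fun p => (F (vec4 p))%:E) \_ (vec4 @^-1` A)) p)%E.
  by apply: erestrict_ge0 => q /F0; rewrite lee_fin.
rewrite !ge0_integralTE//; apply: ge_ereal_sup => _ [h hg <-].
apply: ereal_sup_ubound; exists h => // p; apply: le_trans (hg p) _.
have [->|gp0] := eqVneq (g (vec4 p)) 0; first exact: k0.
have [Ap gFp] := gF _ gp0; rewrite /patch mem_set// lee_fin//.
Qed.

Lemma int4_gt0 g x0 : ccs g -> (forall x, 0 <= g x) -> 0 < g x0 -> 0 < int4 g.
Proof.
move=> cg g0 gx0; have cg' := contP (ccs_cont cg).
have /nbhs_ballP [e /= e0 be] : \forall x \near x0, g x0 / 2 < g x.
  by apply: (cvgr_gt (g x0) (cg' x0)); lra.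
pose B := vec4 @^-1` ball x0 e : set T4.
have mB : measurable B by exact: measurable_vec4_ball.
rewrite -lte_fin int4E//.
apply: (@lt_le_trans _ _ (\int[lam]_(p in B) (cst (g x0 / 2)%:E p))%E).
  rewrite integral_cst// lebesgue4_ballE// -EFinM lte_fin.
  by rewrite mulr_gt0// ?divr_gt0// exprn_gt0// mulr_gt0.
rewrite integral_mkcond; apply: ge0_le_integral => //.
- by move=> p _; apply: erestrict_ge0 => q _; rewrite lee_fin divr_ge0// ltW.
- by apply/(measurable_restrictT _ mB); exact: measurable_cst.
- by apply/measurable_EFinP; exact: measurable_vec4.
move=> p _; rewrite /patch; case: ifPn; last by rewrite lee_fin.
by rewrite inE => /be /ltW; rewrite lee_fin.
Qed.

End int4_comparison.

Section directional_derivatives.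
Context {R : realType} {n : nat}.
Local Notation V := 'rV[R]_n.
Implicit Types (g : V -> R) (x v : V).

Lemma is_derive_line g x v (t l : R) :
  is_derive (x + t *: v) v g l <-> is_derive t 1 (fun s => g (x + s *: v)) l.
Proof.
have E : (fun h : R => h^-1 *: ((g \o shift (x + t *: v)) (h *: v) - g (x + t *: v))) =
    (fun h : R => h^-1 *: (((fun s : R => g (x + s *: v)) \o shift t) (h *: (1 : R^o)) -
       (fun s => g (x + s *: v)) t)).
  apply/funext => h /=; congr (_ *: (g _ - _)).
  by rewrite scalerDl addrCA; congr (_ + (_ *: _ + _)); rewrite [RHS]mulr1.
split=> -[d1 d2]; split.
- by rewrite /derivable -E.
- by rewrite /derive -E.
- by rewrite /derivable E.
- by rewrite /derive E.
Qed.

Lemma is_derive_line0 g x v (l : R) :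
  is_derive x v g l <-> is_derive (0 : R) 1 (fun s => g (x + s *: v)) l.
Proof. by rewrite -is_derive_line scale0r addr0. Qed.

Lemma is_derive_comp_real (h : R -> R) g x v (l dh : R) :
  is_derive (g x) 1 h dh -> is_derive x v g l ->
  is_derive x v (fun y => h (g y)) (dh * l).
Proof.
move=> Hh /is_derive_line0 Hg; apply/is_derive_line0.
have Hh' : is_derive (g (x + (0 : R) *: v)) 1 h dh by rewrite scale0r addr0.
by have := @is_derive1_comp _ h (fun s : R => g (x + s *: v)) 0 _ _ Hh' Hg.
Qed.

End directional_derivatives.

(** * Differential calculus *)

Section C1_functions.
Context {R : realType}.
Local Notation V := 'rV[R]_4.
Local Notation e_ i := (delta_mx 0 i : V).
Implicit Types (f g h : V -> R) (df dg : 'I_4 -> V -> R).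

(** The partial derivatives are carried as data, so that derivatives of composite integrands are
    computed by rules and compared by [ring]. *)
Variant C1 g dg : Prop := IsC1 of cont g & (forall i, cont (dg i)) &
  (forall i x, is_derive x (e_ i) g (dg i x)).

Lemma C1_continuous g dg : C1 g dg -> cont g. Proof. by case. Qed.

Lemma C1_dcontinuous g dg i : C1 g dg -> cont (dg i). Proof. by case. Qed.

Lemma continuous_mul f g : cont f -> cont g -> cont (fun x => f x * g x).
Proof. by move=> [cf] [cg]; split=> x; apply: continuousM; [exact: cf|exact: cg]. Qed.

Lemma continuous_add f g : cont f -> cont g -> cont (fun x => f x + g x).
Proof. by move=> [cf] [cg]; split=> x; apply: continuousD; [exact: cf|exact: cg]. Qed.

Lemma continuous_opp f : cont f -> cont (fun x => - f x).
Proof. by move=> [cf]; split=> x; apply: continuousN; exact: cf. Qed.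

Lemma continuous_const (a : R) : cont (fun _ : V => a).
Proof. by split=> x; exact: cst_continuous. Qed.

Lemma continuous_sum (I : finType) (F : I -> V -> R) :
  (forall a, cont (F a)) -> cont (fun x => \sum_a F a x).
Proof.
move=> CF; suff H (s : seq I) : cont (fun x => \sum_(a <- s) F a x) by exact: H.
elim: s => [|a s IH].
  by under eq_fun do rewrite big_nil; exact: continuous_const.
by under eq_fun do rewrite big_cons; exact: continuous_add.
Qed.

Lemma continuous_pow f k : cont f -> cont (fun x => f x ^+ k).
Proof.
move=> cf; elim: k => [|k IH]; first by under eq_fun do rewrite expr0; exact: continuous_const.
by under eq_fun do rewrite exprS; exact: continuous_mul.
Qed.

Lemma continuous_real_comp (k : R -> R) g : cont g ->
  (forall x, {for g x, continuous k}) -> cont (fun x => k (g x)).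
Proof.
move=> [cg] ck; split=> x.
by apply: (@continuous_comp V R R g k x); [exact: cg|exact: ck].
Qed.

Lemma C1_eq g dg dg' : (forall i, dg i =1 dg' i) -> C1 g dg -> C1 g dg'.
Proof.
by move=> E [? ? ?]; split=> // [i|i x]; rewrite -?E// (_ : dg' i = dg i)//;
  apply/funext => y; rewrite E.
Qed.

Lemma C1_cst (a : R) : C1 (fun=> a) (fun _ _ => 0).
Proof.
split; [exact: continuous_const|move=> i; exact: continuous_const|].
by move=> i x; exact: is_derive_cst.
Qed.

Lemma C1_D f df g dg : C1 f df -> C1 g dg ->
  C1 (fun x => f x + g x) (fun i x => df i x + dg i x).
Proof.
move=> [cf cdf Df] [cg cdg Dg]; split; [exact: continuous_add|move=> i; exact: continuous_add|].
by move=> i x; apply: is_deriveD.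
Qed.

Lemma C1_M f df g dg : C1 f df -> C1 g dg ->
  C1 (fun x => f x * g x) (fun i x => df i x * g x + f x * dg i x).
Proof.
move=> [cf cdf Df] [cg cdg Dg]; split; [exact: continuous_mul| |].
  by move=> i; apply: continuous_add; exact: continuous_mul.
move=> i x; have H := is_deriveM (Df i x) (Dg i x); apply: (is_derive_eq H).
by rewrite addrC; congr (_ + _); rewrite [LHS]mulrC.
Qed.

Lemma C1_Z (a : R) g dg : C1 g dg -> C1 (fun x => a * g x) (fun i x => a * dg i x).
Proof.
by move=> Hg; apply: C1_eq (C1_M (C1_cst a) Hg) => i x /=; rewrite mul0r add0r.
Qed.

Lemma C1_comp (k dk : R -> R) g dg : C1 g dg ->
  (forall x, is_derive (g x) 1 k (dk (g x))) ->
  (forall x, {for g x, continuous dk}) ->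
  C1 (fun x => k (g x)) (fun i x => dk (g x) * dg i x).
Proof.
move=> [cg cdg Dg] Dk ck; split.
- apply: continuous_real_comp => // x.
  by have [/derivable1_diffP/differentiable_continuous] := Dk x.
- by move=> i; apply: continuous_mul => //; exact: continuous_real_comp.
- by move=> i x; apply: is_derive_comp_real.
Qed.

Lemma C1_coord (i : 'I_4) : C1 (fun x => x 0 i) (fun j _ => (j == i)%:R).
Proof.
split; [by split=> x; exact: coord_continuous|move=> j; exact: continuous_const|].
move=> j x; apply/is_derive_line0.
rewrite (_ : (fun s : R => _) = (cst (x 0 i) + (j == i)%:R \*: id)); last first.
  by apply/funext => s; rewrite !mxE eqxx /= mulrC eq_sym.
have H : is_derive (0 : R) 1 (cst (x 0 i) + (j == i)%:R \*: id) (0 + (j == i)%:R *: (1 : R)).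
  by apply: is_deriveD.
by apply: (is_derive_eq H); rewrite add0r [LHS]mulr1.
Qed.

Lemma C1_translate g dg (v : V) : C1 g dg -> C1 (fun x => g (x + v)) (fun i x => dg i (x + v)).
Proof.
have T (h : V -> R) : cont h -> cont (fun x : V => h (x + v)).
  move=> [ch]; split=> x; apply: (@continuous_comp V V R (fun y : V => y + v) h x); last exact: ch.
  by apply: continuousD; [exact: cvg_id|exact: cst_continuous].
move=> [cg cdg Dg]; split; [exact: T|move=> i; exact: T|].
move=> i x; apply/is_derive_line0.
rewrite (_ : (fun s : R => _) = (fun s : R => g ((x + v) + s *: e_ i))); last first.
  by apply/funext => s; rewrite addrAC.
exact/is_derive_line0.
Qed.

Lemma ccs_dC1 g dg i : C1 g dg -> ccs g -> ccs (dg i).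
Proof.
move=> [cg cdg Dg] [_ [r gr]]; split; first exact: cdg.
exists r => x rx; have [_ <-] := Dg i x.
rewrite -(@derive_cst R V R 0 x (e_ i)); apply: near_eq_derive.
near=> y; apply: gr; near: y.
have : open [set y : V | r < `|y|].
  rewrite (_ : mkset _ = Num.norm @^-1` `]r, +oo[%classic); last first.
    by apply/seteqP; split => z /=; rewrite in_itv /= andbT.
  by apply: open_comp; [move=> z _; exact: norm_continuous|exact: interval_open].
by move=> o; apply: open_nbhs_nbhs; split.
Unshelve. all: end_near.
Qed.

End C1_functions.
Arguments C1_dcontinuous {R g dg} i _.
Arguments ccs_dC1 {R g dg} i _ _.

Section integration_by_parts.
Context {R : realType}.
Local Notation V := 'rV[R]_4.
Local Notation e_ i := (delta_mx 0 i : V).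
Implicit Types (f g b c : V -> R) (df dg db dc : 'I_4 -> V -> R).

Lemma ccsMr f g : ccs f -> cont g -> ccs (fun x => f x * g x).
Proof. by move=> cf cg; apply: ccs_ext (ccsM cg cf) => x; rewrite mulrC. Qed.

Lemma bounded_on_normball g (r : R) : cont g ->
  exists2 M, 0 <= M & forall x, `|x| <= r -> `|g x| <= M.
Proof.
move=> [cg].
have cn : continuous (fun x => `|g x|).
  by move=> x; apply: (@continuous_comp V R R g Num.norm x); [exact: cg|exact: norm_continuous].
have [[x0 K0]|K0] := pselect ([set x : V | `|x| <= r] !=set0); last first.
  by exists 0 => // x rx; exfalso; apply: K0; exists x.
have [x _ hx] := @compact_EVT_max _ _ (fun x => `|g x|) _ (ex_intro _ x0 K0)
  (@compact_normball R r) (continuous_subspaceT cn).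
by exists `|g x| => // y yr; apply: hx; rewrite inE.
Qed.

Lemma is_derive_int4_translate c b db j (r : R) : cont c -> C1 b db ->
  (forall t, `|t| < 1 -> ccs (fun x => c x * b (x + t *: e_ j))) ->
  (forall t x, `|t| < 1 -> r < `|x| -> c x * db j (x + t *: e_ j) = 0) ->
  is_derive (0 : R) 1 (fun t => int4 (fun x => c x * b (x + t *: e_ j)))
    (int4 (fun x => c x * db j x)).
Proof.
move=> cc Cb h1 h2; have [A A0 cA] := bounded_on_normball r cc.
have [M M0 hM] := bounded_on_normball (r + `|e_ j|) (C1_dcontinuous j Cb).
have := @is_derive_int4 R (fun t x => c x * b (x + t *: e_ j))
  (fun t x => c x * db j (x + t *: e_ j)) 0 1 r (A * M) ltr01.
have -> : int4 (fun x => c x * db j (x + 0 *: e_ j)) = int4 (fun x => c x * db j x).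
  by apply: eq_int4 => x; rewrite scale0r addr0.
apply.
- by move=> t; rewrite subr0; exact: h1.
- move=> t x _; have [_ _ /(_ j (x + t *: e_ j))/is_derive_line Db] := Cb.
  have H := @is_deriveZ R R R _ (c x) t 1 _ Db.
  exact: H.
- by move=> t x; rewrite subr0; exact: h2.
move=> t x; rewrite subr0 => t1; have [xr|rx] := leP `|x| r; last first.
  by rewrite h2// normr0 mulr_ge0.
rewrite normrM ler_pM//; first exact: cA.
apply: hM; apply: le_trans (ler_normD _ _) _.
by apply: lerD => //; rewrite normrZ ler_piMl// ltW.
Qed.

(** The integral of g (x + t e_i) does not depend on t, and its derivative at t = 0 is the integral
    of [dg i]. *)
Lemma int4_div g dg i : C1 g dg -> ccs g -> int4 (dg i) = 0.
Proof.
move=> Cg cg; have [_ [r gr]] := cg.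
have [M M0 hM] := ccs_bounded (ccs_dC1 i Cg cg).
have dg0 x : r < `|x| -> dg i x = 0.
  move=> rx; have [_ _ Dg] := Cg; have [_ <-] := Dg i x.
  rewrite -(@derive_cst R V R 0 x (e_ i)); apply: near_eq_derive.
  near=> y; apply: gr; near: y.
  exact: (cvgr_gt `|x| (@norm_continuous _ V x)).
have := @is_derive_int4 R (fun t x => g (x + t *: e_ i))
  (fun t x => dg i (x + t *: e_ i)) 0 1 (r + `|e_ i|) M ltr01.
case.
- by move=> t _; exact: ccs_translate.
- by move=> t x _; have [_ _ /(_ i (x + t *: e_ i))/is_derive_line] := Cg.
- move=> t x; rewrite subr0 => t1 rx; apply: dg0.
  have := ler_normD (x + t *: e_ i) (- (t *: e_ i)); rewrite addrK normrN normrZ.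
  have : `|t| * `|e_ i| <= `|e_ i| by rewrite ler_piMl// ltW.
  lra.
- by move=> t x _; exact: hM.
move=> _.
rewrite (_ : (fun t : R => _) = cst (int4 g)); last first.
  by apply/funext => t; rewrite int4_translate.
rewrite derive_cst => ->; apply: eq_int4 => x; by rewrite scale0r addr0.
Unshelve. all: end_near.
Qed.

Lemma int4_by_parts f df g dg i : C1 f df -> C1 g dg -> ccs g ->
  int4 (fun x => df i x * g x) = - int4 (fun x => f x * dg i x).
Proof.
move=> Cf Cg cg; have := int4_div i (C1_M Cf Cg) (ccsM (C1_continuous Cf) cg).
have Cdf := C1_dcontinuous i Cf.
rewrite int4D; [|exact: ccsM|by apply: ccsM; [exact: C1_continuous Cf|exact: ccs_dC1 Cg cg]].
by move=> /eqP; rewrite addr_eq0 => /eqP.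
Qed.

(* A weak form of d_i d_j b = d_j d_i b: both sides are the derivative at t = 0 of
   the integral of (d_i c) b (. + t e_j). *)
Lemma int4_curl c dc b db i j : C1 c dc -> ccs c -> C1 b db ->
  int4 (fun x => dc i x * db j x) = int4 (fun x => dc j x * db i x).
Proof.
move=> Cc cc Cb.
have [cc' [r cr]] := cc; have [_ [r' cr']] := ccs_dC1 i Cc cc.
have [_ [r2 cr2]] := ccs_dC1 j Cc cc.
have cdb k := C1_dcontinuous k Cb.
have cdc k := C1_dcontinuous k Cc.
have CbT t := C1_translate (t *: e_ j) Cb.
have CcT t := C1_translate (t *: e_ j) Cc.
have D1 : is_derive (0 : R) 1 (fun t => int4 (fun x => dc i x * b (x + t *: e_ j)))
    (int4 (fun x => dc i x * db j x)).
  apply: (@is_derive_int4_translate _ _ _ _ r') => //.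
  - by move=> t _; apply: ccsMr; [exact: ccs_dC1 Cc cc|have [] := CbT t].
  - by move=> t x _ rx; rewrite cr' ?mul0r.
have D2 : is_derive (0 : R) 1 (fun t => int4 (fun x => db i x * c (x + t *: e_ j)))
    (int4 (fun x => db i x * dc j x)).
  apply: (@is_derive_int4_translate _ _ _ _ (r2 + `|e_ j|)) => //.
  - by move=> t _; apply: ccsM => //; exact: ccs_translate.
  - move=> t x t1 rx; rewrite cr2 ?mulr0//.
    have := ler_normD (x + t *: e_ j) (- (t *: e_ j)); rewrite addrK normrN normrZ.
    have : `|t| * `|e_ j| <= `|e_ j| by rewrite ler_piMl// ltW.
    lra.
(* Integration by parts moves the derivative in direction i onto the translate of b; a translation
   by - t e_j then moves the shift onto c, with the opposite sign. *)
have E t : int4 (fun x => dc i x * b (x + t *: e_ j)) =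
    - int4 (fun x => db i x * c (x + (- t) *: e_ j)).
  transitivity (- int4 (fun x => db i (x + t *: e_ j) * c x)).
    rewrite (int4_by_parts i (CbT t) Cc cc) opprK; apply: eq_int4 => x.
    by rewrite mulrC.
  congr (- _); rewrite -(@int4_translate _ (fun x => db i x * c (x + - t *: e_ j)) j t).
    by apply: eq_int4 => x; rewrite -addrA -scalerDl subrr scale0r addr0.
  by apply: ccsM => //; exact: ccs_translate.
pose H (t : R) := int4 (fun x => db i x * c (x + t *: e_ j)).
have D2' : is_derive (- (0 : R)) 1 H (int4 (fun x => db i x * dc j x)).
  by rewrite oppr0.
have D3 := is_deriveN (@is_derive1_comp R H -%R 0 _ _ D2' (is_deriveNid (0 : R) (1 : R))).
have [_ <-] := D1; rewrite (_ : (fun t : R => _) = - ((fun t : R =>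
   int4 (fun x => db i x * c (x + t *: e_ j))) \o -%R)); last exact/funext.
have [_ ->] := D3; rewrite mulrN1 opprK; apply: eq_int4 => x; exact: mulrC.
Qed.

End integration_by_parts.

(** * Radial cut-offs and the symmetry of second derivatives *)

Section bumps.
Context {R : realType}.
Local Notation V := 'rV[R]_4.

(** The k-th power of the positive part, of class C^(k - 1) for k >= 1. For k = 0 it is the constant
    1, even at negative arguments; statements about its support therefore start at [k.+1]. *)
Definition posp (k : nat) (a : R) : R := Num.max a 0 ^+ k.

Lemma posp_ge0 k a : 0 <= posp k a.
Proof. by rewrite exprn_ge0// le_max lexx orbT. Qed.

Lemma posp_le0 k a : a <= 0 -> posp k.+1 a = 0.
Proof. by move=> a0; rewrite /posp max_r// expr0n. Qed.

Lemma posp_gt0 k a : 0 < a -> posp k a = a ^+ k.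
Proof. by move=> a0; rewrite /posp max_l// ltW. Qed.

Lemma pospE k a : posp k a = posp 1 a ^+ k.
Proof. by rewrite /posp expr1. Qed.

Lemma posp_continuous k : continuous (posp k).
Proof.
move=> a.
have c1 : {for a, continuous (fun x : R => Num.max x 0)}.
  by apply: continuous_max; [exact: cvg_id|exact: cst_continuous].
elim: k => [|k IH].
  rewrite (_ : posp 0 = cst 1); first exact: cst_continuous.
  by apply/funext => x; rewrite /posp expr0.
rewrite (_ : posp k.+1 = fun x => Num.max x 0 * posp k x); last first.
  by apply/funext => x; rewrite /posp exprS.
exact: (@continuousM R R _ (posp k) a c1 IH).
Qed.

Lemma is_derive_posp (k : nat) (a : R) : is_derive a 1 (posp k.+2) (k.+2%:R * posp k.+1 a).
Proof.
have [a0|a0|->] := ltgtP a 0.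
- rewrite posp_le0 ?ltW// mulr0.
  apply: (@near_eq_is_derive _ _ _ (cst 0)).
  near=> b; rewrite posp_le0//; apply: ltW; near: b; exact: lt_nbhsl.
- rewrite posp_gt0//.
  apply: (@near_eq_is_derive _ _ _ (fun x : R => x ^+ k.+2)).
    near=> b; rewrite posp_gt0//; near: b; exact: lt_nbhsr.
  have H := @is_deriveX R R id k.+2 a 1 1 (is_derive_id _ _).
  rewrite (_ : (fun x : R => x ^+ k.+2) = id ^+ k.+2); last first.
    by apply/funext => x; rewrite exprfctE.
  by apply: (is_derive_eq H); rewrite [LHS]mulr1.
rewrite posp_le0// mulr0.
have L : (fun h : R => h^-1 *: ((posp k.+2 \o shift 0) (h *: 1) - posp k.+2 0)) @ 0^' --> (0 : R).
  apply/cvgrPdist_le => e e0; near=> h.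
  rewrite sub0r normrN posp_le0//= subr0 addr0 [h *: _]mulr1.
  have h0 : h != 0 by near: h; exact: nbhs_dnbhs_neq.
  have he : `|h| <= Num.min e 1.
    near: h; apply: dnbhs0_le; by rewrite lt_min e0 ltr01.
  move: he; rewrite le_min => /andP[he h1].
  rewrite normrM normfV ler_pdivrMl ?normr_gt0//.
  rewrite ger0_norm ?posp_ge0// /posp exprS.
  have m0 : 0 <= Num.max h 0 by rewrite le_max lexx orbT.
  have mh : Num.max h 0 <= `|h| by rewrite ge_max ler_norm normr_ge0.
  apply: ler_pM => //; first exact: exprn_ge0.
  have m1 := le_trans mh h1.
  by apply: le_trans he; apply: le_trans mh; rewrite exprS ler_piMr// exprn_ile1.
by split; [apply/cvg_ex; exists 0|exact/cvg_lim].
Unshelve. all: end_near.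
Qed.

(** Euclidean distances enter squared, so that they are polynomials. Accordingly the scales s, t, T
    below are squares of radii. *)
Definition sqd (p x : V) : R := \sum_i (x 0 i - p 0 i) ^+ 2.

Lemma sqd_ge0 p x : 0 <= sqd p x.
Proof. by apply: sumr_ge0 => i _; exact: sqr_ge0. Qed.

Lemma sqdxx p : sqd p p = 0.
Proof. by rewrite /sqd big1// => i _; rewrite subrr expr0n. Qed.

Lemma sqdC p x : sqd p x = sqd x p.
Proof. by apply: eq_bigr => i _; ring. Qed.

Lemma sqd_lt_norm p x (s : R) : sqd p x < s -> `|x| <= `|p| + `|s| + 1.
Proof.
move=> xs; rewrite -(subrK p x); apply: le_trans (ler_normD _ _) _.
rewrite addrC -addrA lerD2l leNgt; apply/negP => h.
have n0 : `|x - p| != 0 by rewrite gt_eqF//; apply: lt_trans h; rewrite ltr_wpDl.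
have := @mx_norm_neq0 _ _ _ (x - p) n0 => -[[i j] Eij].
have : `|s| + 1 < `|x 0 j - p 0 j| by move: h; rewrite [`|x - p|]Eij /= (ord1 i) !mxE.
have : (x 0 j - p 0 j) ^+ 2 <= sqd p x.
  by rewrite /sqd (bigD1 j)//= lerDl sumr_ge0// => k _; exact: sqr_ge0.
rewrite -[X in X ^+ 2 <= _]/(x 0 j - p 0 j) -(real_normK (num_real (x 0 j - p 0 j))).
set a := `|x 0 j - p 0 j| => ha h2; have := ler_norm s; have := normr_ge0 s => s1 s2.
nra.
Qed.

End bumps.

Section C2_functions.
Context {R : realType}.
Local Notation V := 'rV[R]_4.
Implicit Types (f h c : V -> R) (df dc : 'I_4 -> V -> R).
Implicit Types (ddf : 'I_4 -> 'I_4 -> V -> R).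

(* ddf i j stands for d_j d_i f. *)
Definition C2 f df ddf := C1 f df /\ forall i, C1 (df i) (ddf i).

Lemma C1_sum (I : finType) (F : I -> V -> R) (dF : I -> 'I_4 -> V -> R) :
  (forall a, C1 (F a) (dF a)) ->
  C1 (fun x => \sum_a F a x) (fun i x => \sum_a dF a i x).
Proof.
move=> CF.
suff H (s : seq I) : C1 (fun x => \sum_(a <- s) F a x) (fun i x => \sum_(a <- s) dF a i x).
  exact: H.
elim: s => [|a s IH].
  by rewrite (_ : (fun x => _) = fun=> 0); [apply: C1_eq (C1_cst 0) => i x;
    rewrite big_nil|apply/funext => x; rewrite big_nil].
rewrite (_ : (fun x => _) = fun x => F a x + \sum_(a <- s) F a x); last first.
  by apply/funext => x; rewrite big_cons.
by apply: C1_eq (C1_D (CF a) IH) => i x; rewrite big_cons.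
Qed.

Lemma ccs0 : ccs (fun _ : V => 0 : R).
Proof. by split; [exact: continuous_const|exists 0]. Qed.

Lemma ccs_sum (I : finType) (F : I -> V -> R) :
  (forall a, ccs (F a)) -> ccs (fun x => \sum_a F a x).
Proof.
move=> CF; suff H (s : seq I) : ccs (fun x => \sum_(a <- s) F a x) by exact: H.
elim: s => [|a s IH]; first by apply: ccs_ext ccs0 => x; rewrite big_nil.
by apply: ccs_ext (ccsD (CF a) IH) => x; rewrite big_cons.
Qed.

Lemma int4_0 : int4 (fun _ : V => 0 : R) = 0.
Proof.
by have := int4Z 0 ccs0; rewrite !mul0r.
Qed.

Lemma int4_sum (I : finType) (F : I -> V -> R) : (forall a, ccs (F a)) ->
  int4 (fun x => \sum_a F a x) = \sum_a int4 (F a).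
Proof.
move=> CF.
suff H (s : seq I) : ccs (fun x => \sum_(a <- s) F a x) /\
  int4 (fun x => \sum_(a <- s) F a x) = \sum_(a <- s) int4 (F a) by have [] := H (index_enum I).
elim: s => [|a s [IH1 IH2]].
  split; first by apply: ccs_ext ccs0 => x; rewrite big_nil.
  by rewrite big_nil -[RHS]int4_0; apply: eq_int4 => x; rewrite big_nil.
split; first by apply: ccs_ext (ccsD (CF a) IH1) => x; rewrite big_cons.
by rewrite big_cons -IH2 -int4D//; apply: eq_int4 => x; rewrite big_cons.
Qed.

Lemma C1_sqd (p : V) : C1 (sqd p) (fun i x => 2 * (x 0 i - p 0 i)).
Proof.
have Hi j : C1 (fun x : V => (x 0 j - p 0 j) ^+ 2)
    (fun i x => (i == j)%:R * (2 * (x 0 j - p 0 j))).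
  have H := C1_D (C1_coord j) (C1_cst (- p 0 j)).
  rewrite (_ : (fun x : V => (x 0 j - p 0 j) ^+ 2) =
    fun x => (x 0 j - p 0 j) * (x 0 j - p 0 j)); last by apply/funext => x; rewrite expr2.
  by apply: C1_eq (C1_M H H) => i x; rewrite addr0; ring.
apply: C1_eq (C1_sum Hi) => i x /=.
rewrite (bigD1 i)//= eqxx mul1r big1 ?addr0// => j ji.
by rewrite eq_sym (negbTE ji) mul0r.
Qed.

(** All cut-offs are powers of the one function [bump 1]. Cut-off terms in an integrand thus become
    monomials in a single nonnegative variable, and pointwise inequalities become polynomial
    ones. *)
Definition bump (k : nat) (p : V) (s : R) (x : V) : R := posp k (s - sqd p x).

Lemma bump_ge0 k p s x : 0 <= bump k p s x. Proof. exact: posp_ge0. Qed.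

Lemma bumpE k p s x : bump k p s x = bump 1 p s x ^+ k.
Proof. exact: pospE. Qed.

Lemma bump_out k p s x : s <= sqd p x -> bump k.+1 p s x = 0.
Proof. by move=> sx; rewrite /bump posp_le0// subr_le0. Qed.

Lemma bump_in k p s x : sqd p x < s -> bump k p s x = (s - sqd p x) ^+ k.
Proof. by move=> sx; rewrite /bump posp_gt0// subr_gt0. Qed.

Lemma bump1_le p s x : 0 <= s -> bump 1 p s x <= s.
Proof.
move=> s0; have [sx|sx] := ltP (sqd p x) s; last by rewrite bump_out.
by rewrite bump_in// expr1 lerBlDr lerDl sqd_ge0.
Qed.

Lemma bump_supp k p s x : bump k.+1 p s x != 0 -> sqd p x < s.
Proof. by move=> h; rewrite ltNge; apply/negP => /bump_out sx; rewrite sx eqxx in h. Qed.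

Lemma bump_continuous k p s : cont (bump k p s).
Proof.
apply: continuous_real_comp; last by move=> x; exact: posp_continuous.
apply: continuous_add; first exact: continuous_const.
by apply: continuous_opp; exact: C1_continuous (C1_sqd p).
Qed.

Lemma ccs_bump k p s : ccs (bump k.+1 p s).
Proof.
split; first exact: bump_continuous.
exists (`|p| + `|s| + 1) => x; rewrite ltNge => /negP h.
by rewrite bump_out// leNgt; apply/negP => /sqd_lt_norm.
Qed.

Lemma C1_bump k p s : C1 (bump k.+2 p s)
  (fun i x => - (2 * k.+2%:R * bump k.+1 p s x * (x 0 i - p 0 i))).
Proof.
have H := C1_D (C1_cst s) (C1_Z (-1) (C1_sqd p)).
have E x : s - sqd p x = s + -1 * sqd p x by rewrite mulN1r.
rewrite (_ : bump k.+2 p s = fun x => posp k.+2 (s + -1 * sqd p x)); last first.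
  by apply/funext => x; rewrite /bump E.
apply: C1_eq (@C1_comp R (posp k.+2) (fun a => k.+2%:R * posp k.+1 a) _ _ H _ _).
- by move=> i x; rewrite /bump E; ring.
- by move=> x; exact: is_derive_posp.
- move=> x; apply: (@continuousM R R (cst k.+2%:R)); first exact: cst_continuous.
  exact: posp_continuous.
Qed.

Lemma C2_bump k p s : C2 (bump k.+3 p s)
  (fun i x => - (2 * k.+3%:R * bump k.+2 p s x * (x 0 i - p 0 i)))
  (fun i j x => 2 * k.+3%:R * (2 * k.+2%:R * bump k.+1 p s x * (x 0 j - p 0 j) * (x 0 i - p 0 i)
     - bump k.+2 p s x * (j == i)%:R)).
Proof.
split; first exact: C1_bump.
move=> i; have H := C1_M (C1_bump k p s) (C1_D (C1_coord i) (C1_cst (- p 0 i))).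
rewrite (_ : (fun x => _) = fun x => (- (2 * k.+3%:R)) * (bump k.+2 p s x * (x 0 i - p 0 i))).
  apply: C1_eq (C1_Z _ H) => j x /=.
  ring.
by apply/funext => x; ring.
Qed.

Lemma C2_cross f df ddf c dc i j : C2 f df ddf -> C1 c dc -> ccs c ->
  int4 (fun x => c x * ddf i j x) = int4 (fun x => c x * ddf j i x).
Proof.
move=> [Cf Cdf] Cc cc.
have P k l : int4 (fun x => c x * ddf k l x) = - int4 (fun x => dc l x * df k x).
  transitivity (int4 (fun x => ddf k l x * c x)).
    by apply: eq_int4 => x; rewrite mulrC.
  by rewrite (int4_by_parts l (Cdf k) Cc cc); congr (- _); apply: eq_int4 => x; rewrite mulrC.
by rewrite !P (int4_curl _ _ Cc cc Cf).
Qed.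

Lemma sqd_small_ball (p : V) (A : set V) : nbhs p A ->
  exists2 s, 0 < s & forall x, sqd p x < s -> A x.
Proof.
move=> /nbhs_ballP [e /= e0 be]; exists (e ^+ 2); first exact: exprn_gt0.
move=> x xs; apply: be; split => // i j; rewrite (ord1 i) /ball /= distrC.
have : (x 0 j - p 0 j) ^+ 2 < e ^+ 2.
  apply: le_lt_trans xs; rewrite /sqd (bigD1 j)//= lerDl sumr_ge0// => k _; exact: sqr_ge0.
by rewrite -[X in X ^+ 2 < _ -> _]/(x 0 j - p 0 j) -(real_normK (num_real (x 0 j - p 0 j))) ltr_pXn2r ?nnegrE// ltW.
Qed.

(** If the mixed derivatives differed at x, their difference would keep a sign near x, and testing
    it with a bump there would contradict the weak symmetry [C2_cross]. *)
Lemma C2_sym f df ddf i j x : C2 f df ddf -> ddf i j x = ddf j i x.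
Proof.
move=> Cf; have [_ Cdf] := Cf.
suff W k l : ddf k l x <= ddf l k x by apply/eqP; rewrite eq_le !W.
rewrite leNgt; apply/negP => lt0.
have cd : cont (fun y => ddf k l y - ddf l k y).
  by apply: continuous_add; [|apply: continuous_opp]; apply: C1_dcontinuous (Cdf _).
have /sqd_small_ball [s s0 hs] : \forall y \near x, 0 < ddf k l y - ddf l k y.
  have [cd'] := cd; by apply: (cvgr_gt _ (cd' x)); rewrite subr_gt0.
have /eqP := C2_cross k l Cf (C1_bump 0 x s) (ccs_bump 1 x s).
rewrite -subr_eq0 -int4B; last 2 first.
- by apply: ccsMr; [exact: ccs_bump|exact: C1_dcontinuous (Cdf _)].
- by apply: ccsMr; [exact: ccs_bump|exact: C1_dcontinuous (Cdf _)].
apply/negP; rewrite gt_eqF//.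
rewrite (@eq_int4 _ _ (fun y => bump 2 x s y * (ddf k l y - ddf l k y))); last first.
  by move=> y; rewrite mulrBr.
apply: (@int4_gt0 _ _ x).
- by apply: ccsMr => //; exact: ccs_bump.
- move=> y; have [ys|ys] := ltP (sqd x y) s; last by rewrite bump_out// mul0r.
  by rewrite mulr_ge0 ?bump_ge0// ltW// hs.
- by rewrite bump_in sqdxx ?subr0// mulr_gt0 ?exprn_gt0// subr_gt0.
Qed.

End C2_functions.

Ltac continuous_atom := match goal with
  | H : cont _ |- _ => exact H
  | H : ccs _ |- _ => exact (ccs_cont H)
  | H : C1 _ _ |- _ => exact (C1_continuous H)
  | H : forall i, cont _ |- _ => exact (H _)
  | H : forall i, ccs _ |- _ => exact (ccs_cont (H _))
  | H : forall i j, cont _ |- _ => exact (H _ _)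
  | H : forall i j, ccs _ |- _ => exact (ccs_cont (H _ _))
  | |- _ => exact (bump_continuous _ _ _)
  | |- _ => exact (continuous_const _)
  end.

Ltac ctac := lazymatch goal with
  | |- cont (fun x => @?f x + @?g x) => refine (@continuous_add _ f g _ _); ctac
  | |- cont (fun x => - @?f x) => refine (@continuous_opp _ f _); ctac
  | |- cont (fun x => @?f x * @?g x) => refine (@continuous_mul _ f g _ _); ctac
  | |- cont (fun x => @?f x ^+ ?k) => refine (@continuous_pow _ f k _); ctac
  | |- _ => first [ continuous_atom | refine (continuous_sum _); intro; ctac ]
  end.

Ltac ccs_atom := match goal with
  | H : ccs _ |- _ => exact H
  | H : forall i, ccs _ |- _ => exact (H _)
  | H : forall i j, ccs _ |- _ => exact (H _ _)
  | |- _ => exact (ccs_bump _ _ _)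
  end.

(** In a product either factor may carry the compact support; the left one is tried first. *)
Ltac cctac := lazymatch goal with
  | |- ccs (fun x => @?f x + @?g x) => refine (@ccsD _ f g _ _); cctac
  | |- ccs (fun x => - @?f x) => refine (@ccsN _ f _); cctac
  | |- ccs (fun x => @?f x * @?g x) => first
     [ refine (@ccsMr _ f g _ _); [cctac | ctac] | refine (@ccsM _ f g _ _); [ctac | cctac] ]
  | |- _ => first [ ccs_atom | refine (ccs_sum _); intro; cctac ]
  end.

(** * The divergence identity for sigma_2 *)

Lemma sum4 (R : nmodType) (F : 'I_4 -> R) :
  \sum_i F i = F (inord 0) + F (inord 1) + F (inord 2) + F (inord 3).
Proof.
rewrite 4!big_ord_recl big_ord0 /= addr0 !addrA.
by congr (_ + _ + _ + _); congr F; apply/val_inj; rewrite /= inordK.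
Qed.

Section sigma2_identity.
Context {R : realType}.
Local Notation V := 'rV[R]_4.
Implicit Types (a b df : 'I_4 -> V -> R) (h ddf : 'I_4 -> 'I_4 -> V -> R).

Definition dotp a b x : R := \sum_i a i x * b i x.
Definition lap h x : R := \sum_i h i i x.
Definition hes h a b x : R := \sum_i \sum_j h i j x * a i x * b j x.

(* Twice sigma_2 of the tensor D^2 f + df (x) df - |df|^2 / 2. *)
Definition twice_sigma2 df ddf x : R :=
  lap ddf x ^+ 2 - \sum_i \sum_j ddf i j x ^+ 2
  - dotp df df x * lap ddf x - 2 * hes ddf df df x.

(** Here a = df, H = D^2 f, e = eta, b = d eta and E = D^2 eta. The right side collects what
    integrates to zero. With z_i = P e a_i, the double sum consists of the null terms d_i z_i d_j
    a_j - d_j z_i d_i a_j; the single sum is the divergence of the field [W] in the next proof. *)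
Lemma divergence_algebra (P P' e : R) (a b : 'I_4 -> R) (H E : 'I_4 -> 'I_4 -> R) :
  (forall i j, H i j = H j i) ->
  let N := \sum_i a i * a i in let D := \sum_i a i * b i in
  let L := \sum_i H i i in let Q := \sum_i \sum_j H i j * a i * a j in
  ((L ^+ 2 - \sum_i \sum_j H i j ^+ 2 - N * L - 2 * Q) * P * e) -
  (P * (\sum_i \sum_j E i j * a i * a j - N * \sum_i E i i + N * D)
   + - P' * e * (L * N - Q - N ^+ 2)) =
  \sum_i \sum_j (((P' * a i * e + P * b i) * a i + P * e * H i i) * H j j
               - ((P' * a j * e + P * b j) * a i + P * e * H i j) * H j i)
  + \sum_i (- (((P' * a i * e + P * b i) * N + P * e * (\sum_j (H j i * a j + a j * H j i))) * a i
       + P * e * N * H i i)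
    - ((P' * a i * D + P * \sum_j (H j i * b j + a j * E j i)) * a i + P * D * H i i)
    + ((P' * a i * N + P * (\sum_j (H j i * a j + a j * H j i))) * b i + P * N * E i i)).
Proof.
move=> sym /=; rewrite !sum4.
rewrite (sym (inord 1) (inord 0)) (sym (inord 2) (inord 0)) (sym (inord 3) (inord 0)).
rewrite (sym (inord 2) (inord 1)) (sym (inord 3) (inord 1)) (sym (inord 3) (inord 2)).
ring.
Qed.

(* Formally twice sigma_2 is the divergence of (Delta f) df - D^2 f df - |df|^2 df, so
   that a double integration by parts leaves only first derivatives of f against
   P, and the full Newton tensor against P'. *)
Lemma int4_twice_sigma2 f df ddf P P' eta deta ddeta :
  C2 f df ddf -> C1 P (fun i x => P' x * df i x) -> cont P' ->
  C2 eta deta ddeta -> ccs eta ->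
  int4 (fun x => twice_sigma2 df ddf x * P x * eta x) =
  int4 (fun x => P x * (hes ddeta df df x - dotp df df x * lap ddeta x
                        + dotp df df x * dotp df deta x)) +
  int4 (fun x => - P' x * eta x *
    (lap ddf x * dotp df df x - hes ddf df df x - dotp df df x ^+ 2)).
Proof.
move=> Cf CP cP' Ce cce; have [Cf1 Cdf] := Cf; have [Ce1 Cde] := Ce.
have cdf i : cont (df i) by exact: C1_dcontinuous Cf1.
have cddf i j : cont (ddf i j) by exact: C1_dcontinuous (Cdf i).
have cdeta i : ccs (deta i) by exact: ccs_dC1 Ce1 cce.
have cddeta i j : ccs (ddeta i j) by exact: ccs_dC1 (Cde i) (cdeta i).
have cP := C1_continuous CP.
have CN : C1 (dotp df df) (fun k x => \sum_j (ddf j k x * df j x + df j x * ddf j k x)).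
  by apply: C1_sum => j; exact: C1_M.
have CD : C1 (dotp df deta) (fun k x => \sum_j (ddf j k x * deta j x + df j x * ddeta j k x)).
  by apply: C1_sum => j; exact: C1_M.
have cN := C1_continuous CN.
have ccD : ccs (dotp df deta) by apply: ccs_sum => i; exact: ccsM.
have clap : cont (lap ddf) by rewrite /lap; ctac.
have ches : cont (hes ddf df df) by rewrite /hes; ctac.
have cS : cont (twice_sigma2 df ddf).
  rewrite /twice_sigma2.
  have c2 : cont (fun x => \sum_i \sum_j ddf i j x ^+ 2) by ctac.
  ctac.
(* These are the terms that would formally produce third derivatives of f. [int4_curl] applied to z
   = P eta df_i and b = df_j makes each of them integrate to zero using only first derivatives of
   df_j. *)
pose T i j x := ((P' x * df i x * eta x + P x * deta i x) * df i x + P x * eta x * ddf i i x)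
    * ddf j j x
  - ((P' x * df j x * eta x + P x * deta j x) * df i x + P x * eta x * ddf i j x) * ddf j i x.
have cT i j : ccs (T i j) by rewrite /T; cctac.
have T0 i j : int4 (T i j) = 0.
  have Cz : C1 (fun x => P x * eta x * df i x)
      (fun k x => (P' x * df k x * eta x + P x * deta k x) * df i x + P x * eta x * ddf i k x).
    by apply: C1_M => //; exact: C1_M.
  rewrite /T int4B; [|cctac|cctac].
  have cz : ccs (fun x => P x * eta x * df i x) by cctac.
  by rewrite (int4_curl i j Cz cz (Cdf j)) subrr.
(* The other terms form the divergence of a field built from first derivatives of f and eta, which
   is C^1 and can be integrated directly. *)
pose W i x := - (P x * eta x * dotp df df x * df i x)
  - P x * dotp df deta x * df i x + P x * dotp df df x * deta i x.
pose dW i x :=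
  - (((P' x * df i x * eta x + P x * deta i x) * dotp df df x
       + P x * eta x * (\sum_j (ddf j i x * df j x + df j x * ddf j i x))) * df i x
       + P x * eta x * dotp df df x * ddf i i x)
    - ((P' x * df i x * dotp df deta x
         + P x * \sum_j (ddf j i x * deta j x + df j x * ddeta j i x)) * df i x
       + P x * dotp df deta x * ddf i i x)
    + ((P' x * df i x * dotp df df x
         + P x * (\sum_j (ddf j i x * df j x + df j x * ddf j i x))) * deta i x
       + P x * dotp df df x * ddeta i i x).
have W0 i : int4 (dW i) = 0 /\ ccs (dW i).
  have CW := C1_D (C1_D
    (C1_Z (-1) (C1_M (C1_M (C1_M CP Ce1) CN) (Cdf i)))
    (C1_Z (-1) (C1_M (C1_M CP CD) (Cdf i)))) (C1_M (C1_M CP CN) (Cde i)).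
  have cW : ccs (fun x => -1 * (P x * eta x * dotp df df x * df i x) +
       -1 * (P x * dotp df deta x * df i x) + P x * dotp df df x * deta i x).
    by cctac.
  have -> : dW i = (fun x => (fun i' x => -1 * ((((P' x * df i' x) * eta x + P x * deta i' x) * dotp df df x
      + P x * eta x * (\sum_j (ddf j i' x * df j x + df j x * ddf j i' x))) * df i x
      + P x * eta x * dotp df df x * ddf i i' x) +
     -1 * ((P' x * df i' x * dotp df deta x + P x * \sum_j (ddf j i' x * deta j x + df j x * ddeta j i' x)) * df i x
       + P x * dotp df deta x * ddf i i' x)
     + ((P' x * df i' x * dotp df df x
         + P x * (\sum_j (ddf j i' x * df j x + df j x * ddf j i' x))) * deta i x
       + P x * dotp df df x * ddeta i i' x)) i x).
    by apply/funext => x; rewrite /dW; ring.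
  by split; [exact: int4_div CW cW|exact: ccs_dC1 CW cW].
apply/eqP; rewrite -subr_eq0 -int4D; [|by rewrite /hes /lap; cctac|by cctac].
rewrite -int4B; [|by cctac|].
  rewrite (@eq_int4 _ _ (fun x => \sum_i \sum_j T i j x + \sum_i dW i x)); last first.
    move=> x; apply: (divergence_algebra (P x) (P' x) (eta x) (df^~ x) (deta^~ x)
      (fun i j => ddeta i j x)) => i j; exact: C2_sym Cf.
  have cTT i : ccs (fun x => \sum_j T i j x) by cctac.
  have cdW i : ccs (dW i) by have [] := W0 i.
  rewrite int4D; [|cctac|cctac].
  rewrite !int4_sum// big1 ?add0r; last by move=> i _; rewrite int4_sum// big1.
  by rewrite big1// => i _; have [] := W0 i.
rewrite /hes /lap; cctac.
Qed.

End sigma2_identity.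

(** * Caccioppoli and weighted energy inequalities *)

Section caccioppoli.
Context {R : realType}.
Local Notation V := 'rV[R]_4.
Implicit Types (df : 'I_4 -> V -> R) (ddf : 'I_4 -> 'I_4 -> V -> R) (p : V).

Definition rad p (i : 'I_4) (x : V) : R := x 0 i - p 0 i.

Lemma dotp_ge0 df x : 0 <= dotp df df x.
Proof. by apply: sumr_ge0 => i _; rewrite -expr2 sqr_ge0. Qed.

Lemma dotp_young (a b : 'I_4 -> V -> R) x (t : R) :
  2 * t * dotp a b x <= t ^+ 2 * dotp a a x + dotp b b x.
Proof.
have : 0 <= \sum_i (t * a i x - b i x) ^+ 2 by apply: sumr_ge0 => i _; exact: sqr_ge0.
rewrite /dotp !sum4; lra.
Qed.

Lemma dotp_rad p x : dotp (rad p) (rad p) x = sqd p x.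
Proof. by apply: eq_bigr => i _; rewrite -expr2. Qed.

Lemma cont_rad p i : cont (rad p i).
Proof.
by apply: continuous_add; [exact: C1_continuous (C1_coord i)|exact: continuous_const].
Qed.

Lemma cont_sqd p : cont (sqd p).
Proof. exact: C1_continuous (C1_sqd p). Qed.

Lemma C1_expR (g : V -> R) dg : C1 g dg ->
  C1 (fun x => expR (g x)) (fun i x => expR (g x) * dg i x).
Proof.
move=> Cg; apply: (@C1_comp R expR expR _ _ Cg) => x.
exact: continuous_expR.
Qed.

(** The divergence of w u^4 df integrates to zero, where w is the exponential and u = [bump 1 p s].
    As lap f >= |df|^2 and c <= 1/2, half of w u^4 |df|^2 survives; Young's inequality spends a
    quarter of it on the cut-off term 8 u^3 df . (x - p). *)
Lemma caccioppoli f df ddf p s (c k : R) : C2 f df ddf -> 0 <= c <= 2^-1 ->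
  (forall x, sqd p x < s -> dotp df df x <= lap ddf x) ->
  int4 (fun x => expR (c * (k - f x)) * dotp df df x * bump 4 p s x) <=
  256 * int4 (fun x => expR (c * (k - f x)) * sqd p x * bump 2 p s x).
Proof.
move=> [Cf Cdf] /andP[c0 c2] hN.
pose w x := expR (c * (k - f x)).
have Cw : C1 w (fun i x => - (c * w x * df i x)).
  have H := C1_expR (C1_Z c (C1_D (C1_cst k) (C1_Z (-1) Cf))).
  rewrite (_ : w = fun x => expR (c * (k + -1 * f x))); last first.
    by apply/funext => x; rewrite /w mulN1r.
  by apply: C1_eq H => i x; ring.
have cdf i : cont (df i) by exact: C1_dcontinuous Cf.
have cddf i j : cont (ddf i j) by exact: C1_dcontinuous (Cdf i).
have cs := cont_sqd p; have cr := cont_rad p.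
pose X i x := (- (c * w x * df i x) * df i x + w x * ddf i i x) * bump 4 p s x
  + w x * df i x * (- (2 * 4 * bump 3 p s x * rad p i x)).
have cX i : ccs (X i) by rewrite /X; cctac.
have X0 i : int4 (X i) = 0.
  have H := C1_M (C1_M Cw (Cdf i)) (C1_bump 2 p s).
  have cW : ccs (fun x => w x * df i x * bump 4 p s x) by cctac.
  exact: int4_div i H cW.
have SX : int4 (fun x => \sum_i X i x) = 0 by rewrite int4_sum// big1.
have cN : cont (dotp df df) by rewrite /dotp; ctac.
have c1 : ccs (fun x => w x * dotp df df x * bump 4 p s x) by cctac.
have c3 : ccs (fun x => w x * sqd p x * bump 2 p s x) by cctac.
have cSX : ccs (fun x => \sum_i X i x) by cctac.
have : int4 (fun x => 4^-1 * (w x * dotp df df x * bump 4 p s x)) <=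
  int4 (fun x => \sum_i X i x + 64 * (w x * sqd p x * bump 2 p s x)).
  apply: int4_le; [by apply: ccsZ|by apply: ccsD => //; apply: ccsZ|].
  move=> x; have w0 : 0 < w x by exact: expR_gt0.
  have -> : \sum_i X i x = w x * ((lap ddf x - c * dotp df df x) * bump 4 p s x
     - 8 * bump 3 p s x * dotp df (rad p) x).
    by rewrite /X /lap /dotp !sum4; ring.
  have [xs|sx] := ltP (sqd p x) s; last by rewrite !bump_out//; lra.
  (* With t = u / 16, multiplication by 64 u^2 gives 8 u^3 D <= u^4 N / 4 + 64 u^2 q. *)
  have := dotp_young df (rad p) x (bump 1 p s x / 16); rewrite dotp_rad.
  rewrite !(bumpE 4) !(bumpE 3) !(bumpE 2).
  set u := bump 1 p s x; have u0 : 0 <= u by exact: bump_ge0.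
  have := hN x xs; have := dotp_ge0 df x; have := sqd_ge0 p x.
  set q := sqd p x; set N := dotp df df x; set L := lap ddf x; set D := dotp df (rad p) x.
  move=> q0 N0 NL Y.
  suff : 4^-1 * N * u ^+ 4 <= (L - c * N) * u ^+ 4 - 8 * u ^+ 3 * D + 64 * q * u ^+ 2.
    by move=> /(ler_wpM2l (ltW w0)); lra.
  have Y2 : 64 * u ^+ 2 * (2 * (u / 16) * D) <= 64 * u ^+ 2 * ((u / 16) ^+ 2 * N + q).
    by apply: ler_wpM2l => //; rewrite mulr_ge0// exprn_ge0.
  have h4 : 0 <= u ^+ 4 by rewrite exprn_ge0.
  have h : 0 <= (L - c * N - 2^-1 * N) * u ^+ 4 by apply: mulr_ge0 => //; nra.
  lra.
rewrite int4Z// int4D// ?SX; last exact: ccsZ.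
rewrite int4Z//; lra.
Qed.

End caccioppoli.

Section weights.
Context {R : realType}.
Local Notation V := 'rV[R]_4.
Implicit Types (df : 'I_4 -> V -> R) (p : V).

Lemma cont_inv (g : V -> R) : cont g -> (forall x, g x != 0) -> cont (fun x => (g x)^-1).
Proof. by move=> cg g0; apply: continuous_real_comp => // x; exact: inv_continuous. Qed.

Lemma C1_inv (g : V -> R) dg : C1 g dg -> (forall x, 0 < g x) ->
  C1 (fun x => (g x)^-1) (fun i x => - (g x)^-1 ^+ 2 * dg i x).
Proof.
move=> Cg g0; apply: (@C1_comp R (fun a => a^-1) (fun a => - a^-1 ^+ 2) _ _ Cg) => x.
  have g1 : g x != 0 by rewrite gt_eqF.
  have H := @is_deriveV R id (g x) 1 1 g1 (is_derive_id _ _).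
  by apply: (is_derive_eq H); rewrite [LHS]mulr1 exprVn.
apply: (@continuousN R R R (fun a : R => a^-1 ^+ 2)).
have c1 : {for g x, continuous (fun a : R => a^-1)} by apply: inv_continuous; rewrite gt_eqF.
rewrite (_ : (fun a : R => a^-1 ^+ 2) = fun a => a^-1 * a^-1); last first.
  by apply/funext => a; rewrite expr2.
exact: (@continuousM R R _ _ (g x) c1 c1).
Qed.

Lemma C1_ln (g : V -> R) dg : C1 g dg -> (forall x, 0 < g x) ->
  C1 (fun x => ln (g x)) (fun i x => (g x)^-1 * dg i x).
Proof.
move=> Cg g0; have := @C1_comp R (@ln R) (fun a : R => a^-1) _ _ Cg.
apply=> x.
  exact: is_derive1_ln.
by apply: inv_continuous; rewrite gt_eqF.
Qed.

(* The exponent is small enough for the Hessian of the weight to dominate the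
   cubic term |df|^2 df . d(weight) of the divergence identity. *)
Definition kappa : R := 64^-1.

(* (s + |x - p|^2)^(- kappa) *)
Definition weight p (s : R) (x : V) : R := expR (- kappa * ln (s + sqd p x)).

Lemma weight_gt0 p s x : 0 < weight p s x. Proof. exact: expR_gt0. Qed.

Lemma C1_weight p s : 0 < s -> C1 (weight p s)
  (fun i x => - (2 * kappa) * weight p s x * (s + sqd p x)^-1 * rad p i x).
Proof.
move=> s0; have a0 x : 0 < s + sqd p x by rewrite ltr_pwDl// sqd_ge0.
have H := C1_expR (C1_Z (- kappa) (C1_ln (C1_D (C1_cst s) (C1_sqd p)) a0)).
by apply: C1_eq H => i x /=; rewrite /weight /rad; ring.
Qed.

Definition wbump p s t x := weight p s x * bump 4 p t x.

(** Radial derivatives: the gradient of [wbump] is [wbump1] times x - p, and its Hessian is [wbump2]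
    times the tensor square of x - p plus [wbump1] times the identity. *)
Definition wbump1 p s t x :=
  - weight p s x * (2 * kappa * (s + sqd p x)^-1 * bump 4 p t x + 8 * bump 3 p t x).

Definition wbump2 p s t x :=
  weight p s x * (4 * kappa * (kappa + 1) * (s + sqd p x)^-1 ^+ 2 * bump 4 p t x
    + 32 * kappa * (s + sqd p x)^-1 * bump 3 p t x + 48 * bump 2 p t x).

Lemma C2_wbump p s t : 0 < s -> C2 (wbump p s t)
  (fun i x => wbump1 p s t x * rad p i x)
  (fun i j x => wbump2 p s t x * rad p j x * rad p i x + wbump1 p s t x * (j == i)%:R).
Proof.
move=> s0; have a0 x : 0 < s + sqd p x by rewrite ltr_pwDl// sqd_ge0.
have Cw := C1_weight p s0; have Ca := C1_inv (C1_D (C1_cst s) (C1_sqd p)) a0.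
split=> [|i].
  by apply: C1_eq (C1_M Cw (C1_bump 2 p t)) => i x; rewrite /wbump1 /rad; ring.
have Cr : C1 (rad p i) (fun j _ => (j == i)%:R).
  by apply: C1_eq (C1_D (C1_coord i) (C1_cst (- p 0 i))) => j x; rewrite addr0.
have H := C1_M (C1_M (C1_Z (-1) Cw) (C1_D
  (C1_Z (2 * kappa) (C1_M Ca (C1_bump 2 p t))) (C1_Z 8 (C1_bump 1 p t)))) Cr.
rewrite (_ : (fun x => _) = fun x => -1 * weight p s x *
  (2 * kappa * ((s + sqd p x)^-1 * bump 4 p t x) + 8 * bump 3 p t x) * rad p i x).
  by apply: C1_eq H => j x; rewrite /wbump2 /wbump1 /rad; ring.
by apply/funext => x; rewrite /wbump1; ring.
Qed.

Lemma ccs_wbump p s t : 0 < s -> ccs (wbump p s t).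
Proof.
move=> s0; have := C1_continuous (C1_weight p s0) => cw.
rewrite /wbump; cctac.
Qed.

Lemma hes_wbump df p s t x :
  hes (fun i j x => wbump2 p s t x * rad p j x * rad p i x + wbump1 p s t x * (j == i)%:R)
    df df x = wbump2 p s t x * dotp df (rad p) x ^+ 2 + wbump1 p s t x * dotp df df x.
Proof.
rewrite /hes /dotp.
have -> : \sum_i \sum_j (wbump2 p s t x * rad p j x * rad p i x + wbump1 p s t x * (j == i)%:R)
    * df i x * df j x = \sum_i (\sum_j wbump2 p s t x * (df i x * rad p i x) * (df j x * rad p j x)
       + wbump1 p s t x * (df i x * df i x)).
  apply: eq_bigr => i _; rewrite (bigD1 i)//= [in RHS](bigD1 i)//= eqxx mulr1.
  rewrite (eq_bigr (fun j => wbump2 p s t x * (df i x * rad p i x) * (df j x * rad p j x))).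
    by ring.
  by move=> j /negbTE ->; rewrite mulr0 addr0; ring.
rewrite big_split/= -mulr_sumr expr2; congr (_ + _).
under eq_bigr do rewrite -mulr_sumr.
by rewrite -mulr_suml -mulr_sumr mulrA.
Qed.

Lemma lap_wbump p s t x :
  lap (fun i j x => wbump2 p s t x * rad p j x * rad p i x + wbump1 p s t x * (j == i)%:R) x
  = wbump2 p s t x * sqd p x + 4 * wbump1 p s t x.
Proof.
rewrite /lap -dotp_rad /dotp !sum4 !eqxx !mulr1; ring.
Qed.

Lemma dotp_wbump df p s t x :
  dotp df (fun i x => wbump1 p s t x * rad p i x) x = wbump1 p s t x * dotp df (rad p) x.
Proof. by rewrite /dotp mulr_sumr; apply: eq_bigr => i _; ring. Qed.

End weights.

Ltac nneg := repeat first
  [ assumption | exact: ler0n | exact: ler01 | exact: sqr_ge0 | apply: mulr_ge0 | apply: addr_ge0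
  | apply: exprn_ge0 | rewrite invr_ge0 | (apply: ltW; assumption) ].

Section weighted_energy_inequality.
Context {R : realType}.
Local Notation V := 'rV[R]_4.
Implicit Types (df : 'I_4 -> V -> R) (ddf : 'I_4 -> 'I_4 -> V -> R).

(* The second inequality says that the Newton tensor sigma_1 I - A is
   nonnegative in the direction df. *)
Definition gamma2_on (U : set V) df ddf := forall x, U x ->
  [/\ dotp df df x <= lap ddf x,
      3 / 2 * dotp df df x ^+ 2 <= lap ddf x * dotp df df x - hes ddf df df x
    & 0 <= twice_sigma2 df ddf x].

(** Here N = |df|^2, q = |x - p|^2, a = s + q, u is [bump 1], D = df . (x - p), m = - P' / P and th
    = tau exp ((k - f) / 4). The weight contributes kappa (6 - 4 (kappa + 1)) u^4 N / a, which is
    positive. The terms cubic in df are split by Young's inequality between m N^2, which the Newton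
    tensor supplies, and multiples of N. *)
Lemma weight_algebra (N q a u th m D : R) : 0 <= N -> 0 <= q -> q <= a -> 0 < a ->
  0 <= u -> 0 <= th -> m * (4 * (1 + th)) = 1 ->
  (forall t, 2 * t * D <= t ^+ 2 * N + q) ->
  3 / 2 * kappa * (u ^+ 4 / a * N) <=
    (4 * kappa * (kappa + 1) * a^-1 ^+ 2 * u ^+ 4 + 32 * kappa * a^-1 * u ^+ 3 + 48 * u ^+ 2)
      * (D ^+ 2 - N * q)
    + 3 * (2 * kappa * a^-1 * u ^+ 4 + 8 * u ^+ 3) * N
    - (2 * kappa * a^-1 * u ^+ 4 + 8 * u ^+ 3) * N * D
    + m * u ^+ 4 * N ^+ 2 / 2
    + kappa / 4 * (th * (u ^+ 4 / a * N)) + 304 * ((1 + th) * (q * u ^+ 2 * N)).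
Proof.
move=> N0 q0 qa a0 u0 th0 mE Y.
set b := a^-1; have b0 : 0 < b by rewrite invr_gt0.
have ab : a * b = 1 by rewrite divff// gt_eqF.
have qb : q * b <= 1 by rewrite -ab ler_wpM2r// ltW.
rewrite /kappa; set k : R := 64^-1.
have kE : 64 * k = 1 by rewrite /k divff.
have k0 : 0 <= k by rewrite /k.
have u2 : 0 <= u ^+ 2 by rewrite exprn_ge0.
have u3 : 0 <= u ^+ 3 by rewrite exprn_ge0.
have u4 : 0 <= u ^+ 4 by rewrite exprn_ge0.
have th1 : 0 <= 1 + th by rewrite addr_ge0.
(* Young's inequality with t = 16 m a; since 64 kappa = 1, the share of m N is exactly a quarter.
   [Y2] takes another quarter, and m N^2 / 2 is what is available. *)
have Y1 : 2 * k * b * D <= m * N / 4 + k / 4 * (1 + th) * b.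
  have c0 : 0 <= k * b ^+ 2 * (1 + th) / 4 by nneg.
  have := ler_wpM2l c0 (Y (16 * m * a)).
  have -> : k * b ^+ 2 * (1 + th) / 4 * (2 * (16 * m * a) * D) =
    2 * k * b * D * ((a * b) * (m * (4 * (1 + th)))) by field.
  have -> : k * b ^+ 2 * (1 + th) / 4 * ((16 * m * a) ^+ 2 * N + q) =
    (64 * k) * (a * b) ^+ 2 * (m * (4 * (1 + th))) * m * N / 4
      + k / 4 * (1 + th) * b * (q * b) by field.
  rewrite ab mE kE !mulr1 expr1n !mul1r => h; apply: le_trans h _.
  by rewrite lerD2l ler_piMr//; nneg.
(* This 256 and the 48 from the second derivative of the cut-off add up to 304. *)
have Y2 : 8 * u ^+ 3 * D <= m * u ^+ 4 * N / 4 + 256 * (1 + th) * u ^+ 2 * q.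
  have c0 : 0 <= 256 * (1 + th) * u ^+ 2 by nneg.
  have := ler_wpM2l c0 (Y (m * u / 16)).
  have -> : 256 * (1 + th) * u ^+ 2 * (2 * (m * u / 16) * D) =
    8 * u ^+ 3 * D * (m * (4 * (1 + th))) by field.
  have -> : 256 * (1 + th) * u ^+ 2 * ((m * u / 16) ^+ 2 * N + q) =
    (m * (4 * (1 + th))) * m * u ^+ 4 * N / 4 + 256 * (1 + th) * u ^+ 2 * q by field.
  by rewrite mE !mulr1 !mul1r.
have Z1 := ler_wpM2l (mulr_ge0 N0 u4) Y1.
have Z2 := ler_wpM2l N0 Y2.
have Bq : (4 * k * (k + 1) * b ^+ 2 * u ^+ 4 + 32 * k * b * u ^+ 3 + 48 * u ^+ 2) * q <=
    4 * k * (k + 1) * b * u ^+ 4 + 32 * k * u ^+ 3 + 48 * u ^+ 2 * q.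
  have c1 : 0 <= 4 * k * (k + 1) * b * u ^+ 4 by nneg.
  have c2 : 0 <= 32 * k * u ^+ 3 by nneg.
  have := ler_wpM2l c1 qb; have := ler_wpM2l c2 qb; rewrite !mulr1; lra.
have BN := ler_wpM2l N0 Bq.
have BD : 0 <= (4 * k * (k + 1) * b ^+ 2 * u ^+ 4 + 32 * k * b * u ^+ 3 + 48 * u ^+ 2) * D ^+ 2.
  by nneg.
have T1 : 0 <= N * u ^+ 4 * b by nneg.
have T2 : 0 <= N * u ^+ 3 by nneg.
have T3 : 0 <= N * u ^+ 2 * q * th by nneg.
have kv : k = 1 / 64 by rewrite /k mul1r.
clearbody k b; subst k; clear Y Y1 Y2 Bq; lra.
Qed.

End weighted_energy_inequality.

Section weighted_energy.
Context {R : realType}.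
Local Notation V := 'rV[R]_4.
Implicit Types (df : 'I_4 -> V -> R) (ddf : 'I_4 -> 'I_4 -> V -> R) (p : V).

(** The test function P(f): decreasing in f, at most 1 / tau for tau > 0, and close to exp ((k - f)
    / 4) where f is large. This form makes - P' / P equal to exp ((f - k) / 4) P / 4, the quantity m
    of [weight_algebra]. *)
Definition psi (f : V -> R) (tau k : R) (x : V) : R := (tau + expR (4^-1 * (f x - k)))^-1.

Lemma psi_gt0 f tau k x : 0 <= tau -> 0 < psi f tau k x.
Proof. by move=> t0; rewrite invr_gt0 ltr_wpDl// expR_gt0. Qed.

Lemma C1_psi f df tau k : C1 f df -> 0 <= tau -> C1 (psi f tau k)
  (fun i x => - (4^-1 * expR (4^-1 * (f x - k)) * psi f tau k x ^+ 2) * df i x).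
Proof.
move=> Cf t0.
have H := C1_inv (C1_D (C1_cst tau) (C1_expR (C1_Z 4^-1 (C1_D Cf (C1_cst (- k))))))
  (fun x => ltr_wpDl t0 (expR_gt0 _)).
by apply: C1_eq H => i x /=; rewrite /psi; ring.
Qed.

Lemma weighted_energy f df ddf p s t tau k : C2 f df ddf -> 0 < s -> 0 <= tau ->
  gamma2_on [set x | sqd p x < t] df ddf ->
  3 / 2 * kappa * int4 (fun x => psi f tau k x * wbump p s t x * (s + sqd p x)^-1
     * dotp df df x) <=
  int4 (fun x => twice_sigma2 df ddf x * psi f tau k x * wbump p s t x)
  + kappa / 4 * (tau * int4 (fun x => psi f tau k x * expR (4^-1 * (k - f x)) * wbump p s t x
     * (s + sqd p x)^-1 * dotp df df x))
  + 304 * int4 (fun x => expR (4^-1 * (k - f x)) * weight p s x * sqd p x * bump 2 p t x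
     * dotp df df x).
Proof.
move=> Cf s0 t0 G; have [Cf1 Cdf] := Cf.
have a0 x : 0 < s + sqd p x by rewrite ltr_pwDl// sqd_ge0.
have CP := C1_psi k Cf1 t0.
set P := psi f tau k in CP *.
have CE := C1_expR (C1_Z 4^-1 (C1_D Cf1 (C1_cst (- k)))).
have CiE := C1_expR (C1_Z 4^-1 (C1_D (C1_cst k) (C1_Z (-1) Cf1))).
have ciE : cont (fun x => expR (4^-1 * (k - f x))).
  by have := C1_continuous CiE; under eq_fun do rewrite mulN1r.
have cP := C1_continuous CP.
pose E x := expR (4^-1 * (f x - k)); have cE : cont E by exact: C1_continuous CE.
have cP' : cont (fun x => - (4^-1 * E x * P x ^+ 2)) by ctac.
have cce := ccs_wbump p t s0.
pose de (i : 'I_4) x := wbump1 p s t x * rad p i x.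
pose dde (i j : 'I_4) x :=
  wbump2 p s t x * rad p j x * rad p i x + wbump1 p s t x * (j == i)%:R.
have Ce : C2 (wbump p s t) de dde := C2_wbump p t s0.
rewrite (int4_twice_sigma2 Cf CP cP' Ce cce).
have cdf i : cont (df i) by exact: C1_dcontinuous Cf1.
have cddf i j : cont (ddf i j) by exact: C1_dcontinuous (Cdf i).
have cN : cont (dotp df df) by rewrite /dotp; ctac.
have clap : cont (lap ddf) by rewrite /lap; ctac.
have ches : cont (hes ddf df df) by rewrite /hes; ctac.
have [Ce1 Cde] := Ce.
have cde i := ccs_dC1 i Ce1 cce.
have cdde i j := ccs_dC1 j (Cde i) (cde i).
have cw := C1_continuous (C1_weight p s0).
have cs := cont_sqd p.
have ca : cont (fun x => (s + sqd p x)^-1).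
  apply: cont_inv; first by ctac.
  by move=> x; rewrite gt_eqF.
rewrite -[3 / 2 * kappa * _]int4Z; last by cctac.
rewrite -[tau * _]int4Z; last by cctac.
rewrite -[kappa / 4 * _]int4Z; last by cctac.
rewrite -[304 * _]int4Z; last by cctac.
set F1 := (X in int4 X + int4 _ + _ + _); set F2 := (X in _ + int4 X + _ + _).
set F3 := (X in _ + int4 X + _); set F4 := (X in _ + int4 X).
have c1 : ccs F1 by rewrite /F1 /hes /lap /dotp; cctac.
have c2 : ccs F2 by rewrite /F2; cctac.
have c3 : ccs F3 by rewrite /F3; cctac.
have c4 : ccs F4 by rewrite /F4; cctac.
rewrite -(int4D c1 c2) -(int4D (ccsD c1 c2) c3) -(int4D (ccsD (ccsD c1 c2) c3) c4).
apply: int4_le; [by cctac|by cctac|] => x; rewrite /F1 /F2 /F3 /F4 {F1 F2 F3 F4 c1 c2 c3 c4}.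
rewrite /de /dde hes_wbump lap_wbump dotp_wbump.
have [xt|tx] := ltP (sqd p x) t; last first.
  by rewrite /wbump1 /wbump2 /wbump !bump_out//; lra.
have [_ G2 _] := G x xt.
rewrite /wbump1 /wbump2 /wbump !(bumpE 4) !(bumpE 3) !(bumpE 2).
have iEE : expR (4^-1 * (k - f x)) * E x = 1.
  by rewrite /E -expRD -mulrDr addrA subrK subrr mulr0 expR0.
have PE : P x * (tau + E x) = 1 by rewrite mulVf// gt_eqF// ltr_wpDl// expR_gt0.
have E0 : 0 < E x by exact: expR_gt0.
have P0 : 0 < P x by exact: psi_gt0.
have iE0 : 0 < expR (4^-1 * (k - f x)) by exact: expR_gt0.
set iE := expR _ in iEE iE0 *.
have h0 := weight_gt0 p s x; set h := weight p s x in h0 *.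
have mE : 4^-1 * E x * P x * (4 * (1 + tau * iE)) = 1.
  transitivity (P x * (tau * (iE * E x) + E x)); first by field.
  by rewrite iEE mulr1.
have PiE : P x * (1 + tau * iE) = iE.
  transitivity (P x * (tau + E x) * iE); last by rewrite PE mul1r.
  by rewrite -iEE; ring.
have Y u : 2 * u * dotp df (rad p) x <= u ^+ 2 * dotp df df x + sqd p x.
  by rewrite -dotp_rad; exact: dotp_young.
have qa : sqd p x <= s + sqd p x by rewrite lerDr ltW.
have := weight_algebra (dotp_ge0 df x) (sqd_ge0 p x) qa (a0 x)
  (bump_ge0 1 p t x) (mulr_ge0 t0 (ltW iE0)) mE Y.
have Ph0 : 0 <= P x * h by rewrite mulr_ge0// ltW.
move=> /(ler_wpM2l Ph0).
(* This is - P' times the weighted cut-off, the coefficient of the Newton tensor in the divergence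
   identity. *)
have c0 : 0 <= 4^-1 * E x * P x ^+ 2 * (h * bump 1 p t x ^+ 4).
  by have := bump_ge0 1 p t x => u0; nneg.
have := ler_wpM2l c0 G2.
have : P x * (1 + tau * iE) * (h * sqd p x * bump 1 p t x ^+ 2 * dotp df df x) =
  iE * (h * sqd p x * bump 1 p t x ^+ 2 * dotp df df x) by rewrite PiE.
set N := dotp df df x; set D := dotp df (rad p) x; set q := sqd p x.
set u := bump 1 p t x; set L := lap ddf x; set Q := hes ddf df df x.
rewrite -/(E x) /kappa; set b := (s + q)^-1; set Px := P x; set Ex := E x.
clearbody N D q u L Q b Px Ex h iE; clear.
lra.
Qed.

End weighted_energy.

(** * Averages over balls and decay of the energy *)

Section averages.
Context {R : realType}.
Local Notation V := 'rV[R]_4.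
Implicit Types (g : V -> R) (dg : 'I_4 -> V -> R) (ddg : 'I_4 -> 'I_4 -> V -> R) (p : V).

(** On a ball of squared radius s both the volume and [bump 2] are of order s^2, hence the power 4.
    The mean is not normalized: the mean of 1 is [omega], and means tend to omega g(p) as s tends to
    0. *)
Definition avg g p (s : R) : R := s^-1 ^+ 4 * int4 (fun x => g x * bump 2 p s x).

Lemma bump_mul_sqd k p s x : bump k.+1 p s x * sqd p x = bump k.+1 p s x * (s - bump 1 p s x).
Proof.
have [xs|sx] := ltP (sqd p x) s; last by rewrite !bump_out ?mul0r.
by rewrite [bump 1 _ _ _]bump_in// expr1 opprB addrC subrK.
Qed.

Lemma is_derive_int4_bump g p (s : R) : cont g ->
  is_derive s 1 (fun s => int4 (fun x => g x * bump 2 p s x))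
    (int4 (fun x => g x * (2 * bump 1 p s x))).
Proof.
move=> cg; pose r := `|p| + (`|s| + 1) + 1.
have [A A0 hA] := bounded_on_normball r cg.
have rx (t : R) x : `|t - s| < 1 -> r < `|x| -> t <= sqd p x.
  move=> ts xr; rewrite leNgt; apply/negP => /sqd_lt_norm h.
  have := ler_normD (t - s) s; rewrite subrK => h2.
  by move: xr; rewrite /r ltNge => /negP; apply; apply: le_trans h _; lra.
apply: (@is_derive_int4 R (fun s x => g x * bump 2 p s x)
  (fun s x => g x * (2 * bump 1 p s x)) s 1 r (A * (2 * (`|s| + 1))) ltr01).
- by move=> t _; cctac.
- move=> t x _.
  have H := @is_derive1_comp R (posp 2) (fun t => t - sqd p x) t _ _
    (is_derive_posp 0 _) (is_deriveB (is_derive_id t (1 : R)) (is_derive_cst (sqd p x) t 1)).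
  have H2 := @is_deriveZ R R R _ (g x) t 1 _ H.
  by apply: (is_derive_eq H2); rewrite subr0 mulr1.
- by move=> t x ts xr; rewrite bump_out ?mulr0//; exact: rx.
move=> t x ts; have [xr|xr] := leP `|x| r; last first.
  by rewrite bump_out ?mulr0 ?normr0; [rewrite !mulr_ge0// addr_ge0|exact: rx].
rewrite normrM ler_pM//; first exact: hA.
rewrite normrM ger0_norm// ler_pM2l//.
rewrite ger0_norm ?bump_ge0//.
have [xt|tx] := ltP (sqd p x) t; last by rewrite bump_out// addr_ge0.
rewrite bump_in// expr1; have := sqd_ge0 p x; have := ler_normD (t - s) s; rewrite subrK.
have := ler_norm t; lra.
Qed.

(** The divergence of g (x - p) [bump 2] integrates to zero, and |x - p|^2 is s - [bump 1] on the
    support. The result expresses the derivative of the mean in s through the radial derivative of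
    g. *)
Lemma int4_rad_bump g dg p s : C1 g dg ->
  int4 (fun x => dotp dg (rad p) x * bump 2 p s x) =
  - 8 * int4 (fun x => g x * bump 2 p s x) + 4 * s * int4 (fun x => g x * bump 1 p s x).
Proof.
move=> Cg; have cg := C1_continuous Cg.
have cdg i : cont (dg i) by exact: C1_dcontinuous Cg.
have cr := cont_rad p.
pose X (i : 'I_4) x := dg i x * (rad p i x * bump 2 p s x) +
  g x * (bump 2 p s x - 4 * bump 1 p s x * rad p i x ^+ 2).
have X0 i : int4 (X i) = 0 /\ ccs (X i).
  have Cr : C1 (rad p i) (fun j _ => (j == i)%:R).
    by apply: C1_eq (C1_D (C1_coord i) (C1_cst (- p 0 i))) => j x; rewrite addr0.
  have H := C1_M Cg (C1_M Cr (C1_bump 0 p s)).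
  have cW : ccs (fun x => g x * (rad p i x * bump 2 p s x)) by cctac.
  have -> : X i = (fun x => dg i x * (rad p i x * bump 2 p s x) + g x * ((i == i)%:R * bump 2 p s x
      + rad p i x * - (2 * 2 * bump 1 p s x * (x 0 i - p 0 i)))).
    by apply/funext => x; rewrite /X eqxx mul1r -/(rad p i x); ring.
  by split; [exact: int4_div i H cW|exact: ccs_dC1 i H cW].
have cX i : ccs (X i) by have [] := X0 i.
have SX : int4 (fun x => \sum_i X i x) = 0.
  by rewrite int4_sum// big1// => i _; have [] := X0 i.
have c1 : ccs (fun x => g x * bump 2 p s x) by cctac.
have c2 : ccs (fun x => g x * bump 1 p s x) by cctac.
rewrite -[- 8 * _]int4Z// -[4 * s * _]int4Z//.
have c3 : ccs (fun x => - 8 * (g x * bump 2 p s x)) by cctac.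
have c4 : ccs (fun x => 4 * s * (g x * bump 1 p s x)) by cctac.
rewrite -int4D// -[LHS]subr0 -SX -int4B; [|by rewrite /dotp; cctac|by cctac].
apply: eq_int4 => x.
have E : \sum_i X i x = dotp dg (rad p) x * bump 2 p s x
    + g x * (4 * bump 2 p s x - 4 * (bump 1 p s x * sqd p x)).
  by rewrite /X -dotp_rad /dotp !sum4; ring.
by rewrite E bump_mul_sqd bumpE; ring.
Qed.

Lemma is_derive_avg g dg p (s : R) : C1 g dg -> 0 < s -> is_derive s 1 (avg g p)
  (2^-1 * s^-1 ^+ 5 * int4 (fun x => dotp dg (rad p) x * bump 2 p s x)).
Proof.
move=> Cg s0; have cg := C1_continuous Cg.
have s1 : s != 0 by rewrite gt_eqF.
pose F (t : R) := t^-1 ^+ 4; pose I t := int4 (fun x => g x * bump 2 p t x).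
have H1 : is_derive s 1 F (- (4 * s^-1 ^+ 5)).
  rewrite (_ : F = (fun t : R => t^-1) ^+ 4); last by apply/funext => t; rewrite exprfctE.
  have := @is_deriveX R R _ 4 s 1 _ (@is_deriveV R id s 1 1 s1 (is_derive_id _ _)).
  move=> H; apply: (is_derive_eq H); rewrite -exprVn; 
  have -> : - s^-1 ^+ 2 *: (1 : R) = - s^-1 ^+ 2 by rewrite [LHS]mulr1.
  by rewrite [LHS]/GRing.scale/=; ring.
have H := is_deriveM H1 (is_derive_int4_bump p s cg).
rewrite (_ : avg g p = F * I)//.
apply: (is_derive_eq H); rewrite (int4_rad_bump p s Cg).
have -> : int4 (fun x => g x * (2 * bump 1 p s x)) = 2 * int4 (fun x => g x * bump 1 p s x).
  by rewrite -int4Z; [apply: eq_int4 => x; ring|cctac].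
set A := int4 (fun x => g x * bump 1 p s x); set B := int4 _.
transitivity (F s * (2 * A) + B * - (4 * s^-1 ^+ 5)); first by [].
by rewrite /F; field.
Qed.

(** Green's formula, as the gradient of [bump 3] is - 6 (x - p) [bump 2]. It shows that means of
    superharmonic functions decrease in s. *)
Lemma int4_lap_bump dg ddg p s : (forall i, C1 (dg i) (ddg i)) ->
  int4 (fun x => dotp dg (rad p) x * bump 2 p s x) =
  6^-1 * int4 (fun x => lap ddg x * bump 3 p s x).
Proof.
move=> Cdg; have cdg i : cont (dg i) by exact: C1_continuous (Cdg i).
have cddg i j : cont (ddg i j) by exact: C1_dcontinuous (Cdg i).
have cr := cont_rad p.
pose X (i : 'I_4) x := ddg i i x * bump 3 p s x
  + dg i x * - (2 * 3 * bump 2 p s x * rad p i x).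
have X0 i : int4 (X i) = 0 /\ ccs (X i).
  have H := C1_M (Cdg i) (C1_bump 1 p s).
  have cW : ccs (fun x => dg i x * bump 3 p s x) by cctac.
  by split; [exact: int4_div i H cW|exact: ccs_dC1 i H cW].
have cX i : ccs (X i) by have [] := X0 i.
have SX : int4 (fun x => \sum_i X i x) = 0.
  by rewrite int4_sum// big1// => i _; have [] := X0 i.
have cl : ccs (fun x => lap ddg x * bump 3 p s x) by rewrite /lap; cctac.
have cd : ccs (fun x => dotp dg (rad p) x * bump 2 p s x) by rewrite /dotp; cctac.
have c6 : ccs (fun x => 6^-1 * (lap ddg x * bump 3 p s x)) by cctac.
have cX6 : ccs (fun x => 6^-1 * \sum_i X i x) by cctac.
rewrite -int4Z// -[RHS]subr0 -(mulr0 6^-1) -SX -int4Z; last by cctac.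
rewrite -int4B//; apply: eq_int4 => x.
by rewrite /X /lap /dotp !sum4; field.
Qed.

Lemma MVT_gt0 (F F' : R -> R) (a b : R) :
  (forall s : R, 0 < s -> is_derive s 1 F (F' s)) -> 0 < a -> a < b ->
  exists2 c, a < c < b & F b - F a = F' c * (b - a).
Proof.
move=> dF a0 ab.
have [] := @MVT R F F' a b ab.
- by move=> x; rewrite in_itv/= => /andP[ax _]; apply: dF; exact: lt_trans ax.
- apply: derivable_within_continuous => x; rewrite in_itv/= => /andP[ax _].
  by have [] := dF x (lt_le_trans a0 ax).
- by move=> c; rewrite in_itv/= => cab E; exists c.
Qed.

Lemma int4_translate_vec g (v : V) : ccs g -> int4 (fun x => g (x + v)) = int4 g.
Proof.
move=> cg; rewrite [v]row_sum_delta; elim: (index_enum _) => [|j l IH].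
  by apply: eq_int4 => x; rewrite big_nil addr0.
rewrite -IH -[RHS](int4_translate j (v 0 j) (ccs_translate _ cg)).
by apply: eq_int4 => x; rewrite big_cons addrA.
Qed.

Definition omega : R := avg (fun=> 1) 0 1.

(** The derivative of the mean of 1 in s vanishes by [is_derive_avg]; this replaces a change of
    variables by dilation. A translation disposes of the centre. *)
Lemma int4_bump p s : 0 < s -> int4 (bump 2 p s) = omega * s ^+ 4.
Proof.
move=> s0.
have E1 q t : avg (fun=> 1) q t = t^-1 ^+ 4 * int4 (bump 2 q t).
  by congr (_ * _); apply: eq_int4 => x; rewrite mul1r.
have -> : int4 (bump 2 p s) = int4 (bump 2 0 s).
  rewrite -[RHS](int4_translate_vec (- p) (ccs_bump 1 0 s)); apply: eq_int4 => x.
  by congr (posp 2 (s - _)); apply: eq_bigr => i _; rewrite !mxE subr0.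
have D (t : R) : 0 < t -> is_derive t 1 (avg (fun=> 1) 0) 0.
  move=> t0; have H := is_derive_avg 0 (C1_cst 1) t0; apply: (is_derive_eq H).
  rewrite (@eq_int4 _ _ (fun=> 0)) ?int4_0 ?mulr0// => x.
  by rewrite /dotp big1 ?mul0r// => i _; rewrite mul0r.
have : avg (fun=> 1) 0 s = omega.
  have [s1|s1|->//] := ltgtP s 1.
    by have [c _] := MVT_gt0 D s0 s1; rewrite mul0r => /eqP; rewrite subr_eq0 => /eqP.
  by have [c _] := MVT_gt0 D ltr01 s1; rewrite mul0r => /eqP; rewrite subr_eq0 => /eqP.
by rewrite E1 => <-; rewrite mulrAC -exprMn mulVf ?expr1n ?mul1r// gt_eqF.
Qed.

Lemma omega_gt0 : 0 < omega.
Proof.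
have := int4_bump 0 ltr01; rewrite expr1n mulr1 => <-.
apply: (@int4_gt0 _ _ 0); first exact: ccs_bump.
- by move=> x; exact: bump_ge0.
- by rewrite bump_in sqdxx// subr0 expr1n.
Qed.

Lemma avg_bound g p s (c : R) : cont g -> 0 < s -> (forall x, sqd p x < s -> g x <= c) ->
  avg g p s <= omega * c.
Proof.
move=> cg s0 gc.
have : int4 (fun x => g x * bump 2 p s x) <= int4 (fun x => c * bump 2 p s x).
  apply: int4_le; [by cctac|by cctac|move=> x].
  have [xs|sx] := ltP (sqd p x) s; last by rewrite bump_out// !mulr0.
  by rewrite ler_wpM2r ?bump_ge0// gc.
rewrite int4Z; last exact: ccs_bump.
rewrite int4_bump// /avg => h.
have s4 : 0 <= s^-1 ^+ 4 by rewrite exprn_ge0// invr_ge0 ltW.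
apply: le_trans (ler_wpM2l s4 h) _.
have E4 : s^-1 ^+ 4 * s ^+ 4 = 1 by rewrite -exprMn mulVf ?expr1n// gt_eqF.
have -> : s^-1 ^+ 4 * (c * (omega * s ^+ 4)) = omega * c * (s^-1 ^+ 4 * s ^+ 4) by ring.
by rewrite E4 mulr1.
Qed.

Lemma avgZ g p s (c : R) : cont g -> avg (fun x => c * g x) p s = c * avg g p s.
Proof.
move=> cg; rewrite /avg mulrCA; congr (_ * _); rewrite -int4Z; last by cctac.
by apply: eq_int4 => x; rewrite mulrA.
Qed.

Lemma avg_limit_ge g p (c S : R) : cont g -> 0 < S ->
  (forall s, 0 < s < S -> c <= avg g p s) -> c <= omega * g p.
Proof.
move=> cg S0 h; rewrite leNgt; apply/negP => lt; have o0 := omega_gt0.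
pose e := (c / omega - g p) / 2.
have e0 : 0 < e by rewrite divr_gt0// subr_gt0 ltr_pdivlMr// mulrC.
have [cg'] := cg.
have /sqd_small_ball [s0 s00 hs] : \forall y \near p, g y < g p + e.
  by apply: (cvgr_lt _ (cg' p)); rewrite ltrDl.
pose s := Num.min s0 S / 2.
have m0 : 0 < Num.min s0 S by rewrite lt_min s00.
have [ms1 ms2] : Num.min s0 S <= s0 /\ Num.min s0 S <= S by rewrite !ge_min !lexx orbT.
have sS : 0 < s < S by rewrite /s; lra.
have s1 : 0 < s by case/andP: sS.
have := le_trans (h s sS) (avg_bound (c := g p + e) cg s1 _).
have H : forall x, sqd p x < s -> g x <= g p + e.
  by move=> x xs; apply/ltW/hs; apply: lt_trans xs _; rewrite /s; lra.
move=> /(_ H).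
rewrite mulrC -ler_pdivrMr// /e; set d := c / omega; move: e0; rewrite /e -/d; lra.
Qed.

Lemma avg_limit_le g p (c S : R) : cont g -> 0 < S ->
  (forall s, 0 < s < S -> avg g p s <= c) -> omega * g p <= c.
Proof.
move=> cg S0 h; have cNg : cont (fun x => -1 * g x) by ctac.
have := @avg_limit_ge (fun x => -1 * g x) p (- c) S cNg S0.
rewrite mulN1r mulrN lerN2; apply=> s sS; rewrite avgZ// mulN1r lerN2; exact: h.
Qed.

Lemma superharmonic_mean g dg ddg p (S : R) : C2 g dg ddg -> 0 < S ->
  (forall x, sqd p x < S -> lap ddg x <= 0) -> avg g p S <= omega * g p.
Proof.
move=> [Cg Cdg] S0 hS; apply: (@avg_limit_ge _ _ _ S) => //; first exact: C1_continuous Cg.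
move=> s /andP[s0 sS].
have D (t : R) : 0 < t -> is_derive t 1 (avg g p)
  (2^-1 * t^-1 ^+ 5 * int4 (fun x => dotp dg (rad p) x * bump 2 p t x)).
  by move=> t0; exact: is_derive_avg.
have [t /andP[st tS]] := MVT_gt0 D s0 sS.
rewrite (int4_lap_bump _ _ Cdg) => E.
have t0 : 0 < t by exact: lt_trans st.
have : int4 (fun x => lap ddg x * bump 3 p t x) <= int4 (fun=> 0).
  apply: int4_le; [|exact: ccs0|].
    have cddg i j : cont (ddg i j) by exact: C1_dcontinuous (Cdg i).
    by rewrite /lap; cctac.
  move=> x; have [xt|tx] := ltP (sqd p x) t; last by rewrite bump_out// mulr0.
  by rewrite mulr_le0_ge0 ?bump_ge0// hS// (lt_trans xt).
rewrite int4_0 => I0; rewrite -subr_le0 E mulr_le0_ge0//; last by rewrite subr_ge0 ltW.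
rewrite mulr_ge0_le0//; first by rewrite mulr_ge0// exprn_ge0// invr_ge0 ltW.
by rewrite mulr_ge0_le0.
Qed.

End averages.

(** * Scale-invariant energy and the mean value inequality *)

Section superharmonicity.
Context {R : realType}.
Local Notation V := 'rV[R]_4.
Implicit Types (f g : V -> R) (df dg : 'I_4 -> V -> R) (ddf : 'I_4 -> 'I_4 -> V -> R) (p : V).

Lemma sqd_triangle p x y (a : R) : 0 < a ->
  sqd p y <= (1 + a) * sqd p x + (1 + a^-1) * sqd x y.
Proof.
move=> a0.
suff H (b c : R) : (b + c) ^+ 2 <= (1 + a) * b ^+ 2 + (1 + a^-1) * c ^+ 2.
  rewrite /sqd !mulr_sumr -big_split; apply: ler_sum => i _ /=.
  have -> : y 0 i - p 0 i = (x 0 i - p 0 i) + (y 0 i - x 0 i) by ring.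
  exact: H.
rewrite -subr_ge0.
have -> : (1 + a) * b ^+ 2 + (1 + a^-1) * c ^+ 2 - (b + c) ^+ 2 =
  a^-1 * (a * b - c) ^+ 2 by field; rewrite gt_eqF.
by rewrite mulr_ge0 ?sqr_ge0// invr_ge0 ltW.
Qed.

(** Invariant under dilations: |dg|^2 scales like s^-1, while [bump 2] and the volume each scale
    like s^2. *)
Definition energy dg p (s : R) : R := s^-1 ^+ 3 * int4 (fun x => dotp dg dg x * bump 2 p s x).

(** Young's inequality with parameter d applied to dg . (x - p), where |x - p|^2 < s on the support.
    Small energy thus makes the mean vary slowly in ln s. *)
Lemma avg_derive_bound g dg p (s d : R) : C1 g dg -> 0 < s -> 0 < d ->
  `|2^-1 * s^-1 ^+ 5 * int4 (fun x => dotp dg (rad p) x * bump 2 p s x)| <=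
  (4 * s)^-1 * (d * omega + d^-1 * energy dg p s).
Proof.
move=> Cg s0 d0; have cr := cont_rad p.
have cdg i : cont (dg i) by exact: C1_dcontinuous Cg.
set I := int4 _.
have c1 : ccs (fun x => dotp dg (rad p) x * bump 2 p s x) by rewrite /dotp; cctac.
have cu : ccs (bump 2 p s) by exact: ccs_bump.
have c2 : ccs (fun x => dotp dg dg x * bump 2 p s x) by rewrite /dotp; cctac.
have b2 : int4 (fun x => dotp dg dg x * bump 2 p s x) = s ^+ 3 * energy dg p s.
  by rewrite /energy mulrA -exprMn divff ?expr1n ?mul1r// gt_eqF.
have K (x : V) (a : R) : a = 1 \/ a = -1 ->
    a * (dotp dg (rad p) x * bump 2 p s x) <=
    2^-1 * d * bump 2 p s x + 2^-1 * d^-1 * s * (dotp dg dg x * bump 2 p s x).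
  move=> aE; have [xs|sx] := ltP (sqd p x) s; last by rewrite bump_out// !mulr0 addr0.
  have := dotp_young dg (rad p) x (a * s / d); rewrite dotp_rad => Y.
  have u0 := bump_ge0 2 p s x; set u := bump _ _ _ _ in u0 *.
  suff : a * dotp dg (rad p) x <= 2^-1 * d + 2^-1 * d^-1 * s * dotp dg dg x.
    by move=> /(ler_wpM2r u0); rewrite mulrDl !mulrA.
  have c0 : 0 <= 2^-1 * d / s by rewrite divr_ge0 ?mulr_ge0// ltW.
  have := ler_wpM2l c0 Y.
  have a2 : a ^+ 2 = 1 by case: aE => ->; rewrite ?sqrrN expr1n.
  have s1 : s != 0 by rewrite gt_eqF.
  have d1 : d != 0 by rewrite gt_eqF.
  have -> : 2^-1 * d / s * (2 * (a * s / d) * dotp dg (rad p) x) = a * dotp dg (rad p) x.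
    by field; apply/andP.
  have -> : 2^-1 * d / s * ((a * s / d) ^+ 2 * dotp dg dg x + sqd p x) =
    2^-1 * d * (sqd p x / s) + a ^+ 2 * (2^-1 * d^-1 * s * dotp dg dg x).
    by field; apply/andP.
  rewrite a2 mul1r => h; apply: le_trans h _; rewrite lerD2r ler_piMr//.
    by rewrite mulr_ge0// ltW.
  by rewrite ler_pdivrMr// mul1r ltW.
have B (a : R) : a = 1 \/ a = -1 ->
    a * I <= 2^-1 * d * (omega * s ^+ 4) + 2^-1 * d^-1 * s * (s ^+ 3 * energy dg p s).
  move=> aE; rewrite -int4Z// -(int4_bump p s0) -b2.
  rewrite -[2^-1 * d * _]int4Z// -[2^-1 * d^-1 * s * _]int4Z// -int4D; [|cctac|cctac].
  by apply: int4_le; [cctac|cctac|move=> x; exact: K].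
have c5 : 0 < 2^-1 * s^-1 ^+ 5 by rewrite mulr_gt0// exprn_gt0// invr_gt0.
rewrite normrM (gtr0_norm c5).
have NI : `|I| <= 2^-1 * d * (omega * s ^+ 4) + 2^-1 * d^-1 * s * (s ^+ 3 * energy dg p s).
  rewrite ler_norml; have := B 1 (or_introl erefl); have := B (-1) (or_intror erefl).
  by rewrite mul1r mulN1r => h1 h2; apply/andP; split; [rewrite lerNl|].
apply: le_trans (ler_wpM2l (ltW c5) NI) _.
rewrite le_eqVlt; apply/orP; left; apply/eqP; field.
by rewrite !gt_eqF.
Qed.

Lemma C2_expN f df ddf : C2 f df ddf ->
  C2 (fun x => expR (- f x)) (fun i x => - expR (- f x) * df i x)
    (fun i j x => expR (- f x) * (df j x * df i x - ddf i j x)).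
Proof.
move=> [Cf Cdf].
have H : C1 (fun x => expR (- f x)) (fun i x => - expR (- f x) * df i x).
  have := C1_expR (C1_Z (-1) Cf); under eq_fun do rewrite mulN1r.
  by apply: C1_eq => i x; rewrite mulN1r; ring.
split=> // i; have := C1_M (C1_Z (-1) H) (Cdf i).
rewrite (_ : (fun x => -1 * expR (- f x) * df i x) = (fun x => - expR (- f x) * df i x)); last first.
  by apply/funext => x; ring.
by apply: C1_eq => j x; ring.
Qed.

Lemma lap_expN f df ddf x :
  lap (fun i j x => expR (- f x) * (df j x * df i x - ddf i j x)) x =
  expR (- f x) * (dotp df df x - lap ddf x).
Proof. by rewrite /lap /dotp !sum4; ring. Qed.

(** By superharmonicity the value of exp (- f) at x dominates its mean over the ball of squared
    radius 4 s about x. That ball contains the one of squared radius s about p and lies in the one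
    of squared radius 9 s; the constant 256 is 4^4. *)
Lemma lower_harnack f df ddf p x (s : R) : C2 f df ddf -> 0 < s ->
  (forall y, sqd p y < 9 * s -> dotp df df y <= lap ddf y) -> sqd p x <= s ->
  int4 (fun y => expR (- f y) * bump 2 p s y) <= 256 * omega * s ^+ 4 * expR (- f x).
Proof.
move=> Cf s0 hN xs; have Cp := C2_expN Cf.
have s4 : 0 < 4 * s by rewrite mulr_gt0.
have := @superharmonic_mean _ _ _ _ x (4 * s) Cp s4.
have cp : cont (fun x => expR (- f x)) by case: Cp => /C1_continuous.
move=> H; have {}H : avg (fun x => expR (- f x)) x (4 * s) <= omega * expR (- f x).
  apply: H => y ys; rewrite lap_expN mulr_ge0_le0 ?expR_ge0// subr_le0; apply: hN.
  apply: le_lt_trans (sqd_triangle p x y (ltr0n R 2)) _; lra.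
have s40 : 0 < (4 * s) ^+ 4 by rewrite exprn_gt0.
apply: le_trans (_ : (4 * s) ^+ 4 * avg (fun x => expR (- f x)) x (4 * s) <= _); last first.
  have := ler_wpM2l (ltW s40) H; lra.
rewrite /avg mulrA -exprMn divff ?expr1n ?mul1r ?gt_eqF//.
apply: int4_le; [by cctac|by cctac|move=> y].
rewrite ler_wpM2l ?expR_ge0//.
have [ys|sy] := ltP (sqd p y) s; last by rewrite bump_out// bump_ge0.
have y4 : sqd x y <= 3 * s + sqd p y.
  have := sqd_triangle x p y ltr01; rewrite invr1 (sqdC x p); lra.
rewrite !bump_in//; last by lra.
by rewrite ler_pXn2r// ?nnegrE; lra.
Qed.

End superharmonicity.

(** * Power decay of the energy *)

Section weighted_energy_decay.
Context {R : realType}.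
Local Notation V := 'rV[R]_4.
Implicit Types (f g : V -> R) (df : 'I_4 -> V -> R) (ddf : 'I_4 -> 'I_4 -> V -> R) (p : V).

(* x^kappa for x > 0 (and 1 for x <= 0) *)
Definition pw (x : R) : R := expR (kappa * ln x).

Lemma kappa_gt0 : 0 < kappa :> R. Proof. by rewrite invr_gt0. Qed.

Lemma pw_gt0 x : 0 < pw x. Proof. exact: expR_gt0. Qed.

Lemma weightE p s x : weight p s x = (pw (s + sqd p x))^-1.
Proof. by rewrite /weight mulNr expRN. Qed.

Lemma pw_le x y : 0 < x -> x <= y -> pw x <= pw y.
Proof.
move=> x0 xy; rewrite /pw ler_expR ler_pM2l ?kappa_gt0// ler_ln// posrE//.
exact: lt_le_trans xy.
Qed.

Lemma pwM x y : 0 < x -> 0 < y -> pw (x * y) = pw x * pw y.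
Proof. by move=> x0 y0; rewrite /pw lnM ?posrE// mulrDr expRD. Qed.

Lemma pwV x : 0 < x -> pw x^-1 = (pw x)^-1.
Proof. by move=> x0; rewrite /pw lnV ?posrE// mulrN expRN. Qed.

Lemma kappa_le1 : kappa <= 1 :> R.
Proof. by rewrite /kappa invf_le1// ler1n. Qed.

Lemma pw_le_id x : 1 <= x -> pw x <= x.
Proof.
move=> x1; have x0 : 0 < x by exact: lt_le_trans x1.
by rewrite -[leRHS](lnK x0) ler_expR ler_piMl ?ln_ge0// kappa_le1.
Qed.

Lemma mul_invpw_le x y : 0 < x -> x <= y -> x * (pw x)^-1 <= y * (pw y)^-1.
Proof.
move=> x0 xy; have y0 : 0 < y by exact: lt_le_trans xy.
have E z : 0 < z -> z * (pw z)^-1 = expR ((1 - kappa) * ln z).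
  by move=> z0; rewrite mulrBl mul1r expRB lnK ?posrE.
by rewrite !E// ler_expR ler_wpM2l ?ler_ln ?posrE// subr_ge0 kappa_le1.
Qed.

Lemma wbump_ge p s t x : 0 < s -> 4 * s <= t ->
  bump 2 p s x * (t ^+ 4 / 8 * (pw (2 * s))^-1 * s^-1 ^+ 3) <=
  wbump p s t x * (s + sqd p x)^-1.
Proof.
move=> s0 st; have q0 := sqd_ge0 p x; have sq : 0 < s + sqd p x by rewrite ltr_pwDl.
have t0 : 0 < t by lra.
have [xs|sx] := ltP (sqd p x) s; last first.
  by rewrite bump_out// mul0r mulr_ge0 ?invr_ge0 ?(ltW sq)// mulr_ge0 ?bump_ge0// ltW ?weight_gt0.
rewrite /wbump weightE [bump 4 _ _ _]bump_in; last by lra.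
have h1 : (pw (2 * s))^-1 <= (pw (s + sqd p x))^-1.
  by rewrite lef_pV2 ?posrE ?pw_gt0// pw_le//; lra.
have h2 : (2 * s)^-1 <= (s + sqd p x)^-1 by rewrite lef_pV2 ?posrE//; lra.
have h3 : t ^+ 4 / 4 <= (t - sqd p x) ^+ 4.
  apply: (@le_trans _ _ ((3 / 4 * t) ^+ 4)).
    have t4 : 0 <= t ^+ 4 by rewrite exprn_ge0// ltW.
    by rewrite exprMn; lra.
  by rewrite lerXn2r ?nnegrE; lra.
have h4 : bump 2 p s x <= s ^+ 2.
  by rewrite bumpE lerXn2r ?nnegrE ?bump_ge0 ?(ltW s0)// bump1_le// ltW.
have p0 : 0 < (pw (2 * s))^-1 by rewrite invr_gt0 pw_gt0.
apply: (@le_trans _ _ ((pw (2 * s))^-1 * (t ^+ 4 / 4) * (2 * s)^-1)); last first.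
  apply: ler_pM => //; first by rewrite mulr_ge0 ?divr_ge0 ?exprn_ge0 ?ltW.
    by rewrite invr_ge0 mulr_ge0// ltW.
  by apply: ler_pM => //; [exact: ltW|rewrite divr_ge0// exprn_ge0// ltW].
have c0 : 0 <= t ^+ 4 / 8 * (pw (2 * s))^-1 * s^-1 ^+ 3.
  by rewrite !mulr_ge0 ?exprn_ge0 ?invr_ge0 ?(ltW t0) ?(ltW s0) ?(ltW (pw_gt0 _)).
apply: le_trans (ler_wpM2r c0 h4) _.
rewrite le_eqVlt; apply/orP; left; apply/eqP; field.
by rewrite !gt_eqF ?pw_gt0.
Qed.

(** Near p the weight divided by s + |x - p|^2 is of size s^(- 1 - kappa). Measured against the
    factor t^(- kappa) of the error term in [weighted_energy_decay], this yields the decay (s /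
    t)^kappa. *)
Lemma energy_le_weighted g p s t : cont g -> (forall x, 0 <= g x) -> 0 < s -> 4 * s <= t ->
  t ^+ 4 / 8 * (pw (2 * s))^-1 * (s^-1 ^+ 3 * int4 (fun x => g x * bump 2 p s x)) <=
  int4 (fun x => g x * (wbump p s t x * (s + sqd p x)^-1)).
Proof.
move=> cg g0 s0 st; rewrite mulrA -int4Z; last by cctac.
have cs := cont_sqd p; have cw := ccs_wbump p t s0.
have ca : cont (fun x => (s + sqd p x)^-1).
  apply: cont_inv; first by ctac.
  by move=> x; rewrite gt_eqF// ltr_pwDl// sqd_ge0.
apply: int4_le; [cctac|cctac|move=> x].
by have := ler_wpM2l (g0 x) (wbump_ge p x s0 st); lra.
Qed.

Lemma weight_le p s x : 0 < s -> weight p s x <= (pw s)^-1.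
Proof.
move=> s0; have q0 := sqd_ge0 p x.
by rewrite weightE lef_pV2 ?posrE ?pw_gt0// pw_le//; lra.
Qed.

Lemma sqd_weight_le p s t x : 0 < s -> sqd p x < t -> sqd p x * weight p s x <= t * (pw t)^-1.
Proof.
move=> s0 xt; have := sqd_ge0 p x; rewrite le_eqVlt => /orP[/eqP <-|q0].
  by rewrite mul0r mulr_ge0 ?invr_ge0 ?(ltW (pw_gt0 _))// (le_trans (sqd_ge0 p x))// ltW.
apply: le_trans (mul_invpw_le q0 (ltW xt)); rewrite ler_pM2l// weightE.
by rewrite lef_pV2 ?posrE ?pw_gt0// pw_le// lerDr ltW.
Qed.

Lemma caccioppoli_double f df ddf p t (c k : R) : C2 f df ddf -> 0 <= c <= 2^-1 -> 0 < t ->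
  (forall x, sqd p x < 2 * t -> dotp df df x <= lap ddf x) ->
  t * int4 (fun x => expR (c * (k - f x)) * dotp df df x * bump 2 p t x) <=
  512 * int4 (fun x => expR (c * (k - f x)) * bump 2 p (2 * t) x).
Proof.
move=> Cf c01 t0 hN; have [Cf1 _] := Cf.
have H := caccioppoli k Cf c01 hN.
have cw : cont (fun x => expR (c * (k - f x))).
  have := C1_continuous (C1_expR (C1_Z c (C1_D (C1_cst k) (C1_Z (-1) Cf1)))).
  by under eq_fun do rewrite mulN1r.
have cdf i : cont (df i) by exact: C1_dcontinuous Cf1.
have cN : cont (dotp df df) by rewrite /dotp; ctac.
have cs := cont_sqd p.
have t2 : 0 < t ^+ 2 by rewrite exprn_gt0.
have h1 : t ^+ 2 * int4 (fun x => expR (c * (k - f x)) * dotp df df x * bump 2 p t x) <=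
    int4 (fun x => expR (c * (k - f x)) * dotp df df x * bump 4 p (2 * t) x).
  rewrite -int4Z; last by cctac.
  apply: int4_le; [cctac|cctac|move=> x].
  have [xt|tx] := ltP (sqd p x) t; last first.
    rewrite (@bump_out _ 1)// !mulr0; apply: mulr_ge0; last exact: bump_ge0.
    by apply: mulr_ge0; [exact: expR_ge0|exact: dotp_ge0].
  rewrite mulrCA; apply: ler_wpM2l.
    by apply: mulr_ge0; [exact: expR_ge0|exact: dotp_ge0].
  rewrite !bump_in//; last by lra.
  have q0 := sqd_ge0 p x.
  have -> : (2 * t - sqd p x) ^+ 4 = (2 * t - sqd p x) ^+ 2 * (2 * t - sqd p x) ^+ 2.
    by rewrite -exprD.
  by apply: ler_pM; rewrite ?exprn_ge0 ?lerXn2r ?nnegrE//; lra.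
have h2 : int4 (fun x => expR (c * (k - f x)) * sqd p x * bump 2 p (2 * t) x) <=
    2 * t * int4 (fun x => expR (c * (k - f x)) * bump 2 p (2 * t) x).
  rewrite -int4Z; last by cctac.
  apply: int4_le; [cctac|cctac|move=> x].
  have [xt|tx] := ltP (sqd p x) (2 * t); last by rewrite bump_out// !mulr0.
  have e0 : 0 <= expR (c * (k - f x)) * bump 2 p (2 * t) x.
    by apply: mulr_ge0; [exact: expR_ge0|exact: bump_ge0].
  by have := ler_wpM2l e0 (ltW xt); lra.
rewrite -(ler_pM2l t0) mulrA -expr2; apply: le_trans h1 _; apply: le_trans H _; lra.
Qed.

(** In the last term of [weighted_energy], |x - p|^2 times the weight is at most t^(1 - kappa),
    because z^(1 - kappa) increases. The Caccioppoli inequality with c = 1/4 then removes the factor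
    |df|^2. *)
Lemma weighted_energy_decay : exists2 C : R, 0 < C & forall f df ddf p s t tau k,
  C2 f df ddf -> 0 < s -> 0 < t -> 0 <= tau ->
  gamma2_on [set x | sqd p x < 2 * t] df ddf ->
  3 / 2 * kappa * int4 (fun x => psi f tau k x * wbump p s t x * (s + sqd p x)^-1
     * dotp df df x) <=
  int4 (fun x => twice_sigma2 df ddf x * psi f tau k x * wbump p s t x)
  + kappa / 4 * (tau * int4 (fun x => psi f tau k x * expR (4^-1 * (k - f x)) * wbump p s t x
     * (s + sqd p x)^-1 * dotp df df x))
  + C * ((pw t)^-1 * int4 (fun x => expR (4^-1 * (k - f x)) * bump 2 p (2 * t) x)).
Proof.
exists (304 * 512); first by apply: mulr_gt0; rewrite ltr0n.
move=> f df ddf p s t tau k Cf s0 t0 tau0 G; have [Cf1 _] := Cf.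
have Gt : gamma2_on [set x | sqd p x < t] df ddf.
  by move=> x /= xt; apply: G => /=; lra.
apply: le_trans (weighted_energy k Cf s0 tau0 Gt) _; rewrite lerD2l -mulrA.
apply: ler_wpM2l; first exact: ler0n.
have c4 : 0 <= (4^-1 : R) <= 2^-1 by rewrite invr_ge0 ler0n/= lef_pV2 ?posrE// ler_nat.
have hN x : sqd p x < 2 * t -> dotp df df x <= lap ddf x by move=> /G [].
have H := caccioppoli_double k Cf c4 t0 hN.
have cw : cont (fun x => expR (4^-1 * (k - f x))).
  have := C1_continuous (C1_expR (C1_Z 4^-1 (C1_D (C1_cst k) (C1_Z (-1) Cf1)))).
  by under eq_fun do rewrite mulN1r.
have cdf i : cont (df i) by exact: C1_dcontinuous Cf1.
have cN : cont (dotp df df) by rewrite /dotp; ctac.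
have cs := cont_sqd p; have cwt := C1_continuous (C1_weight p s0).
have ip0 : 0 <= (pw t)^-1 by rewrite invr_ge0 ltW// pw_gt0.
apply: le_trans (_ : (pw t)^-1 * (t * int4 (fun x => expR (4^-1 * (k - f x)) * dotp df df x
   * bump 2 p t x)) <= _); last first.
  by rewrite [leRHS]mulrCA; exact: ler_wpM2l.
rewrite mulrA -int4Z; last by cctac.
apply: int4_le; [cctac|cctac|move=> x].
have [xt|tx] := ltP (sqd p x) t; last by rewrite bump_out// ?(mulr0, mul0r).
have := sqd_weight_le s0 xt; rewrite [t * _]mulrC.
have c0 : 0 <= expR (4^-1 * (k - f x)) * bump 2 p t x * dotp df df x.
  by apply: mulr_ge0; [apply: mulr_ge0; [exact: expR_ge0|exact: bump_ge0]|exact: dotp_ge0].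
move=> /(ler_wpM2l c0); set X := expR _; set Y := dotp _ _ _; set u := bump _ _ _ _.
set q := sqd _ _; set h := weight _ _ _; set z := (pw t)^-1; clearbody X Y u q h z; clear; lra.
Qed.

End weighted_energy_decay.

Section energy_decay.
Context {R : realType}.
Local Notation V := 'rV[R]_4.
Implicit Types (f : V -> R) (df : 'I_4 -> V -> R) (ddf : 'I_4 -> 'I_4 -> V -> R) (p : V).

Lemma cont_twice_sigma2 f df ddf : C2 f df ddf -> cont (twice_sigma2 df ddf).
Proof.
move=> [Cf1 Cdf].
have cdf i : cont (df i) by exact: C1_dcontinuous Cf1.
have cddf i j : cont (ddf i j) by exact: C1_dcontinuous (Cdf i).
rewrite /twice_sigma2 /lap /dotp /hes.
have c2 : cont (fun x => \sum_i \sum_j ddf i j x ^+ 2) by ctac.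
ctac.
Qed.

Lemma cont_expR_aff f df (c k : R) : C1 f df -> cont (fun x => expR (c * (k - f x))).
Proof.
move=> Cf; have := C1_continuous (C1_expR (C1_Z c (C1_D (C1_cst k) (C1_Z (-1) Cf)))).
by under eq_fun do rewrite mulN1r.
Qed.

Lemma pw_double (s : R) : 0 < s -> pw (2 * s) <= 2 * pw s.
Proof.
move=> s0; rewrite pwM// ler_wpM2r ?(ltW (pw_gt0 _))// pw_le_id//; exact: ler1n.
Qed.

(** Bookkeeping for [energy_near], with a = Sig t^2 and J the weighted energy. The term ka / 4 * J,
    which comes from tau = 1, is absorbed by the left side. *)
Lemma near_arith (t4 C om ka ps pt p2s Z J a : R) : 0 < t4 -> 0 < C -> 0 < om -> 0 < ka ->
  0 < ps -> 0 < pt -> 0 < p2s -> p2s <= 2 * ps -> 0 <= Z -> 0 <= a ->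
  t4 / 8 / p2s * Z <= J ->
  3 / 2 * ka * J <= a / ps * (om * t4) + ka / 4 * J + C * (pt^-1 * (om * (16 * t4))) ->
  2 * Z <= 64 / (5 * ka) * om * (2 + 32 * C) * (a + ps / pt).
Proof.
move=> t0 C0 o0 k0 ps0 pt0 p20 h2 Z0 a0 HJ H.
have y0 : 0 < ps / pt by rewrite divr_gt0.
have HJ2 : t4 * Z <= 16 * (ps * J).
  rewrite -(ler_pM2l ps0) in HJ; apply: le_trans (_ : 16 * (ps * (t4 / 8 / p2s * Z)) <= _); last by lra.
  have : 1 <= 2 * (ps / p2s) by rewrite mulrA ler_pdivlMr// mul1r.
  have tZ : 0 <= t4 * Z by rewrite mulr_ge0// ltW.
  move=> /(ler_wpM2l tZ); rewrite mulr1 => h; apply: le_trans h _.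
  rewrite le_eqVlt; apply/orP; left; apply/eqP; field; by rewrite gt_eqF.
have HH : 5 / 4 * ka * (ps * J) <= t4 * (om * a + 16 * C * om * (ps / pt)).
  have h : 5 / 4 * ka * J <= a / ps * (om * t4) + C * (pt^-1 * (om * (16 * t4))) by lra.
  have := ler_wpM2l (ltW ps0) h.
  have -> : ps * (a / ps * (om * t4) + C * (pt^-1 * (om * (16 * t4)))) =
    t4 * (om * a + 16 * C * om * (ps / pt)) by field; rewrite !gt_eqF.
  lra.
have : t4 * (5 * ka * Z) <= t4 * (64 * (om * a + 16 * C * om * (ps / pt))).
  have := ler_wpM2l (mulr_ge0 (ler0n R 5) (ltW k0)) HJ2; lra.
rewrite ler_pM2l// => h.
have -> : 64 / (5 * ka) * om * (2 + 32 * C) * (a + ps / pt) =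
  (64 * om * (2 + 32 * C) * (a + ps / pt)) / (5 * ka) by field; rewrite !gt_eqF.
rewrite ler_pdivlMr ?mulr_gt0//.
set y := ps / pt in y0 h *; clearbody y.
have c1 : 0 <= om * C * a by rewrite !mulr_ge0// ltW.
have c2 : 0 <= om * y by rewrite !mulr_ge0// ltW.
have c3 : 0 <= om * a by rewrite !mulr_ge0// ltW.
lra.
Qed.

Lemma bump4_le p (t : R) x : 0 <= t -> bump 4 p t x <= t ^+ 2 * bump 2 p t x.
Proof.
move=> t0; have u0 := bump_ge0 1 p t x; have ut := bump1_le p x t0.
rewrite bumpE (bumpE 2); move: (bump 1 p t x) u0 ut => u u0 ut.
have u2 : u ^+ 2 <= t ^+ 2 by rewrite lerXn2r ?nnegrE.
by have := ler_wpM2r (exprn_ge0 2 u0) u2; rewrite -exprD.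
Qed.

(* Near a point where f is at least k the function is almost constant at small
   scales: the energy of exp (- (f - k) / 8) decays like a power of the scale. *)
Lemma energy_near : exists2 C : R, 0 < C & forall f df ddf p s t k Sig,
  C2 f df ddf -> 0 < s -> 4 * s <= t -> 0 <= Sig ->
  gamma2_on [set x | sqd p x < 2 * t] df ddf ->
  (forall x, sqd p x < 2 * t -> k <= f x) ->
  (forall x, sqd p x < t -> twice_sigma2 df ddf x <= Sig) ->
  s^-1 ^+ 3 * int4 (fun x => expR (4^-1 * (k - f x)) * dotp df df x * bump 2 p s x) <=
  C * (Sig * t ^+ 2 + pw (s / t)).
Proof.
have [C0 C00 W] := @weighted_energy_decay R; have o0 : 0 < (omega : R) := omega_gt0.
exists (64 / (5 * (kappa : R)) * (omega : R) * (2 + 32 * C0)).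
  have k0 : 0 < (kappa : R) := kappa_gt0.
  apply: mulr_gt0; last by lra.
  by apply: mulr_gt0 => //; apply: divr_gt0; [exact: ltr0n|apply: mulr_gt0].
move=> f df ddf p s t k Sig Cf s0 st Sig0 G fk SS; have [Cf1 Cdf] := Cf.
have t0 : 0 < t by lra.
have := W f df ddf p s t 1 k Cf s0 t0 ler01 G; rewrite mul1r.
have cP := C1_continuous (C1_psi k Cf1 ler01).
set P := psi f 1 k in cP *.
pose iE x := expR (4^-1 * (k - f x)).
have ciE : cont iE by exact: cont_expR_aff Cf1.
have cS := cont_twice_sigma2 Cf.
have cdf i : cont (df i) by exact: C1_dcontinuous Cf1.
have cN : cont (dotp df df) by rewrite /dotp; ctac.
have cs := cont_sqd p; have cwt := C1_continuous (C1_weight p s0).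
have cwb := ccs_wbump p t s0.
have a0 x : 0 < s + sqd p x by rewrite ltr_pwDl// sqd_ge0.
have ca : cont (fun x => (s + sqd p x)^-1).
  apply: cont_inv; first by ctac.
  by move=> x; rewrite gt_eqF.
have P0 x : 0 < P x by exact: psi_gt0.
have P0' x : 0 <= P x by exact: ltW.
have ia0 x : 0 <= (s + sqd p x)^-1 by rewrite invr_ge0 ltW.
have PE x : P x * (1 + expR (4^-1 * (f x - k))) = 1.
  by rewrite mulVf// gt_eqF// ltr_pwDl// expR_gt0.
have iEE x : iE x * expR (4^-1 * (f x - k)) = 1.
  by rewrite /iE -expRD -mulrDr addrA subrK subrr mulr0 expR0.
have iE0 x : 0 < iE x by exact: expR_gt0.
have iE1 x : sqd p x < 2 * t -> iE x <= 1.
  by move=> /fk h; rewrite /iE -expR0 ler_expR pmulr_rle0// subr_le0.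
have P1 x : P x <= 1.
  by rewrite -(PE x) ler_peMr ?(ltW (P0 x))// lerDl expR_ge0.
(* For tau = 1, P = iE / (1 + iE); since f >= k gives iE <= 1, P and the exponential iE are
   comparable. *)
have iEP x : sqd p x < 2 * t -> iE x <= 2 * P x.
  move=> /iE1 h; have := PE x; have := iEE x; have := P0 x; have := iE0 x; have := P1 x.
  have := expR_gt0 (4^-1 * (f x - k)).
  set E := expR _ => h1 h2 h3 h4 h5 h6.
  have -> : iE x = P x * iE x + P x by rewrite -{1}(mulr1 (iE x)) -h6 -[in RHS](mulr1 (P x)) -h5; ring.
  have := ler_wpM2l (ltW h4) h; lra.
have N0 := dotp_ge0 df.
have wb0 x : 0 <= wbump p s t x by rewrite mulr_ge0 ?bump_ge0// ltW// weight_gt0.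
set J := int4 _ => H.
have H2 : int4 (fun x => P x * iE x * wbump p s t x * (s + sqd p x)^-1 * dotp df df x) <= J.
  apply: int4_le; [cctac|cctac|move=> x].
  have [xt|tx] := ltP (sqd p x) t; last by rewrite /wbump bump_out// !(mulr0, mul0r).
  have x2 : sqd p x < 2 * t by lra.
  have c0 : 0 <= P x * wbump p s t x * (s + sqd p x)^-1 * dotp df df x.
    by do ![apply: mulr_ge0 => //].
  by have := ler_wpM2l c0 (iE1 x x2); lra.
have ips : 0 < (pw s)^-1 by rewrite invr_gt0 pw_gt0.
have H1 : int4 (fun x => twice_sigma2 df ddf x * P x * wbump p s t x) <=
    Sig * (pw s)^-1 * t ^+ 2 * (omega * t ^+ 4).
  rewrite -(int4_bump p t0) -int4Z; last by cctac.
  apply: int4_le; [cctac|cctac|move=> x].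
  have [xt|tx] := ltP (sqd p x) t; last by rewrite /wbump !bump_out// !(mulr0, mul0r).
  have x2 : sqd p x < 2 * t by lra.
  have [_ _ S0] := G x x2.
  have u0 := bump_ge0 2 p t x.
  have b4 : bump 4 p t x <= t ^+ 2 * bump 2 p t x.
    by apply: bump4_le; exact: ltW.
  have w1 : wbump p s t x <= (pw s)^-1 * (t ^+ 2 * bump 2 p t x).
    by apply: ler_pM => //; [rewrite ltW ?weight_gt0|exact: bump_ge0|exact: weight_le].
  have s1 : twice_sigma2 df ddf x * P x <= Sig * 1.
    by apply: ler_pM => //; exact: SS.
  have := ler_pM (mulr_ge0 S0 (ltW (P0 x))) (wb0 x) s1 w1; lra.
have H3 : int4 (fun x => iE x * bump 2 p (2 * t) x) <= omega * (2 * t) ^+ 4.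
  have t2 : 0 < 2 * t by lra.
  rewrite -(int4_bump p t2); apply: int4_le; [cctac|cctac|move=> x].
  have [xt|tx] := ltP (sqd p x) (2 * t); last by rewrite !bump_out// !(mulr0, mul0r).
  by rewrite ler_piMl ?bump_ge0// iE1.
have PN0 x : 0 <= P x * dotp df df x by rewrite mulr_ge0// ltW.
have cPN : cont (fun x => P x * dotp df df x) by ctac.
have := energy_le_weighted p cPN PN0 s0 st.
set Z := _ * int4 _ => H4.
have EJ : int4 (fun x => P x * dotp df df x * (wbump p s t x * (s + sqd p x)^-1)) = J.
  by apply: eq_int4 => x; ring.
rewrite EJ in H4.
have H5 : s^-1 ^+ 3 * int4 (fun x => iE x * dotp df df x * bump 2 p s x) <= 2 * Z.
  rewrite /Z mulrCA; apply: ler_wpM2l; first by rewrite exprn_ge0// invr_ge0 ltW.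
  rewrite -int4Z; last by cctac.
  apply: int4_le; [cctac|cctac|move=> x].
  have [xs|sx] := ltP (sqd p x) s; last by rewrite !bump_out// !(mulr0, mul0r).
  have x2 : sqd p x < 2 * t by lra.
  have c0 : 0 <= dotp df df x * bump 2 p s x by rewrite mulr_ge0 ?bump_ge0.
  by have := ler_wpM2r c0 (iEP x x2); lra.
apply: le_trans H5 _.
have Z0 : 0 <= Z.
  rewrite mulr_ge0 ?exprn_ge0 ?invr_ge0 ?(ltW s0)//; apply: int4_ge0 => x.
  by apply: mulr_ge0; [|exact: bump_ge0].
have -> : pw (s / t) = pw s / pw t by rewrite pwM ?invr_gt0// pwV.
have t4 : 0 < t ^+ 4 by rewrite exprn_gt0.
have E16 : (2 * t) ^+ 4 = 16 * t ^+ 4 by ring.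
rewrite E16 in H3.
apply: (near_arith t4 C00 o0 (kappa_gt0) (pw_gt0 s) (pw_gt0 t) (pw_gt0 (2 * s)) (pw_double s0) Z0
  _ H4 (le_trans H _)); first by rewrite mulr_ge0// exprn_ge0// ltW.
rewrite lerD//; last first.
  apply: ler_wpM2l; first exact: ltW.
  by apply: ler_wpM2l H3; rewrite invr_ge0 ltW// pw_gt0.
apply: lerD => //; last by apply: ler_wpM2l => //; rewrite divr_ge0// ltW// kappa_gt0.
by move: H1; rewrite [Sig / _ * _]mulrAC.
Qed.

End energy_decay.

Section energy_far.
Context {R : realType}.
Local Notation V := 'rV[R]_4.
Implicit Types (f : V -> R) (df : 'I_4 -> V -> R) (ddf : 'I_4 -> 'I_4 -> V -> R) (p : V).

(** Bookkeeping for [energy_far]. The three summands come from the mass of S, from the tau term and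
    from the cut-off. The tau term is not absorbed here, since exp ((k - f) / 4) has no upper bound;
    smallness of tau has to pay for it. *)
Lemma far_arith (t s t4 ka C1 C0 ps pt p2s tau eps Z J I1 I2 I3 : R) : 0 < t -> 0 < s ->
  0 < t4 -> 0 < ka -> 64 * ka = 1 -> 0 < C1 -> 0 < C0 -> 0 < ps -> 0 < pt -> 0 < p2s ->
  p2s <= 2 * ps -> 0 <= Z -> 0 < tau -> 0 <= eps ->
  t4 / 8 / p2s * Z <= J ->
  I1 <= tau^-1 * ps^-1 * (t4 * eps) -> I2 <= ps^-1 * s^-1 * (256 * (t * (C1 * t4))) ->
  I3 <= C1 * t4 ->
  3 / 2 * ka * J <= I1 + ka / 4 * (tau * I2) + C0 * (pt^-1 * I3) ->
  2 * Z <= 64 / ka * (1 + C1 + C0 * C1) * (eps / tau + tau * (t / s) + ps / pt).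
Proof.
move=> t0 s0 t40 k0 kE C10 C00 ps0 pt0 p20 h2 Z0 tau0 e0 HJ H1 H2 H3 H.
have HJ2 : t4 * Z <= 16 * (ps * J).
  rewrite -(ler_pM2l ps0) in HJ; apply: le_trans (_ : 16 * (ps * (t4 / 8 / p2s * Z)) <= _); last by lra.
  have : 1 <= 2 * (ps / p2s) by rewrite mulrA ler_pdivlMr// mul1r.
  have tZ : 0 <= t4 * Z by rewrite mulr_ge0// ltW.
  move=> /(ler_wpM2l tZ); rewrite mulr1 => h; apply: le_trans h _.
  rewrite le_eqVlt; apply/orP; left; apply/eqP; field; by rewrite gt_eqF.
set x1 := eps / tau; set x2 := tau * (t / s); set x3 := ps / pt.
have y1 : 0 <= x1 by rewrite divr_ge0// ltW.
have y2 : 0 <= x2 by rewrite mulr_ge0 ?divr_ge0// ltW.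
have y3 : 0 <= x3 by rewrite divr_ge0// ltW.
have HH : 3 / 2 * ka * (ps * J) <= t4 * (x1 + x2 * C1 + C0 * C1 * x3).
  have c1 : 0 <= ka / 4 * tau by rewrite mulr_ge0 ?divr_ge0// ltW.
  have c2 : 0 <= C0 / pt by rewrite divr_ge0// ltW.
  have G2 := ler_wpM2l c1 H2; have G3 := ler_wpM2l c2 H3.
  have h : 3 / 2 * ka * J <= tau^-1 * ps^-1 * (t4 * eps)
     + ka / 4 * tau * (ps^-1 * s^-1 * (256 * (t * (C1 * t4)))) + C0 / pt * (C1 * t4) by lra.
  have := ler_wpM2l (ltW ps0) h.
  have -> : ps * (tau^-1 * ps^-1 * (t4 * eps)
     + ka / 4 * tau * (ps^-1 * s^-1 * (256 * (t * (C1 * t4)))) + C0 / pt * (C1 * t4)) =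
    t4 * (x1 + (64 * ka) * x2 * C1 + C0 * C1 * x3).
    by rewrite /x1 /x2 /x3; field; rewrite !gt_eqF.
  rewrite kE; lra.
have : t4 * (3 * ka * Z) <= t4 * (32 * (x1 + x2 * C1 + C0 * C1 * x3)).
  have := ler_wpM2l (mulr_ge0 (ler0n R 3) (ltW k0)) HJ2; lra.
rewrite ler_pM2l// => h.
have -> : 64 / ka * (1 + C1 + C0 * C1) * (x1 + x2 + x3) =
  (64 * (1 + C1 + C0 * C1) * (x1 + x2 + x3)) / ka by field; rewrite gt_eqF.
rewrite ler_pdivlMr//.
clearbody x1 x2 x3; clear H H1 H2 H3 HJ HJ2 HH.
have C2 : 0 <= C0 * C1 by rewrite mulr_ge0// ltW.
have n1 := mulr_ge0 y1 (ltW C10); have n2 := mulr_ge0 y1 C2; have n3 := mulr_ge0 y2 C2.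
have n4 := mulr_ge0 y3 (ltW C10); have n5 := mulr_ge0 y2 (ltW C10); have n6 := mulr_ge0 y3 C2.
have kZ : 0 <= ka * Z by rewrite mulr_ge0// ltW.
lra.
Qed.

Lemma bump_mono k p (s t : R) x : s <= t -> bump k p s x <= bump k p t x.
Proof.
move=> st; rewrite bumpE [leRHS]bumpE lerXn2r ?nnegrE ?bump_ge0//.
rewrite /bump /posp !expr1 ge_max !le_max; apply/andP; split; apply/orP; first by left; lra.
by right.
Qed.

(* If the total curvature is small, subharmonicity bounds f from above at the scale t,
   and the energy of f itself is small at the smaller scale s. *)
Lemma energy_far : exists2 C : R, 0 < C & forall f df ddf p s t tau eps,
  C2 f df ddf -> 0 < s -> 4 * s <= t -> 0 < tau -> tau <= 1 -> 0 <= eps ->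
  gamma2_on [set x | sqd p x < 18 * t] df ddf ->
  int4 (fun x => twice_sigma2 df ddf x * bump 4 p t x) <= t ^+ 4 * eps ->
  energy df p s <= C * (eps / tau + tau * (t / s) + pw (s / t)).
Proof.
have [C0 C00 W] := @weighted_energy_decay R; have o0 : 0 < (omega : R) := omega_gt0.
have k0 : 0 < (kappa : R) := kappa_gt0.
pose C1 : R := 8 * (omega : R) + 128 * (16 * omega).
have C10 : 0 < C1 by rewrite /C1; lra.
exists (64 / (kappa : R) * (1 + C1 + C0 * C1)).
  apply: mulr_gt0; first exact: divr_gt0.
  by have := mulr_gt0 C00 C10; lra.
move=> f df ddf p s t tau eps Cf s0 st tau0 tau1 e0 G18 HS; have [Cf1 Cdf] := Cf.
have t0 : 0 < t by lra.
have t2 : 0 < 2 * t by lra.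
have tau0' := ltW tau0.
have G : gamma2_on [set x | sqd p x < 2 * t] df ddf.
  by move=> x /= xt; apply: G18 => /=; lra.
have cphi : cont (fun x => expR (- f x)).
  have := cont_expR_aff 1 0 Cf1; under eq_fun do rewrite mul1r sub0r.
  exact.
pose M := int4 (fun y => expR (- f y) * bump 2 p (2 * t) y).
pose D := 256 * omega * (2 * t) ^+ 4.
have D0 : 0 < D.
  by rewrite /D; apply: mulr_gt0; [apply: mulr_gt0; [exact: ltr0n|]|apply: exprn_gt0; apply: mulr_gt0].
have M0 : 0 < M.
  apply: (@int4_gt0 _ _ p); first by cctac.
    by move=> x; apply: mulr_ge0; [exact: expR_ge0|exact: bump_ge0].
  by rewrite bump_in sqdxx ?subr0// mulr_gt0 ?expR_gt0// exprn_gt0.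
have LH x : sqd p x <= 2 * t -> M <= D * expR (- f x).
  move=> xt; apply: (@lower_harnack _ _ df ddf) => // y yt.
  by have [] := G18 y; rewrite /=; lra.
(* The upper bound for f that [lower_harnack] gives. With this k the integral of exp (k - f) against
   the cut-off is exactly D, of order t^4. *)
pose k := ln (D / M).
have kE : expR k = D / M by rewrite lnK// posrE divr_gt0.
have fk x : sqd p x <= 2 * t -> f x <= k.
  move=> /LH h; rewrite -ler_expR kE -[f x]opprK expRN ler_pdivlMr// mulrC.
  by rewrite ler_pdivrMr ?expR_gt0.
have := W f df ddf p s t tau k Cf s0 t0 tau0' G.
have cP := C1_continuous (C1_psi k Cf1 tau0').
set P := psi f tau k in cP *.
pose iE x := expR (4^-1 * (k - f x)).
have ciE : cont iE by exact: cont_expR_aff Cf1.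
pose iE2 x := expR (2^-1 * (k - f x)).
have ciE2 : cont iE2 by exact: cont_expR_aff Cf1.
have iEE2 x : iE x * iE x = iE2 x by rewrite -expRD; congr expR; field.
have cS := cont_twice_sigma2 Cf.
have cdf i : cont (df i) by exact: C1_dcontinuous Cf1.
have cN : cont (dotp df df) by rewrite /dotp; ctac.
have cs := cont_sqd p; have cwt := C1_continuous (C1_weight p s0).
have cwb := ccs_wbump p t s0.
have a0 x : 0 < s + sqd p x by rewrite ltr_pwDl// sqd_ge0.
have ca : cont (fun x => (s + sqd p x)^-1).
  apply: cont_inv; first by ctac.
  by move=> x; rewrite gt_eqF.
have P0 x : 0 < P x by exact: psi_gt0.
have P0' x : 0 <= P x by exact: ltW.
have ia0 x : 0 <= (s + sqd p x)^-1 by rewrite invr_ge0 ltW.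
have E0 x : 0 < expR (4^-1 * (f x - k)) by exact: expR_gt0.
have PE x : P x * (tau + expR (4^-1 * (f x - k))) = 1.
  by rewrite mulVf// gt_eqF// ltr_pwDl// expR_ge0.
have iEE x : iE x * expR (4^-1 * (f x - k)) = 1.
  by rewrite /iE -expRD -mulrDr addrA subrK subrr mulr0 expR0.
have iE0 x : 0 < iE x by exact: expR_gt0.
have E1 x : sqd p x < 2 * t -> expR (4^-1 * (f x - k)) <= 1.
  by move=> /ltW /fk h; rewrite -expR0 ler_expR pmulr_rle0// subr_le0.
have iE1 x : sqd p x < 2 * t -> 1 <= iE x.
  by move=> /E1 h; rewrite -(iEE x) ler_piMr ?(ltW (iE0 x)).
have Ptau x : P x <= tau^-1.
  by rewrite /P /psi lef_pV2 ?posrE// ?lerDl ?(ltW (E0 x))// ltr_pwDl.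
have PiE x : P x <= iE x.
  have := PE x; have := iEE x; have := P0' x; have := E0 x.
  set E := expR _ => h1 h2 h3 h4.
  have h5 : P x * E <= 1 by rewrite -h4 ler_wpM2l// lerDr.
  by rewrite -(ler_pM2r h1) h3.
have P2 x : sqd p x < 2 * t -> 1 <= 2 * P x.
  move=> /E1 h; have := PE x; have := ler_wpM2l (P0' x) h; have := ler_wpM2l (P0' x) tau1; lra.
have N0 := dotp_ge0 df.
have wb0 x : 0 <= wbump p s t x by rewrite mulr_ge0 ?bump_ge0// ltW// weight_gt0.
set J := int4 _; set I1 := int4 _; set I2 := int4 _; set I3 := int4 _ => H.
have ips : 0 < (pw s)^-1 by rewrite invr_gt0 pw_gt0.
have t4 : 0 < t ^+ 4 by rewrite exprn_gt0.
(* exp ((k - f) / 2) is at most (1 + exp (k - f)) / 2, and the second summand integrates to D /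
   2. *)
pose B := int4 (fun x => iE2 x * bump 2 p (2 * t) x).
have HB : B <= C1 * t ^+ 4.
  have -> : C1 * t ^+ 4 = 2^-1 * (omega * (2 * t) ^+ 4) + 2^-1 * D.
    by rewrite /C1 /D; field.
  have -> : D = expR k * M by rewrite kE divfK// gt_eqF.
  rewrite -(int4_bump p t2) /M -[expR k * _]int4Z; last by cctac.
  rewrite -[2^-1 * int4 (bump _ _ _)]int4Z; last by cctac.
  rewrite -[2^-1 * int4 (fun x => _)]int4Z; last by cctac.
  rewrite -int4D; [|cctac|cctac].
  apply: int4_le; [cctac|cctac|move=> x].
  have u0 := bump_ge0 2 p (2 * t) x.
  suff : iE2 x <= 2^-1 + 2^-1 * (expR k * expR (- f x)).
    by move=> /(ler_wpM2r u0); lra.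
  rewrite -expRD; have -> : expR (k - f x) = iE2 x * iE2 x by rewrite -expRD; congr expR; field.
  have := sqr_ge0 (1 - iE2 x); rewrite expr2; lra.
have H1 : I1 <= tau^-1 * (pw s)^-1 * (t ^+ 4 * eps).
  apply: le_trans (_ : tau^-1 * (pw s)^-1 *
     int4 (fun x => twice_sigma2 df ddf x * bump 4 p t x) <= _); last first.
    by apply: ler_wpM2l => //; rewrite mulr_ge0// ?invr_ge0 ltW// pw_gt0.
  rewrite -int4Z; last by cctac.
  apply: int4_le; [cctac|cctac|move=> x].
  have [xt|tx] := ltP (sqd p x) t; last by rewrite /wbump !bump_out// !(mulr0, mul0r).
  have x2 : sqd p x < 2 * t by lra.
  have [_ _ S0] := G x x2.
  have c0 : 0 <= twice_sigma2 df ddf x * bump 4 p t x by rewrite mulr_ge0 ?bump_ge0.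
  have : P x * weight p s x <= tau^-1 * (pw s)^-1.
    by apply: ler_pM => //; [rewrite ltW ?weight_gt0|exact: weight_le].
  by move=> /(ler_wpM2l c0); rewrite /wbump; lra.
(* P iE <= iE^2 = exp ((k - f) / 2), which is the extreme exponent c = 1/2 of [caccioppoli]. The
   weight is replaced by its largest value, attained at p, which costs the factor t / s. *)
have H2 : I2 <= (pw s)^-1 * s^-1 * (256 * (t * (C1 * t ^+ 4))).
  have c2 : 0 <= (2^-1 : R) <= 2^-1 by rewrite invr_ge0 ler0n/=.
  have hN x : sqd p x < t -> dotp df df x <= lap ddf x.
    by move=> xt; have [] := G x; rewrite /=; lra.
  have := caccioppoli k Cf c2 hN; rewrite -/iE2 => CC.
  have B2 : int4 (fun x => iE2 x * sqd p x * bump 2 p t x) <= t * B.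
    rewrite /B -int4Z; last by cctac.
    apply: int4_le; [cctac|cctac|move=> x].
    have [xt|tx] := ltP (sqd p x) t; last first.
      rewrite bump_out// mulr0; apply: mulr_ge0; first exact: ltW.
      by apply: mulr_ge0; [exact: expR_ge0|exact: bump_ge0].
    have tb : t <= 2 * t by lra.
    have bm := bump_mono 2 p x tb; have b0 := bump_ge0 2 p t x.
    have qb : sqd p x * bump 2 p t x <= t * bump 2 p (2 * t) x.
      by apply: ler_pM => //; [exact: sqd_ge0|exact: ltW].
    by have := ler_wpM2l (expR_ge0 (2^-1 * (k - f x))) qb; rewrite -/(iE2 x); lra.
  apply: le_trans (_ : (pw s)^-1 * s^-1 * (int4 (fun x => iE2 x * dotp df df x * bump 4 p t x)) <= _).
    rewrite -int4Z; last by cctac.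
    apply: int4_le; [cctac|cctac|move=> x].
    have b0 := bump_ge0 4 p t x.
    have PP : P x * iE x <= iE2 x by rewrite -iEE2 ler_wpM2r// ltW.
    have WW : weight p s x * (s + sqd p x)^-1 <= (pw s)^-1 * s^-1.
      apply: ler_pM => //; [by rewrite ltW ?weight_gt0|exact: weight_le|].
      by rewrite lef_pV2 ?posrE// lerDl sqd_ge0.
    have c0 : 0 <= dotp df df x * bump 4 p t x by rewrite mulr_ge0.
    have pi0 : 0 <= P x * iE x by rewrite mulr_ge0// ltW.
    have w0 : 0 <= weight p s x * (s + sqd p x)^-1.
      by rewrite mulr_ge0// ltW// weight_gt0.
    by have := ler_wpM2l c0 (ler_pM pi0 w0 PP WW); rewrite /wbump -/(iE x); lra.
  apply: ler_wpM2l; first by rewrite mulr_ge0 ?invr_ge0 ?(ltW s0)// ltW// pw_gt0.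
  apply: le_trans CC _; apply: ler_wpM2l; first exact: ler0n.
  by apply: le_trans B2 _; rewrite ler_pM2l.
have H3 : I3 <= C1 * t ^+ 4.
  apply: le_trans HB; apply: int4_le; [cctac|cctac|move=> x].
  have [xt|tx] := ltP (sqd p x) (2 * t); last by rewrite !bump_out// !(mulr0, mul0r).
  by rewrite ler_wpM2r ?bump_ge0// -iEE2 ler_peMl ?(ltW (iE0 x))// iE1.
have PN0 x : 0 <= P x * dotp df df x by rewrite mulr_ge0// ltW.
have cPN : cont (fun x => P x * dotp df df x) by ctac.
have := energy_le_weighted p cPN PN0 s0 st.
set Z := _ * int4 _ => H4.
have EJ : int4 (fun x => P x * dotp df df x * (wbump p s t x * (s + sqd p x)^-1)) = J.
  by apply: eq_int4 => x; ring.
rewrite EJ in H4.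
have H5 : energy df p s <= 2 * Z.
  rewrite /Z mulrCA; apply: ler_wpM2l; first by rewrite exprn_ge0// invr_ge0 ltW.
  rewrite -int4Z; last by cctac.
  apply: int4_le; [cctac|cctac|move=> x].
  have [xs|sx] := ltP (sqd p x) s; last by rewrite !bump_out// !(mulr0, mul0r).
  have x2 : sqd p x < 2 * t by lra.
  have c0 : 0 <= dotp df df x * bump 2 p s x by rewrite mulr_ge0 ?bump_ge0.
  by have := ler_wpM2r c0 (P2 x x2); lra.
apply: le_trans H5 _.
have Z0 : 0 <= Z.
  rewrite mulr_ge0 ?exprn_ge0 ?invr_ge0 ?(ltW s0)//; apply: int4_ge0 => x.
  by apply: mulr_ge0; [|exact: bump_ge0].
have -> : pw (s / t) = pw s / pw t by rewrite pwM ?invr_gt0// pwV.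
have kE64 : 64 * kappa = 1 :> R by rewrite /kappa divff.
exact: (far_arith t0 s0 t4 k0 kE64 C10 C00 (pw_gt0 s) (pw_gt0 t) (pw_gt0 (2 * s)) (pw_double s0)
  Z0 tau0 e0 H4 H1 H2 H3 H).
Qed.

End energy_far.

(** * Concentration of mass and the Harnack inequality *)

Section concentration.
Context {R : realType}.
Local Notation V := 'rV[R]_4.
Implicit Types (f : V -> R) (df : 'I_4 -> V -> R) (ddf : 'I_4 -> 'I_4 -> V -> R) (p : V).

Lemma pw_ge_id (z : R) : 0 < z -> z <= 1 -> z <= pw z.
Proof.
move=> z0 z1; have : 1 <= z^-1 by rewrite invf_ge1.
by move=> /pw_le_id; rewrite pwV// lef_pV2 ?posrE ?pw_gt0.
Qed.

(** The graph of v^8 lies above its tangent at t. Integrated, this is Jensen's inequality for the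
    eighth power, which leads from the mean of exp (- f / 8) to that of exp (- f). *)
Lemma tangent_pow8 (v t : R) : 0 <= t -> 8 * t ^+ 7 * v - 7 * t ^+ 8 <= v ^+ 8.
Proof.
move=> t0.
have h (a b : R) : 2 * b * a - b ^+ 2 <= a ^+ 2 by have := sqr_ge0 (a - b); lra.
have h1 := h v t; have h2 := h (v ^+ 2) (t ^+ 2); have h4 := h (v ^+ 4) (t ^+ 4).
have k1 := ler_wpM2l (exprn_ge0 2 t0) h1; have k2 := ler_wpM2l (exprn_ge0 4 t0) h2.
have k3 := ler_wpM2l (exprn_ge0 4 t0) k1.
lra.
Qed.

(** (s / T)^(kappa / 4), whose square is the energy bound at scale s. Taken as the parameter d of
    [avg_derive_bound], it bounds the derivative of the mean by a multiple of halfpow / s, which is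
    integrable down to s = 0. *)
Definition halfpow (T s : R) : R := expR (kappa / 4 * (ln s - ln T)).

Lemma is_derive_halfpow (T s : R) : 0 < s ->
  is_derive s 1 (halfpow T) (kappa / 4 * s^-1 * halfpow T s).
Proof.
move=> s0; have H0 := is_deriveB (is_derive1_ln s0) (is_derive_cst (ln T) s 1).
have H1 := @is_deriveZ R R R _ (kappa / 4) s 1 _ H0.
have H := @is_derive1_comp R expR (fun s : R => kappa / 4 * (ln s - ln T)) s _ _
  (is_derive_expR _) H1.
apply: (is_derive_eq H); rewrite subr0 /halfpow.
by rewrite [kappa / 4 *: _]/(_ * _) mulrC.
Qed.

(* Where sigma_2 is below the scale-invariant threshold, the mass of exp (- f) around
   a near-maximum is comparable to its value there. *)
Lemma mass_near_max (A : R) : exists2 lam : R, 0 < lam <= 64^-1 & forall f df ddf p T,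
  C2 f df ddf -> 0 < T -> gamma2_on [set x | sqd p x < T] df ddf ->
  (forall x, sqd p x < T -> f p - A <= f x) ->
  (forall x, sqd p x < T -> twice_sigma2 df ddf x <= T^-1 ^+ 2) ->
  omega * (2^-1 ^+ 8 * expR (- f p)) <= avg (fun x => expR (- f x)) p (lam * T).
Proof.
have [C C0 N] := @energy_near R; have o0 : 0 < (omega : R) := omega_gt0.
have k0 : 0 < (kappa : R) := kappa_gt0.
pose c2 : R := (omega + C) / kappa; have c20 : 0 < c2 by rewrite divr_gt0// addr_gt0.
pose m := 2^-1 * omega * expR (- (8^-1 * A)) / c2.
have m0 : 0 < m by rewrite divr_gt0// mulr_gt0 ?expR_gt0// mulr_gt0.
(* The first entry makes c2 * halfpow at scale lam * T at most half of omega * v p; the second gives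
   z <= 8^-1 below, the room needed for 4 * s <= t. *)
pose lam := Num.min (expR (4 / kappa * ln m)) 64^-1.
have lam0 : 0 < lam by rewrite lt_min expR_gt0 invr_gt0 ltr0n.
have [lam1 lam2] : lam <= expR (4 / kappa * ln m) /\ lam <= 64^-1.
  by rewrite !ge_min !lexx orbT.
exists lam; first by rewrite lam0.
move=> f df ddf p T Cf T0 G fA SS; have [Cf1 Cdf] := Cf.
(* [energy_near] controls exp ((k - f) / 4) |df|^2, and this is 64 |dv|^2. *)
pose k := f p - A; pose v x := expR (8^-1 * (k - f x)).
have Cv : C1 v (fun i x => - (8^-1 * v x) * df i x).
  have := C1_expR (C1_Z 8^-1 (C1_D (C1_cst k) (C1_Z (-1) Cf1))).
  under eq_fun do rewrite mulN1r.
  by apply: C1_eq => i x; rewrite mulN1r -/(v x); ring.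
have cv := C1_continuous Cv.
have cdf i : cont (df i) by exact: C1_dcontinuous Cf1.
have cN : cont (dotp df df) by rewrite /dotp; ctac.
have lt64 : lam * T <= 64^-1 * T by rewrite ler_pM2r.
have hpos (s : R) : 0 < halfpow T s by exact: expR_gt0.
have energy_v s : 0 < s -> s <= 64^-1 * T ->
    energy (fun i x => - (8^-1 * v x) * df i x) p s <= C * halfpow T s ^+ 2.
  move=> s0 sT; pose z := expR (2^-1 * (ln s - ln T)).
  have z0 : 0 < z by exact: expR_gt0.
  have z2 : z ^+ 2 * T = s.
    rewrite expr2 -expRD -mulrDl; have -> : 2^-1 + 2^-1 = 1 :> R by lra.
    by rewrite mul1r expRB !lnK ?posrE// divfK// gt_eqF.
  have z8 : z <= 8^-1.
    rewrite leNgt; apply/negP => h; have : 8^-1 ^+ 2 < z ^+ 2 by rewrite ltrXn2r// ?nnegrE// ltW.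
    by rewrite -(ltr_pM2r T0) z2; lra.
  (* Half the geometric mean of s and T: then s / t and t / T are both of order (s / T)^(1 / 2), and
     both terms of [energy_near] are bounded by a multiple of (s / T)^(kappa / 2). *)
  pose t := 2^-1 * z * T.
  have t0 : 0 < t by rewrite !mulr_gt0.
  have h4 : 4 * s <= t.
    rewrite -z2 /t expr2; have := ler_wpM2l (ltW (mulr_gt0 z0 T0)) z8; lra.
  have h2t : 2 * t <= T by rewrite /t; have := ler_wpM2r (ltW T0) z8; lra.
  have G2 : gamma2_on [set x | sqd p x < 2 * t] df ddf.
    by move=> x /= xt; apply: G => /=; apply: lt_le_trans h2t.
  have T2 : 0 <= T^-1 ^+ 2 by rewrite sqr_ge0.
  have := N f df ddf p s t k (T^-1 ^+ 2) Cf s0 h4 T2 G2.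
  move=> H; have {}H := H (fun x xt => fA x (lt_le_trans xt h2t)).
  have t2t : t <= T by lra.
  have {}H := H (fun x xt => SS x (lt_le_trans xt t2t)).
  have st : s / t = 2 * z.
    by rewrite -z2 /t; field; rewrite !gt_eqF.
  have E1 : T^-1 ^+ 2 * t ^+ 2 = 4^-1 * z ^+ 2.
    by rewrite /t; field; rewrite gt_eqF.
  have hz : halfpow T s ^+ 2 = pw z.
    by rewrite /halfpow /pw /z expRK expr2 -expRD; congr expR; field.
  rewrite hz /energy; apply: le_trans (_ : 64^-1 * (C * (T^-1 ^+ 2 * t ^+ 2 + pw (s / t))) <= _).
    apply: le_trans (ler_wpM2l _ H); last by rewrite invr_ge0.
    rewrite mulrCA; apply: ler_wpM2l; first by rewrite exprn_ge0// invr_ge0 ltW.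
    have cc := cont_expR_aff 4^-1 k Cf1.
    rewrite -int4Z; last by cctac.
    rewrite le_eqVlt; apply/orP; left; apply/eqP; apply: eq_int4 => x.
    have -> : expR (4^-1 * (k - f x)) = v x * v x by rewrite /v -expRD; congr expR; field.
    by rewrite /dotp !sum4; field.
  rewrite E1 st; have := pw_double z0; have z1 : z <= 1 by lra.
  have := pw_ge_id z0 z1; have zz : z ^+ 2 <= z by rewrite expr2 ler_piMl// ltW.
  move=> h1 h2; rewrite mulrCA ler_pM2l//; lra.
(* The mean of v plus c2 * halfpow is nondecreasing in the scale; its limit at s = 0 is omega * v
   p. *)
have step s : 0 < s -> s < lam * T -> avg v p s <= avg v p (lam * T) + c2 * halfpow T (lam * T).
  move=> s0 sl.
  have D (u : R) : 0 < u -> is_derive u 1 (fun u => avg v p u + c2 * halfpow T u)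
    (2^-1 * u^-1 ^+ 5 * int4 (fun x => dotp (fun i x => - (8^-1 * v x) * df i x) (rad p) x
       * bump 2 p u x) + c2 * (kappa / 4 * u^-1 * halfpow T u)).
    move=> u0; have H1 := is_derive_avg p Cv u0.
    have H2 := @is_deriveZ R R R _ c2 u 1 _ (is_derive_halfpow T u0).
    exact: (is_deriveD H1 H2).
  have [u /andP[su ul] E] := MVT_gt0 D s0 sl.
  have u0 : 0 < u by exact: lt_trans su.
  have hu := hpos u.
  have := avg_derive_bound p Cv u0 hu.
  have uT : u <= 64^-1 * T by exact: le_trans (ltW ul) lt64.
  have EV := energy_v u u0 uT.
  set I := (X in `|X|); move=> IB.
  have c4 : 0 <= (4 * u)^-1 by rewrite invr_ge0 mulr_ge0// ltW.
  have ihu : 0 <= (halfpow T u)^-1 by rewrite invr_ge0 ltW.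
  have IB2 : `|I| <= (4 * u)^-1 * (halfpow T u * omega + C * halfpow T u).
    apply: le_trans IB _; apply: ler_wpM2l => //; rewrite lerD2l.
    apply: le_trans (ler_wpM2l ihu EV) _.
    by rewrite le_eqVlt; apply/orP; left; apply/eqP; field; rewrite gt_eqF.
  have : 0 <= I + c2 * (kappa / 4 * u^-1 * halfpow T u).
    have -> : c2 * (kappa / 4 * u^-1 * halfpow T u) =
      (4 * u)^-1 * (halfpow T u * omega + C * halfpow T u).
      by rewrite /c2; field; rewrite !gt_eqF.
    have := ler_norm (- I); rewrite normrN; lra.
  move=> h0; have slu : 0 <= lam * T - s by rewrite subr_ge0 ltW.
  have := mulr_ge0 h0 slu; rewrite -/I -E; have := mulr_ge0 (ltW c20) (ltW (hpos s)); lra.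
have lT0 : 0 < lam * T by rewrite mulr_gt0.
have hlim : omega * v p <= avg v p (lam * T) + c2 * halfpow T (lam * T).
  by apply: (avg_limit_le cv lT0) => s /andP[s0 sl]; exact: step.
have vp : v p = expR (- (8^-1 * A)) by rewrite /v /k; congr expR; ring.
have hl : c2 * halfpow T (lam * T) <= 2^-1 * omega * v p.
  have : halfpow T (lam * T) <= m.
    rewrite /halfpow lnM ?posrE// addrK -[leRHS](lnK m0) ler_expR.
    have : ln lam <= 4 / kappa * ln m by rewrite -ler_expR lnK ?posrE.
    have ka4 : 0 <= (kappa / 4 : R) by rewrite divr_ge0// ltW.
    move=> /(ler_wpM2l ka4) h; apply: le_trans h _.
    rewrite le_eqVlt; apply/orP; left; apply/eqP; field; by rewrite gt_eqF.
  move=> /(ler_wpM2l (ltW c20)) h; apply: le_trans h _.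
  by rewrite /m mulrC divfK ?gt_eqF// vp.
have vp0 : 0 < v p by exact: expR_gt0.
(* The point of tangency for Jensen's inequality; its eighth power is the source of 2^-8 in the
   conclusion. *)
set tau := 2^-1 * v p.
have tau0 : 0 <= tau by rewrite mulr_ge0// ltW.
have avg_ge : omega * tau <= avg v p (lam * T) by rewrite /tau; lra.
have cphi : cont (fun x => expR (- f x)).
  have := cont_expR_aff 1 0 Cf1; under eq_fun do rewrite mul1r sub0r.
  exact.
have phiE x : expR (- f x) = expR (- k) * v x ^+ 8.
  by rewrite /v -expRM_natl -expRD; congr expR; field.
have J : int4 (fun x => expR (- k) * ((8 * tau ^+ 7 * v x - 7 * tau ^+ 8) * bump 2 p (lam * T) x)) <=
    int4 (fun x => expR (- f x) * bump 2 p (lam * T) x).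
  apply: int4_le; [|cctac|move=> x].
    have cc : cont (fun x => 8 * tau ^+ 7 * v x - 7 * tau ^+ 8) by ctac.
    cctac.
  rewrite phiE -[leRHS]mulrA; apply: ler_wpM2l; first exact: expR_ge0.
  by rewrite ler_wpM2r ?bump_ge0// tangent_pow8.
have s4 : 0 < (lam * T)^-1 ^+ 4 by rewrite exprn_gt0// invr_gt0.
have := ler_wpM2l (ltW s4) J; rewrite -/(avg (fun x => expR (- f x)) p (lam * T)).
apply: le_trans.
have E : int4 (fun x => expR (- k) * ((8 * tau ^+ 7 * v x - 7 * tau ^+ 8) * bump 2 p (lam * T) x)) =
   expR (- k) * (8 * tau ^+ 7 * int4 (fun x => v x * bump 2 p (lam * T) x)
     - 7 * tau ^+ 8 * (omega * (lam * T) ^+ 4)).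
  rewrite -(int4_bump p lT0).
  rewrite -[8 * tau ^+ 7 * int4 _]int4Z; last by cctac.
  rewrite -[7 * tau ^+ 8 * int4 _]int4Z; last by cctac.
  rewrite -int4B; [|cctac|cctac].
  by rewrite -int4Z; [apply: eq_int4 => x; ring|cctac].
rewrite E.
have -> : (lam * T)^-1 ^+ 4 * (expR (- k) * (8 * tau ^+ 7 * int4 (fun x => v x * bump 2 p (lam * T) x)
     - 7 * tau ^+ 8 * (omega * (lam * T) ^+ 4))) =
  expR (- k) * (8 * tau ^+ 7 * avg v p (lam * T) - 7 * tau ^+ 8 * omega).
  by rewrite /avg; field; rewrite !gt_eqF.
have -> : omega * (2^-1 ^+ 8 * expR (- f p)) = expR (- k) * (omega * tau ^+ 8).
  by rewrite phiE /tau; ring.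
apply: ler_wpM2l; first exact: expR_ge0.
have t7 : 0 <= 8 * tau ^+ 7 by rewrite mulr_ge0// exprn_ge0.
have := ler_wpM2l t7 avg_ge; lra.
Qed.

End concentration.

Section growth_of_mean.
Context {R : realType}.
Local Notation V := 'rV[R]_4.
Implicit Types (f : V -> R) (df : 'I_4 -> V -> R) (ddf : 'I_4 -> 'I_4 -> V -> R) (p : V).

Lemma pw_surj (y : R) : 0 < y -> pw (expR (kappa^-1 * ln y)) = y.
Proof.
move=> y0; have k0 : kappa != 0 :> R by rewrite gt_eqF// kappa_gt0.
by rewrite /pw expRK mulVKf// lnK ?posrE.
Qed.

(** [avg_derive_bound] with d = 1/2 and energy at most omega / 4 bounds the derivative of the mean
    by omega / (4 s). At this rate exp (- 4 f) loses one power of s while the volume gains two, so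
    the mass still grows linearly in s. *)
Lemma far_drop : exists2 L : R, 1 <= L & exists2 eps : R, 0 < eps &
  forall f df ddf p s0 s1, C2 f df ddf -> 0 < s0 -> s0 < s1 ->
  gamma2_on [set x | sqd p x < L * s1] df ddf ->
  (forall t, 0 < t -> t <= L * s1 ->
     int4 (fun x => twice_sigma2 df ddf x * bump 4 p t x) <= t ^+ 4 * eps) ->
  avg f p s1 <= avg f p s0 + 4^-1 * omega * (ln s1 - ln s0).
Proof.
have [C C0 F] := @energy_far R; have o0 : 0 < (omega : R) := omega_gt0.
(* Each of the three terms of [energy_far] at t = Lam * s is to be at most d, so that the energy is
   at most omega / 4. This fixes Lam for the power of s / t, then tau for tau * Lam, and last eps =
   d * tau. *)
pose d : R := omega / (12 * C).
have d0 : 0 < d by rewrite divr_gt0// mulr_gt0.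
pose m := expR (- (kappa^-1 * ln d)).
pose Lam := Num.max 4 m.
have [Lam4 Lamm] : 4 <= Lam /\ m <= Lam by rewrite !le_max !lexx orbT.
have Lam0 : 0 < Lam by apply: lt_le_trans Lam4; rewrite ltr0n.
pose tau := Num.min 1 (d / Lam).
have tau0 : 0 < tau by rewrite lt_min ltr01 divr_gt0.
have [tau1 tau2] : tau <= 1 /\ tau <= d / Lam by rewrite !ge_min !lexx orbT.
pose eps := d * tau; have eps0 : 0 < eps by rewrite mulr_gt0.
exists (18 * Lam); first by lra.
exists eps => // f df ddf p s0 s1 Cf s00 s01 G HS; have [Cf1 Cdf] := Cf.
pose w : R := 4^-1 * omega.
have D (s : R) : 0 < s -> is_derive s 1 (fun s => avg f p s - w * ln s)
    (2^-1 * s^-1 ^+ 5 * int4 (fun x => dotp df (rad p) x * bump 2 p s x) - w * s^-1).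
  move=> sp; have H1 := is_derive_avg p Cf1 sp.
  have H2 := @is_deriveZ R R R _ w s 1 _ (is_derive1_ln sp).
  exact: (is_deriveB H1 H2).
have [s /andP[s0s ss1] E] := MVT_gt0 D s00 s01.
have sp : 0 < s by exact: lt_trans s0s.
have half0 : 0 < (2^-1 : R) by rewrite invr_gt0.
have := avg_derive_bound p Cf1 sp half0; rewrite invrK.
set I := (X in `|X|) => IB.
have hst : 4 * s <= Lam * s by rewrite ler_pM2r.
have Ls : Lam * s <= Lam * s1 by rewrite ler_pM2l// ltW.
have L1 : 0 <= Lam * s1 by rewrite mulr_ge0 ?ltW// (lt_trans s00).
have EN : energy df p s <= 4^-1 * omega.
  have G' : gamma2_on [set x | sqd p x < 18 * (Lam * s)] df ddf.
    by move=> x /= xs; apply: G => /=; lra.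
  have HS' : int4 (fun x => twice_sigma2 df ddf x * bump 4 p (Lam * s) x) <= (Lam * s) ^+ 4 * eps.
    by apply: HS; [rewrite mulr_gt0|lra].
  have := F f df ddf p s (Lam * s) tau eps Cf sp hst tau0 tau1 (ltW eps0) G' HS'.
  have -> : eps / tau = d by rewrite /eps mulfK// gt_eqF.
  have -> : Lam * s / s = Lam by rewrite mulfK// gt_eqF.
  have -> : s / (Lam * s) = Lam^-1 by field; rewrite !gt_eqF.
  have h1 : tau * Lam <= d by rewrite -ler_pdivlMr.
  have h2 : pw Lam^-1 <= d.
    rewrite -(pw_surj d0) pw_le ?invr_gt0//.
    by rewrite -[leRHS]invrK -expRN lef_pV2 ?posrE// ?expR_gt0.
  have : C * d = omega / 12 by rewrite /d; field; rewrite gt_eqF.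
  have := ler_wpM2l (ltW C0) h1; have := ler_wpM2l (ltW C0) h2; lra.
have IB2 : I <= w * s^-1.
  apply: le_trans (ler_norm _) _; apply: le_trans IB _.
  have c0 : 0 <= (4 * s)^-1 by rewrite invr_ge0 mulr_ge0// ltW.
  have : 2^-1 * omega + 2 * energy df p s <= omega by lra.
  move=> /(ler_wpM2l c0) h; apply: le_trans h _; rewrite /w.
  by rewrite le_eqVlt; apply/orP; left; apply/eqP; field; rewrite gt_eqF.
have h0 : I - w * s^-1 <= 0 by rewrite subr_le0.
have h1 : 0 <= s1 - s0 by rewrite subr_ge0 ltW.
have := mulr_le0_ge0 h0 h1; rewrite -/I -E -/w; lra.
Qed.

End growth_of_mean.

(** * The blow-up argument *)

Section sup_bound.
Context {R : realType}.
Local Notation V := 'rV[R]_4.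
Implicit Types (f g : V -> R) (df : 'I_4 -> V -> R) (ddf : 'I_4 -> 'I_4 -> V -> R) (p : V).

Definition edist p x : R := Num.sqrt (sqd p x).

Lemma edist_ge0 p x : 0 <= edist p x. Proof. exact: sqrtr_ge0. Qed.

Lemma edist_sqr p x : edist p x ^+ 2 = sqd p x.
Proof. by rewrite sqr_sqrtr// sqd_ge0. Qed.

Lemma edistxx p : edist p p = 0. Proof. by rewrite /edist sqdxx sqrtr0. Qed.

Lemma edistC p x : edist p x = edist x p. Proof. by rewrite /edist sqdC. Qed.

Lemma edist_lt p x r : 0 <= r -> (edist p x < r) = (sqd p x < r ^+ 2).
Proof. by move=> r0; rewrite -edist_sqr ltr_pXn2r ?nnegrE ?edist_ge0. Qed.

Lemma edist_le p x r : 0 <= r -> (edist p x <= r) = (sqd p x <= r ^+ 2).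
Proof. by move=> r0; rewrite -edist_sqr ler_pXn2r ?nnegrE ?edist_ge0. Qed.

Lemma sqd_eq0 p x : sqd p x = 0 -> x = p.
Proof.
move=> /eqP; rewrite psumr_eq0; last by move=> i _; exact: sqr_ge0.
move=> /allP h; apply/rowP => i; have := h i (mem_index_enum i).
by rewrite /= sqrf_eq0 subr_eq0 => /eqP.
Qed.

Lemma edist_triangle x p y : edist p y <= edist p x + edist x y.
Proof.
have Z u v : edist u v = 0 -> v = u.
  by move=> h; apply: sqd_eq0; rewrite -edist_sqr h expr0n.
have [/Z ->|xp] := eqVneq (edist p x) 0; first by rewrite edistxx add0r.
have [/Z ->|yx] := eqVneq (edist x y) 0; first by rewrite edistxx addr0.
have x0 : 0 < edist p x by rewrite lt0r xp edist_ge0.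
have y0 : 0 < edist x y by rewrite lt0r yx edist_ge0.
rewrite edist_le; last by rewrite addr_ge0 ?edist_ge0.
apply: le_trans (sqd_triangle p x y (divr_gt0 y0 x0)) _.
rewrite -!edist_sqr le_eqVlt; apply/orP; left; apply/eqP; field.
by rewrite xp yx.
Qed.

Lemma cont_edist p : cont (edist p).
Proof.
apply: continuous_real_comp; first exact: cont_sqd.
by move=> x; exact: sqrt_continuous.
Qed.

Lemma jensen_expR f df p (s : R) : C1 f df -> 0 < s ->
  omega * s ^+ 4 * expR (- (4 * (avg f p s / omega))) <=
  int4 (fun x => expR (- (4 * f x)) * bump 2 p s x).
Proof.
move=> Cf s0; have o0 : 0 < (omega : R) := omega_gt0.
have cf := C1_continuous Cf.
have c4 : cont (fun x => expR (- (4 * f x))).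
  have := cont_expR_aff 4 0 Cf; under eq_fun do rewrite sub0r mulrN.
  exact.
set m := avg f p s / omega; set e := expR (- (4 * m)).
apply: le_trans (_ : int4 (fun x => e * (1 - 4 * (f x - m)) * bump 2 p s x) <= _); last first.
  have c5 : cont (fun x => e * (1 - 4 * (f x - m))) by ctac.
  apply: int4_le; [cctac|cctac|move=> x].
  rewrite ler_wpM2r ?bump_ge0//.
  have -> : expR (- (4 * f x)) = e * expR (- (4 * (f x - m))) by rewrite -expRD; congr expR; ring.
  by rewrite ler_wpM2l ?expR_ge0// expR_ge1Dx.
have Ef : int4 (fun x => f x * bump 2 p s x) = m * (omega * s ^+ 4).
  by rewrite /m /avg; field; rewrite !gt_eqF.
have -> : int4 (fun x => e * (1 - 4 * (f x - m)) * bump 2 p s x) =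
  e * ((1 + 4 * m) * int4 (bump 2 p s) - 4 * int4 (fun x => f x * bump 2 p s x)).
  rewrite -[(1 + 4 * m) * _]int4Z; last by cctac.
  rewrite -[4 * int4 _]int4Z; last by cctac.
  rewrite -int4B; [|cctac|cctac].
  by rewrite -int4Z; [apply: eq_int4 => x; ring|cctac].
by rewrite Ef (int4_bump p s0) le_eqVlt; apply/orP; left; apply/eqP; ring.
Qed.

(* The blow-up argument: exp (- f) d, with d the distance to the boundary, is maximal at
   some x*, the scale T of x* is defined by 2 K0 exp (- 4 f) = 1 / T^2 there, and between the scales T and d^2 the mean of f can
   only grow half as fast as it would for a full bubble, so that d^2 / T is
   bounded by the total mass. *)
Lemma sup_bound : exists2 eps : R, 0 < eps & exists2 th : R -> R,
  (forall M, 0 < th M <= 32^-1) & forall f df ddf x0 r K0 M,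
  C2 f df ddf -> 0 < r -> 0 < K0 ->
  gamma2_on [set x | edist x0 x < 3 / 2 * r] df ddf ->
  (forall x, edist x0 x < 3 / 2 * r -> twice_sigma2 df ddf x <= 2 * K0 * expR (- (4 * f x))) ->
  (forall p t, 0 < t -> (forall x, sqd p x < t -> edist x0 x < 3 / 2 * r) ->
     int4 (fun x => twice_sigma2 df ddf x * bump 4 p t x) <= t ^+ 4 * eps) ->
  (forall p t, 0 < t -> (forall x, sqd p x < t -> edist x0 x < 3 / 2 * r) ->
     K0 * int4 (fun x => expR (- (4 * f x)) * bump 2 p t x) <= t ^+ 2 * M) ->
  forall x, edist x0 x < 5 / 4 * r -> 2 * K0 * expR (- (4 * f x)) <= (th M * r)^-1 ^+ 4.
Proof.
have [L L1 [eps eps0 FD]] := @far_drop R; have o0 : 0 < (omega : R) := omega_gt0.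
have [lam /andP[lam0 lam64] MN] := @mass_near_max R (ln 2).
(* 2^-8 comes from [mass_near_max] and 256 from [lower_harnack]: together they give exp (- f) >= a *
   ps near the maximum. *)
pose a : R := 2^-1 ^+ 8 / 256; have a0 : 0 < a by rewrite divr_gt0 ?ltr0n// exprn_gt0.
have L0 : 0 < L by exact: lt_le_trans L1.
pose b : R := 4 * L * 32 / (omega * lam * a ^+ 4).
have oa0 : 0 < omega * lam * a ^+ 4.
  by apply: mulr_gt0; [apply: mulr_gt0|rewrite exprn_gt0].
have b0 : 0 < b by apply: divr_gt0 => //; apply: mulr_gt0; [apply: mulr_gt0|exact: ltr0n].
pose B (M : R) := 4 * L + b * `|M|.
have B4 (M : R) : 4 <= B M by rewrite /B; have := mulr_ge0 (ltW b0) (normr_ge0 M); lra.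
exists eps => //; exists (fun M => (32 * B M)^-1).
  move=> M; have := B4 M => h; rewrite invr_gt0 lef_pV2 ?posrE; lra.
move=> f df ddf x0 r K0 M Cf r0 K00 G SK HS HM; have [Cf1 Cdf] := Cf.
have cphi : cont (fun x => expR (- f x)).
  have := cont_expR_aff 1 0 Cf1; under eq_fun do rewrite mul1r sub0r.
  exact.
have BM0 : 0 < B M by have := B4 M; lra.
pose rho := 3 / 2 * r; have rho0 : 0 < rho by rewrite /rho; lra.
pose D x := Num.max (rho - edist x0 x) 0.
pose g x := expR (- f x) * D x.
have cg : ccs g.
  apply: ccsM => //; split.
    have cd := cont_edist x0.
    apply: (@continuous_real_comp R (fun y => Num.max y 0) (fun x => rho - edist x0 x)).
      by ctac.
    move=> x; have [c1] : {for rho - edist x0 x, continuous (posp 1)} /\ True.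
      by split => //; exact: posp_continuous.
    by move=> _; rewrite (_ : (fun y => Num.max y 0) = posp 1)//; apply/funext => y; rewrite /posp expr1.
  exists (`|x0| + `|rho ^+ 2| + 1) => x h; rewrite /D max_r// subr_le0 leNgt.
  apply/negP; rewrite edist_lt ?ltW// => /sqd_lt_norm; rewrite leNgt h//.
have [xs Hmax] := ccs_max cg.
have Dle x : edist x0 x <= rho -> D x = rho - edist x0 x.
  by move=> h; rewrite /D max_l// subr_ge0.
have gx0 : 0 < g x0.
  by rewrite /g Dle edistxx ?ltW// subr0 mulr_gt0// expR_gt0.
have gxs : 0 < g xs by have h := Hmax x0 gx0; exact: lt_le_trans h.
have Dxs : 0 < D xs by move: gxs; rewrite /g pmulr_rgt0 ?expR_gt0.
have xs_in : edist x0 xs < rho.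
  rewrite ltNge; apply/negP => h; move: Dxs; rewrite /D max_r ?ltxx// subr_le0//.
set d := D xs in Dxs; have dE : d = rho - edist x0 xs by rewrite /d Dle// ltW.
have Hg x : edist x0 x < rho -> expR (- f x) * (rho - edist x0 x) <= expR (- f xs) * d.
  move=> h; have := Hmax x; rewrite /g -/d [D x]Dle; last exact: ltW.
  by apply; rewrite mulr_gt0 ?expR_gt0// subr_gt0.
clearbody d.
have ball_in x : edist xs x < d -> edist x0 x < rho.
  by move=> h; apply: le_lt_trans (edist_triangle xs x0 x) _; rewrite dE in h; lra.
have half x : sqd xs x < (d / 2) ^+ 2 -> edist xs x < d / 2.
  by move=> h; rewrite edist_lt// divr_ge0// ltW.
have in_half x : sqd xs x < (d / 2) ^+ 2 -> edist x0 x < rho.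
  by move=> /half h; apply: ball_in; lra.
have phi2 x : sqd xs x < (d / 2) ^+ 2 -> expR (- f x) <= 2 * expR (- f xs).
  move=> /[dup] /in_half hin /half h; have := Hg x hin.
  have := edist_triangle xs x0 x => tr.
  have : expR (- f x) * (d / 2) <= expR (- f x) * (rho - edist x0 x).
    by rewrite ler_pM2l ?expR_gt0// dE; rewrite dE in h; lra.
  move=> h1 h2; have h3 := le_trans h1 h2.
  rewrite -(ler_pM2r Dxs); lra.
set ps := expR (- f xs); have ps0 : 0 < ps by exact: expR_gt0.
(* On the half ball exp (- f) is at most 2 * ps, so S is at most 2 K0 (2 ps)^4 = 32 K0 ps^4 = T^-2
   there. *)
pose T := (Num.sqrt (32 * K0) * ps ^+ 2)^-1.
have sq0 : 0 < Num.sqrt (32 * K0) by rewrite sqrtr_gt0 mulr_gt0.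
have T0 : 0 < T by rewrite invr_gt0 mulr_gt0// exprn_gt0.
have T2 : T^-1 ^+ 2 = 32 * K0 * ps ^+ 4.
  by rewrite /T invrK exprMn sqr_sqrtr ?mulr_ge0 ?(ltW K00)// -exprM.
have exp4 x : expR (- (4 * f x)) = expR (- f x) ^+ 4.
  by rewrite -expRM_natl; congr expR; ring.
have key : d ^+ 2 <= B M * T.
  have [dT|Td] := ltP ((d / 2) ^+ 2) T.
    by have := B4 M => /(ler_wpM2r (ltW T0)); move: dT; rewrite expr_div_n; lra.
  have inT x : sqd xs x < T -> sqd xs x < (d / 2) ^+ 2 by move=> h; exact: lt_le_trans Td.
  have GT : gamma2_on [set x | sqd xs x < T] df ddf.
    by move=> x /= /inT /in_half h; exact: G.
  have fA x : sqd xs x < T -> f xs - ln 2 <= f x.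
    move=> /inT /phi2; rewrite -[X in _ <= X * _](@lnK R 2) ?posrE// -expRD ler_expR; lra.
  have ST x : sqd xs x < T -> twice_sigma2 df ddf x <= T^-1 ^+ 2.
    move=> /inT h; apply: le_trans (SK x (in_half x h)) _; rewrite T2 exp4.
    have h4 : expR (- f x) ^+ 4 <= (2 * ps) ^+ 4.
      by rewrite ler_pXn2r ?nnegrE ?expR_ge0 ?phi2// mulr_ge0// ltW.
    have k2 : 0 <= 2 * K0 by rewrite mulr_ge0// ltW.
    have := ler_wpM2l k2 h4; rewrite exprMn; lra.
  have := MN f df ddf xs T Cf T0 GT fA ST; rewrite -/ps => NN.
  set s0 := lam * T in NN; have s00 : 0 < s0 by rewrite mulr_gt0.
  have s0T : s0 <= 64^-1 * T by rewrite ler_pM2r.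
  have low x : sqd xs x <= s0 -> f x <= f xs - ln a.
    move=> xh.
    have N9 y : sqd xs y < 9 * s0 -> dotp df df y <= lap ddf y.
      by move=> yh; have [] := GT y; rewrite /=; lra.
    have LH := lower_harnack Cf s00 N9 xh.
    have s4 : 0 < s0^-1 ^+ 4 by rewrite exprn_gt0// invr_gt0.
    have := ler_wpM2l (ltW s4) LH; rewrite -/(avg (fun x => expR (- f x)) xs s0).
    have -> : s0^-1 ^+ 4 * (256 * omega * s0 ^+ 4 * expR (- f x)) = omega * (256 * expR (- f x)).
      by field; rewrite gt_eqF.
    move=> h; have := le_trans NN h; rewrite ler_pM2l// => h2.
    have : a * ps <= expR (- f x) by rewrite /a; lra.
    rewrite -[X in X * ps](@lnK R a) ?posrE// -expRD ler_expR; lra.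
  have cf := C1_continuous Cf1.
  have A0 : avg f xs s0 <= omega * (f xs - ln a).
    by apply: avg_bound => // x /ltW; exact: low.
  (* The largest scale for which the ball of squared radius L * s1, needed in [far_drop], is within
     the half ball about xs. *)
  pose s1 := d ^+ 2 / (4 * L).
  have Ls1 : L * s1 = (d / 2) ^+ 2 by rewrite /s1; field; rewrite gt_eqF.
  have s10 : 0 < s1 by rewrite divr_gt0 ?exprn_gt0// mulr_gt0.
  have dE2 : d ^+ 2 = 4 * L * s1 by rewrite /s1 mulrCA divff ?mulr1// gt_eqF// mulr_gt0.
  have L4 : 0 < 4 * L by rewrite mulr_gt0.
  have bM : 0 <= b * `|M| by rewrite mulr_ge0// ltW.
  have [s1s0|s0s1] := leP s1 s0.
    have := ler_wpM2l (ltW L4) s1s0; have := ler_wpM2l (ltW L4) s0T; rewrite -dE2 => k1 k2.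
    have := mulr_ge0 bM (ltW T0); have := mulr_gt0 L4 T0; rewrite /B; lra.
  have GL : gamma2_on [set x | sqd xs x < L * s1] df ddf.
    by move=> x /=; rewrite Ls1 => /in_half h; exact: G.
  have HSL t : 0 < t -> t <= L * s1 ->
      int4 (fun x => twice_sigma2 df ddf x * bump 4 xs t x) <= t ^+ 4 * eps.
    move=> t0 tL; apply: HS => // x xt; apply: in_half; rewrite -Ls1; exact: lt_le_trans tL.
  have AV := FD f df ddf xs s0 s1 Cf s00 s0s1 GL HSL.
  have s1L : s1 <= (d / 2) ^+ 2 by rewrite -Ls1 ler_peMl// ltW.
  have HM1 := HM xs s1 s10 (fun x h => in_half x (lt_le_trans h s1L)).
  have JJ := jensen_expR xs Cf1 s10.
  have e1 : ps ^+ 4 * a ^+ 4 * (s0 / s1) <= expR (- (4 * (avg f xs s1 / omega))).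
    have -> : ps ^+ 4 * a ^+ 4 * (s0 / s1) =
        expR (- (4 * (f xs - ln a) + (ln s1 - ln s0))).
      have -> : - (4 * (f xs - ln a) + (ln s1 - ln s0)) =
        4%:R * (- f xs) + 4%:R * ln a + (ln s0 - ln s1) by ring.
      by rewrite !expRD !expRM_natl (expRN (ln s1)) !lnK ?posrE.
    rewrite ler_expR lerN2.
    have -> : 4 * (f xs - ln a) + (ln s1 - ln s0) =
      4 * ((omega * (f xs - ln a) + 4^-1 * omega * (ln s1 - ln s0)) / omega).
      by field; rewrite gt_eqF.
    rewrite ler_pM2l// ler_pM2r ?invr_gt0//; lra.
  have e2 : K0 * (omega * s1 ^+ 4 * (ps ^+ 4 * a ^+ 4 * (s0 / s1))) <= s1 ^+ 2 * M.
    apply: le_trans HM1; rewrite ler_pM2l//; apply: le_trans JJ.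
    by rewrite ler_pM2l// mulr_gt0// exprn_gt0.
  (* Up to constants the volume is at least s1^2 ps^4 (s0 / s1), and K0 ps^4 = T^-2 / 32; the bound
     by M leaves s1 / T bounded by a multiple of M. *)
  have e3 : omega * lam * a ^+ 4 * s1 <= 32 * T * M.
    have : s1 ^+ 2 * (32 * K0 * ps ^+ 4 * (omega * lam * a ^+ 4) * T * s1) <= s1 ^+ 2 * (32 * M).
      have -> : s1 ^+ 2 * (32 * K0 * ps ^+ 4 * (omega * lam * a ^+ 4) * T * s1) =
        32 * (K0 * (omega * s1 ^+ 4 * (ps ^+ 4 * a ^+ 4 * (s0 / s1)))).
        by rewrite /s0; field; rewrite gt_eqF.
      by move: e2; set X := K0 * _; clearbody X; lra.
    rewrite ler_pM2l ?exprn_gt0// -T2 => h.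
    have := ler_wpM2l (ltW T0) h.
    have -> : T * (T^-1 ^+ 2 * (omega * lam * a ^+ 4) * T * s1) = omega * lam * a ^+ 4 * s1.
      by field; rewrite gt_eqF.
    by rewrite (_ : T * (32 * M) = 32 * T * M)//; ring.
  have e4 : d ^+ 2 <= b * M * T.
    rewrite dE2 /b.
    have -> : 4 * L * 32 / (omega * lam * a ^+ 4) * M * T =
      4 * L * (32 * T * M / (omega * lam * a ^+ 4)).
      by field; rewrite !gt_eqF.
    by rewrite ler_pM2l// ler_pdivlMr// mulrC.
  apply: le_trans e4 _; rewrite ler_pM2r// /B.
  by have := ler_wpM2l (ltW b0) (ler_norm M); lra.
move=> x xr; have xin : edist x0 x < rho by rewrite /rho; lra.
(* Points at distance less than 5 r / 4 from x0 are at distance at least r / 4 from the sphere of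
   radius rho = 3 r / 2. *)
have h1 : expR (- f x) * (r / 4) <= ps * d.
  apply: le_trans (Hg x xin); rewrite ler_pM2l ?expR_gt0// /rho; lra.
have r4 : 0 < r ^+ 4 by rewrite exprn_gt0.
have d4 : d ^+ 4 <= (B M) ^+ 2 * T ^+ 2.
  rewrite -exprMn (_ : d ^+ 4 = (d ^+ 2) ^+ 2); last by rewrite -exprM.
  by rewrite ler_pXn2r ?nnegrE ?sqr_ge0// mulr_ge0// ltW.
have h4 : (expR (- f x) * (r / 4)) ^+ 4 <= (ps * d) ^+ 4.
  have n1 : 0 <= expR (- f x) * (r / 4).
    by apply: mulr_ge0; [exact: expR_ge0|rewrite divr_ge0// ltW].
  have n2 : 0 <= ps * d by rewrite mulr_ge0// ltW.
  by rewrite ler_pXn2r ?nnegrE.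
have p4 : 0 < ps ^+ 4 by rewrite exprn_gt0.
have h5 : 32 * K0 * (ps * d) ^+ 4 <= (B M) ^+ 2.
  have c : 0 <= 32 * K0 * ps ^+ 4 by rewrite -T2 sqr_ge0.
  have := ler_wpM2l c d4; rewrite exprMn -T2.
  have -> : T^-1 ^+ 2 * (B M ^+ 2 * T ^+ 2) = B M ^+ 2 by field; rewrite gt_eqF.
  rewrite T2; lra.
have h6 : 2 * K0 * expR (- f x) ^+ 4 * r ^+ 4 <= 16 * (B M) ^+ 2.
  have c : 0 <= 32 * K0 by rewrite mulr_ge0// ltW.
  have := ler_wpM2l c h4; rewrite exprMn expr_div_n => h7.
  have : 32 * K0 * (expR (- f x) ^+ 4 * (r ^+ 4 / 4 ^+ 4)) <= B M ^+ 2 by exact: le_trans h5.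
  lra.
rewrite exp4 invfM invrK exprMn exprVn ler_pdivlMr//.
apply: le_trans h6 _.
have B1 : 1 <= B M by have := B4 M; lra.
have B24 : B M ^+ 2 <= B M ^+ 4 by rewrite ler_weXn2l.
have B2 : 0 <= B M ^+ 2 by rewrite sqr_ge0.
rewrite exprMn; apply: le_trans (_ : 16 * B M ^+ 4 <= _); first by rewrite ler_pM2l.
apply: ler_wpM2r; first exact: le_trans B24.
rewrite (_ : 32 = 2 * 16 :> R); last by rewrite -natrM.
rewrite exprMn; have : (16 : R) <= 2 ^+ 4 by rewrite -natrX ler_nat.
have : (1 : R) <= 16 ^+ 4 by rewrite exprn_ege1// ler1n.
set y := 16 ^+ 4; set z := 2 ^+ 4 => hy hz.
by apply: le_trans hz _; rewrite ler_peMr// exprn_ge0.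
Qed.

End sup_bound.

(** * Harnack inequality by chains of balls *)

Section harnack.
Context {R : realType}.
Local Notation V := 'rV[R]_4.
Implicit Types (f g : V -> R) (df : 'I_4 -> V -> R) (ddf : 'I_4 -> 'I_4 -> V -> R) (p : V).

(* The mass concentrates near the maximum of exp (- f) (dl - |x - p|)^8, and
   superharmonicity of exp (- f) spreads it over the ball. *)
Lemma local_harnack : exists2 a : R, 0 < a & forall f df ddf p dl x',
  C2 f df ddf -> 0 < dl ->
  gamma2_on [set x | edist p x < 6 * dl] df ddf ->
  (forall x, edist p x < dl -> twice_sigma2 df ddf x <= dl^-1 ^+ 4) ->
  edist p x' <= dl -> a * expR (- f p) <= expR (- f x').
Proof.
have o0 : 0 < (omega : R) := omega_gt0.
pose e8 : R := 2 ^+ 8; have e80 : 0 < e8 by rewrite exprn_gt0.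
have [lam /andP[lam0 lam64] MN] := @mass_near_max R (ln e8).
pose a : R := lam ^+ 4 * (e8^-1 / 4 ^+ 4) / (256 * 4 ^+ 4).
have a0 : 0 < a.
  have n4 : 0 < 4 ^+ 4 :> R by exact: exprn_gt0.
  apply: divr_gt0; last by apply: mulr_gt0; [exact: ltr0n|].
  by apply: mulr_gt0; [exact: exprn_gt0|apply: divr_gt0; rewrite ?invr_gt0].
exists a => //.
move=> f df ddf p dl x' Cf dl0 G SS px'; have [Cf1 Cdf] := Cf.
have cphi : cont (fun x => expR (- f x)).
  have := cont_expR_aff 1 0 Cf1; under eq_fun do rewrite mul1r sub0r.
  exact.
pose D x := Num.max (dl - edist p x) 0.
(* The exponent 8 matches the mass: with s0 of order d^2, the integral of exp (- f) against
   [bump 2 xs s0] is at least of order s0^4 exp (- f xs), that is, of order the maximum d^8 exp (- f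
   xs) of g, which is at least dl^8 exp (- f p). *)
pose g x := expR (- f x) * posp 8 (dl - edist p x).
have cg : ccs g.
  apply: ccsM => //; split.
    have cd := cont_edist p.
    apply: (@continuous_real_comp R (posp 8) (fun x => dl - edist p x)); first by ctac.
    by move=> x; exact: posp_continuous.
  exists (`|p| + `|dl ^+ 2| + 1) => x h; rewrite posp_le0// subr_le0 leNgt.
  apply/negP; rewrite edist_lt ?ltW// => /sqd_lt_norm; rewrite leNgt h//.
have [xs Hmax] := ccs_max cg.
have gE x : edist p x < dl -> g x = expR (- f x) * (dl - edist p x) ^+ 8.
  by move=> h; rewrite /g posp_gt0// subr_gt0.
have gp : 0 < g p by rewrite gE edistxx// subr0 mulr_gt0 ?expR_gt0// exprn_gt0.
have gxs : 0 < g xs by have h := Hmax p gp; exact: lt_le_trans h.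
have xs_in : edist p xs < dl.
  rewrite ltNge; apply/negP => h; move: gxs; rewrite /g posp_le0 ?subr_le0//.
  by rewrite mulr0 ltxx.
pose d := dl - edist p xs; have dE : d = dl - edist p xs by [].
have d0 : 0 < d by rewrite subr_gt0.
have ddl : d <= dl by have := edist_ge0 p xs; rewrite dE; lra.
have Hg x : edist p x < dl -> expR (- f x) * (dl - edist p x) ^+ 8 <= expR (- f xs) * d ^+ 8.
  move=> h; have := Hmax x; rewrite !gE//; apply.
  by rewrite mulr_gt0 ?expR_gt0// exprn_gt0// subr_gt0.
clearbody d; clear D.
pose T := (d / 2) ^+ 2; have T0 : 0 < T by rewrite exprn_gt0// divr_gt0.
have d20 : 0 <= d / 2 by rewrite divr_ge0// ltW.
have half x : sqd xs x < T -> edist xs x < d / 2 by move=> h; rewrite edist_lt.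
have dist x : sqd xs x < T -> edist p x < dl - d / 2.
  by move=> /half h; have := edist_triangle xs p x; lra.
have ball_in x : sqd xs x < T -> edist p x < dl by move=> /dist; lra.
have GT : gamma2_on [set x | sqd xs x < T] df ddf.
  by move=> x /= /ball_in h; apply: G => /=; lra.
set ps := expR (- f xs); have ps0 : 0 < ps by exact: expR_gt0.
(* Within d / 2 of xs the distance to the boundary at least keeps half its value, so maximality of g
   costs a factor 2^8. *)
have fA x : sqd xs x < T -> f xs - ln e8 <= f x.
  move=> xT; have h1 := dist x xT; have := Hg x (ball_in x xT) => h2.
  have h3 : (d / 2) ^+ 8 <= (dl - edist p x) ^+ 8.
    by rewrite ler_pXn2r ?nnegrE//; lra.
  have h4 : expR (- f x) * (d / 2) ^+ 8 <= ps * d ^+ 8.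
    by apply: le_trans h2; rewrite ler_pM2l ?expR_gt0.
  have h5 : expR (- f x) <= e8 * ps.
    rewrite -(ler_pM2r (_ : 0 < (d / 2) ^+ 8)); last by rewrite exprn_gt0// divr_gt0.
    apply: le_trans h4 _; rewrite /e8 expr_div_n le_eqVlt; apply/orP; left; apply/eqP.
    by field.
  by move: h5; rewrite -[X in _ <= X * _ -> _](@lnK R e8) ?posrE// -expRD ler_expR; lra.
have ST x : sqd xs x < T -> twice_sigma2 df ddf x <= T^-1 ^+ 2.
  move=> xT; apply: le_trans (SS x (ball_in x xT)) _.
  rewrite /T -exprVn -exprM ler_pXn2r ?nnegrE ?invr_ge0 ?(ltW dl0)//.
  by rewrite lef_pV2 ?posrE ?divr_gt0//; lra.
have := MN f df ddf xs T Cf T0 GT fA ST; rewrite -/ps => NN.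
set s0 := lam * T in NN; have s00 : 0 < s0 by rewrite mulr_gt0.
have Tdl : T <= dl ^+ 2 by rewrite /T ler_pXn2r ?nnegrE ?(ltW dl0)//; lra.
have s0T : s0 <= dl ^+ 2.
  apply: le_trans Tdl; rewrite /s0 ler_piMl ?(ltW T0)//.
  by apply: le_trans lam64 _; rewrite invf_le1// ler1n.
pose s := 4 * dl ^+ 2; have dl2 : 0 < dl ^+ 2 by rewrite exprn_gt0.
have s_0 : 0 < s by rewrite mulr_gt0.
have N9 y : sqd p y < 9 * s -> dotp df df y <= lap ddf y.
  move=> h; have [] := G y => //=; rewrite edist_lt ?mulr_ge0 ?(ltW dl0)//.
  by rewrite exprMn; move: h; rewrite /s; lra.
have xs' : sqd p x' <= s.
  by move: px'; rewrite edist_le ?(ltW dl0)// /s; lra.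
have LH := lower_harnack Cf s_0 N9 xs'.
have bb : int4 (fun y => expR (- f y) * bump 2 xs s0 y) <=
    int4 (fun y => expR (- f y) * bump 2 p s y).
  apply: int4_le; [cctac|cctac|move=> y].
  rewrite ler_pM2l ?expR_gt0//.
  have [yh|yh] := ltP (sqd xs y) s0; last by rewrite bump_out// bump_ge0.
  have := sqd_triangle p xs y ltr01; rewrite invr1 => tr.
  have xsd : sqd p xs < dl ^+ 2 by rewrite -edist_lt// ltW.
  have h1 : s0 - sqd xs y <= s - sqd p y by rewrite /s; lra.
  have h2 : 0 < s0 - sqd xs y by rewrite subr_gt0.
  have h3 : sqd p y < s by lra.
  by rewrite !bump_in// ler_pXn2r ?nnegrE//; lra.
have h4 := le_trans bb LH.
have s4 : 0 < s0 ^+ 4 by rewrite exprn_gt0.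
have NN2 : s0 ^+ 4 * (omega * (2^-1 ^+ 8 * ps)) <= 256 * omega * s ^+ 4 * expR (- f x').
  apply: le_trans h4.
  have := ler_wpM2l (ltW s4) NN; rewrite /avg [X in _ <= X -> _]mulrA -[s0 ^+ 4 * s0^-1 ^+ 4]exprMn divff ?expr1n ?mul1r ?gt_eqF//.
have e8V : 2^-1 ^+ 8 = e8^-1 :> R by rewrite exprVn.
have ps8 : expR (- f p) * dl ^+ 8 <= ps * d ^+ 8.
  by have := Hg p; rewrite edistxx subr0; apply.
have dl8 : 0 < dl ^+ 8 by rewrite exprn_gt0.
have : dl ^+ 8 * (a * expR (- f p)) <= dl ^+ 8 * expR (- f x').
  have h5 := ler_wpM2l (ltW a0) ps8.
  apply: le_trans (_ : a * (ps * d ^+ 8) <= _); first by lra.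
  move: NN2; rewrite e8V.
  have -> : s0 ^+ 4 * (omega * (e8^-1 * ps)) =
     (256 * 4 ^+ 4 * omega) * (a * (ps * d ^+ 8)).
    rewrite /s0 /T /a; move: (256 : R) (ltr0n R 256) => c c1; field.
    by rewrite !gt_eqF.
  have -> : 256 * omega * s ^+ 4 * expR (- f x') = (256 * 4 ^+ 4 * omega) * (dl ^+ 8 * expR (- f x')).
    rewrite /s; ring.
  have k0 : 0 < 256 * 4 ^+ 4 * (omega : R).
    by apply: mulr_gt0 o0; apply: mulr_gt0; [exact: ltr0n|rewrite exprn_gt0].
  by rewrite ler_pM2l.
by rewrite ler_pM2l.
Qed.

Lemma sqd_convex p x y (l : R) : 0 <= l <= 1 ->
  sqd p (x + l *: (y - x)) <= (1 - l) * sqd p x + l * sqd p y.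
Proof.
move=> /andP[l0 l1]; rewrite /sqd !mulr_sumr -big_split; apply: ler_sum => i _ /=.
rewrite !mxE; set u := x 0 i; set v := y 0 i; set w := p 0 i.
have -> : (1 - l) * (u - w) ^+ 2 + l * (v - w) ^+ 2 =
  (u + l * (v - u) - w) ^+ 2 + l * (1 - l) * (u - v) ^+ 2 by ring.
by rewrite lerDl mulr_ge0 ?sqr_ge0// mulr_ge0// subr_ge0.
Qed.

Lemma sqd_segment x y (l m : R) :
  sqd (x + l *: (y - x)) (x + m *: (y - x)) = (m - l) ^+ 2 * sqd x y.
Proof. by rewrite /sqd mulr_sumr; apply: eq_bigr => i _; rewrite !mxE; ring. Qed.

(** The segment from x to y is cut into n >= 2 / th steps of length at most th * r, and
    [local_harnack] is applied to each. The balls of radius 6 th r it needs stay inside radius 5 r /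
    4 because th <= 1/32. *)
Lemma harnack (th : R) : 0 < th <= 32^-1 -> exists2 C : R, 0 < C &
  forall f df ddf x0 r x y, C2 f df ddf -> 0 < r ->
  gamma2_on [set x | edist x0 x < 5 / 4 * r] df ddf ->
  (forall x, edist x0 x < 5 / 4 * r -> twice_sigma2 df ddf x <= (th * r)^-1 ^+ 4) ->
  edist x0 x < r -> edist x0 y < r -> expR (- f x) <= C * expR (- f y).
Proof.
move=> /andP[th0 th32]; have [a a0 LH] := local_harnack.
pose n := (Num.trunc (2 / th)).+1.
have n0 : 0 < n%:R :> R by rewrite ltr0n.
have nth : 2 / th <= n%:R.
  by apply/ltW; have /andP[] := trunc_itv (ltW (divr_gt0 (ltr0n R 2) th0)).
clearbody n.
exists (a ^+ n)^-1; first by rewrite invr_gt0 exprn_gt0.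
move=> f df ddf x0 r x y Cf r0 G SS xr yr.
pose z (i : nat) := x + (i%:R / n%:R) *: (y - x).
have r0' := ltW r0.
have zr i : (i <= n)%N -> edist x0 (z i) < r.
  move=> iN; have l01 : 0 <= (i%:R / n%:R : R) <= 1.
    by apply/andP; split; [apply: divr_ge0|rewrite ler_pdivrMr// mul1r ler_nat].
  rewrite edist_lt//; apply: le_lt_trans (sqd_convex x0 x y l01) _.
  move: xr yr; rewrite !edist_lt//; case/andP: l01; set l := _ / _ => l0 l1 h1 h2.
  set A := sqd x0 x in h1 *; set B := sqd x0 y in h2 *.
  have [AB|BA] := leP A B.
    by have := mulr_ge0 (_ : 0 <= 1 - l) (_ : 0 <= B - A); rewrite !subr_ge0 => /(_ l1 AB); lra.
  by have := mulr_ge0 l0 (_ : 0 <= A - B); rewrite subr_ge0 => /(_ (ltW BA)); lra.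
have dl0 : 0 < th * r by rewrite mulr_gt0.
have step i : (i < n)%N -> a * expR (- f (z i)) <= expR (- f (z i.+1)).
  move=> iN; have zi := zr i (ltnW iN).
  have in54 w : edist (z i) w < r / 4 -> edist x0 w < 5 / 4 * r.
    by move=> h; apply: le_lt_trans (edist_triangle (z i) x0 w) _; lra.
  have thr : th * r <= 32^-1 * r by rewrite ler_pM2r.
  apply: (LH f df ddf (z i) (th * r)) => //.
  - by move=> w /= h; apply: G => /=; apply: in54; lra.
  - by move=> w h; apply: SS; apply: in54; lra.
  rewrite edist_le ?(ltW dl0)// /z sqd_segment.
  have -> : i.+1%:R / n%:R - i%:R / n%:R = n%:R^-1 :> R.
    by rewrite -mulrBl -natrB// subSnn mul1r.
  have xy : sqd x y <= (2 * r) ^+ 2.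
    have := edist_triangle x0 x y; rewrite (edistC x x0) => h.
    by rewrite -edist_le ?mulr_ge0//; lra.
  have : n%:R^-1 ^+ 2 * sqd x y <= (2 / n%:R * r) ^+ 2.
    have c0 : 0 <= n%:R^-1 ^+ 2 :> R by rewrite sqr_ge0.
    have := ler_wpM2l c0 xy; lra.
  move=> h; apply: le_trans h _; rewrite ler_pXn2r ?nnegrE ?(ltW dl0)//.
    by rewrite ler_pM2r// ler_pdivrMr// mulrC -ler_pdivrMr.
  by rewrite mulr_ge0// divr_ge0.
have chain i : (i <= n)%N -> a ^+ i * expR (- f x) <= expR (- f (z i)).
  elim: i => [_|i IH iN]; first by rewrite /z expr0 mul1r mul0r scale0r addr0.
  apply: le_trans (step i iN); rewrite exprS -mulrA ler_pM2l//.
  by apply: IH; exact: ltnW.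
have := chain n (leqnn n); rewrite /z divff ?gt_eqF// scale1r addrC subrK.
by rewrite -ler_pdivlMl ?exprn_gt0// mulrC => h; rewrite mulrC.
Qed.

End harnack.

(** * The Schouten tensor of a conformally flat metric *)

Section elementary_symmetric.
Context {R : realType}.
Implicit Types (L : 'M[R]_4) (l : 'rV[R]_4).

Definition entry L (a b : nat) : R := L (inord a) (inord b).

Lemma det4E L (m := entry L) : \det L =
  m 0%N 0%N * (m 1%N 1%N * (m 2%N 2%N * m 3%N 3%N - m 2%N 3%N * m 3%N 2%N)
             - m 1%N 2%N * (m 2%N 1%N * m 3%N 3%N - m 2%N 3%N * m 3%N 1%N)
             + m 1%N 3%N * (m 2%N 1%N * m 3%N 2%N - m 2%N 2%N * m 3%N 1%N))
  - m 0%N 1%N * (m 1%N 0%N * (m 2%N 2%N * m 3%N 3%N - m 2%N 3%N * m 3%N 2%N)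
             - m 1%N 2%N * (m 2%N 0%N * m 3%N 3%N - m 2%N 3%N * m 3%N 0%N)
             + m 1%N 3%N * (m 2%N 0%N * m 3%N 2%N - m 2%N 2%N * m 3%N 0%N))
  + m 0%N 2%N * (m 1%N 0%N * (m 2%N 1%N * m 3%N 3%N - m 2%N 3%N * m 3%N 1%N)
             - m 1%N 1%N * (m 2%N 0%N * m 3%N 3%N - m 2%N 3%N * m 3%N 0%N)
             + m 1%N 3%N * (m 2%N 0%N * m 3%N 1%N - m 2%N 1%N * m 3%N 0%N))
  - m 0%N 3%N * (m 1%N 0%N * (m 2%N 1%N * m 3%N 2%N - m 2%N 2%N * m 3%N 1%N)
             - m 1%N 1%N * (m 2%N 0%N * m 3%N 2%N - m 2%N 2%N * m 3%N 0%N)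
             + m 1%N 2%N * (m 2%N 0%N * m 3%N 1%N - m 2%N 1%N * m 3%N 0%N)).
Proof.
have E i j : L i j = m i j by rewrite /m /entry !inord_val.
have det1 (M : 'M[R]_1) : \det M = M 0 0 by exact: det_mx11.
rewrite (expand_det_row _ ord0) !big_ord_recl big_ord0 /cofactor.
rewrite !(expand_det_row _ ord0) !big_ord_recl !big_ord0 /cofactor.
rewrite !(expand_det_row _ ord0) !big_ord_recl !big_ord0 /cofactor !det1.
rewrite !mxE !E /=.
rewrite /bump /=.
clear E; move: m => m; rewrite !exprS !expr0; ring.
Qed.

Lemma horner_char_poly L (s : R) : (char_poly L).[s] = \det (s%:M - L).
Proof.
rewrite /char_poly -horner_evalE -det_map_mx; congr (\det _).
apply/matrixP => i j; rewrite !mxE /= horner_evalE hornerD hornerN hornerC.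
by rewrite hornerMn hornerX.
Qed.

Definition elem (k : nat) l : R := \sum_(I : {set 'I_4} | #|I| == k) \prod_(i in I) l 0 i.

(** The generating function: the product is expanded over subsets, which are then grouped by
    cardinality. *)
Lemma prod_elem l (t : R) : \prod_i (1 + t * l 0 i) =
  \sum_(k < 5) t ^+ k * elem k l.
Proof.
under eq_bigr do rewrite addrC.
rewrite bigA_distr (partition_big (fun J : {set 'I_4} => inord #|J| : 'I_5) predT)//=.
apply: eq_bigr => k _; rewrite /elem mulr_sumr.
apply: eq_big => J.
  rewrite -val_eqE /= inordK// ltnS.
  by rewrite -[X in (_ <= X)%N](card_ord 4) max_card.
move=> /eqP /(congr1 val) /=; rewrite inordK; last first.
  by rewrite ltnS -[X in (_ <= X)%N](card_ord 4) max_card.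
move=> <-; rewrite -big_mkcond/= big_split/= prodr_const//.
Qed.

Lemma prod_det L l (t : R) : char_poly L = \prod_i ('X - (l 0 i)%:P) -> t != 0 ->
  \prod_i (1 + t * l 0 i) = \det (1%:M + t *: L).
Proof.
move=> cl t0; have -> : 1%:M + t *: L = (- t) *: ((- t^-1)%:M - L).
  apply/matrixP => i j; rewrite !mxE; case: (i == j); rewrite ?mulr1n ?mulr0n; by field.
rewrite detZ -horner_char_poly cl horner_prod.
have -> : (- t) ^+ 4 = \prod_(i < 4) (- t) by rewrite prodr_const card_ord.
rewrite -big_split /=.
by apply: eq_bigr => i _; rewrite !hornerE; field.
Qed.

Lemma elem0 l : elem 0 l = 1.
Proof.
rewrite /elem (big_pred1 (finset.set0 : {set 'I_4})) ?big_set0// => I; exact: cards_eq0.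
Qed.

(* The coefficients of det (1 + t L) are read off from its values at 1, -1, 2 and -2. *)
Lemma elem12 L l : char_poly L = \prod_i ('X - (l 0 i)%:P) ->
  elem 1 l = \sum_i L i i /\
  2 * elem 2 l = (\sum_i L i i) ^+ 2 - \sum_i \sum_j L i j * L j i.
Proof.
move=> cl.
have e t : t != 0 -> 1 + t * elem 1 l + t ^+ 2 * elem 2 l + t ^+ 3 * elem 3 l
    + t ^+ 4 * elem 4 l = \det (1%:M + t *: L).
  move=> t0; rewrite -(prod_det cl t0) prod_elem !big_ord_recl big_ord0 /=.
  by rewrite elem0 !mul1r !addrA addr0 expr1.
have n1 : (1 : R) != 0 by rewrite oner_neq0.
have n2 : (2 : R) != 0 by rewrite pnatr_eq0.
have m1 : (-1 : R) != 0 by rewrite oppr_eq0.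
have m2 : (-2 : R) != 0 by rewrite oppr_eq0.
have := e _ n1; have := e _ n2; have := e _ m1; have := e _ m2.
have D a b (t : R) : (a < 4)%N -> (b < 4)%N ->
    entry (1%:M + t *: L) a b = (a == b)%:R + t * entry L a b.
  by move=> a4 b4; rewrite /entry !mxE -val_eqE /= !inordK.
rewrite !det4E !D//= !sum4 -!/(entry L _ _).
move: (entry L) => m; move: (elem 1 l) (elem 2 l) (elem 3 l) (elem 4 l) => e1 e2 e3 e4.
move=> h1 h2 h3 h4; split; lra.
Qed.

(* The eigenvalues of a matrix that does not split are 0 by convention, which
   positivity of sigma_1 excludes. *)
Lemma char_poly_eigenvalues L : 0 < sigma 1 L ->
  char_poly L = \prod_i ('X - (eigenvalues L 0 i)%:P).
Proof.
move=> s1; rewrite /eigenvalues; apply: (@xgetPex _ 0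
  [set l : 'rV[R]_4 | char_poly L = \prod_i ('X - (l 0 i)%:P)]).
apply: contrapT => no; move: s1; rewrite /sigma /eigenvalues.
rewrite xgetPN; last by move=> l hl; apply: no; exists l.
rewrite big1 ?ltxx// => I /eqP/eqP/cards1P [i ->].
by rewrite big_set1 mxE.
Qed.

Lemma sigma12 L : 0 < sigma 1 L -> sigma 1 L = \sum_i L i i /\
  2 * sigma 2 L = (\sum_i L i i) ^+ 2 - \sum_i \sum_j L i j * L j i.
Proof. by move=> /char_poly_eigenvalues /elem12. Qed.

End elementary_symmetric.

(** * Pointwise algebra of the Ricci, Schouten and Newton tensors *)

Section schouten_algebra.
Context {R : realType}.
Implicit Types (a : 'I_4 -> R) (h A : 'I_4 -> 'I_4 -> R).

Lemma sum_delta (F : 'I_4 -> R) j : \sum_k F k * (j == k)%:R = F j.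
Proof.
rewrite (bigD1 j)//= eqxx mulr1 big1 ?addr0// => k kj.
by rewrite eq_sym (negbTE kj) mulr0.
Qed.

(** With B = dw and h = D^2 w, G is the Christoffel symbol of e^(2w) g_0 and dG its derivative. The
    sums contract Kronecker deltas in dimension 4; the coefficients 2 are n - 2. *)
Lemma ricci_algebra (B : 'I_4 -> R) (h : 'I_4 -> 'I_4 -> R) (i j : 'I_4) :
  (forall k l, h k l = h l k) ->
  let G k i j : R := B i * (j == k)%:R + B j * (i == k)%:R - B k * (i == j)%:R in
  let dG m k i j : R := h i m * (j == k)%:R + h j m * (i == k)%:R - h k m * (i == j)%:R in
  \sum_k (dG k k i j - dG j k i k) + \sum_k \sum_l (G k k l * G l i j - G k j l * G l i k) =
  - 2 * (h i j - B i * B j) - (\sum_k h k k + 2 * \sum_k B k ^+ 2) * (i == j)%:R.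
Proof.
move=> hs G dG; set d := (i == j)%:R : R.
have S1 : \sum_k (dG k k i j - dG j k i k) = - 2 * h i j - (\sum_k h k k) * d.
  transitivity (\sum_k (h i k * (j == k)%:R) + \sum_k (h j k * (i == k)%:R)
     - (\sum_k h k k) * d - \sum_(k < 4) h i j).
    rewrite mulr_suml -big_split -!sumrB; apply: eq_bigr => k _ /=.
    rewrite /dG -/d eqxx mulr1.
ring.
  rewrite !sum_delta sumr_const card_ord -mulr_natl (hs j i); ring.
have G1 l : \sum_k G k k l = 4 * B l.
  transitivity (\sum_k (B k * (l == k)%:R) + \sum_(k < 4) B l - \sum_k B k * (l == k)%:R).
    rewrite -big_split -sumrB; apply: eq_bigr => k _ /=.
    by rewrite /G eqxx mulr1 (eq_sym k l).
  by rewrite sumr_const card_ord -mulr_natl; ring.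
have S2 : \sum_k \sum_l G k k l * G l i j = 8 * (B i * B j) - 4 * (\sum_k B k ^+ 2) * d.
  rewrite exchange_big /=.
  transitivity (\sum_l 4 * B l * G l i j).
    by apply: eq_bigr => l _; rewrite -mulr_suml G1.
  transitivity (4 * B i * (\sum_l B l * (j == l)%:R) + 4 * B j * (\sum_l B l * (i == l)%:R)
     - 4 * (\sum_l B l ^+ 2) * d).
    rewrite !mulr_sumr mulr_suml -big_split -sumrB; apply: eq_bigr => l _ /=.
    by rewrite /G -/d; ring.
  by rewrite !sum_delta; ring.
have S3 : \sum_k \sum_l G k j l * G l i k = 6 * (B i * B j) - 2 * (\sum_k B k ^+ 2) * d.
  have row k : \sum_l G k j l * G l i k =
     B j * G k i k + (j == k)%:R * (\sum_l B l * G l i k) - B k * G j i k.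
    transitivity (\sum_l ((B j * G l i k) * (k == l)%:R + (j == k)%:R * (B l * G l i k)
        - (B k * G l i k) * (j == l)%:R)).
      by apply: eq_bigr => l _; rewrite /G (eq_sym l k); ring.
    by rewrite sumrB big_split/= !sum_delta mulr_sumr.
  have col k : \sum_l B l * G l i k = 2 * (B i * B k) - (\sum_l B l ^+ 2) * (i == k)%:R.
    transitivity (\sum_l ((B i * B l) * (k == l)%:R + (B k * B l) * (i == l)%:R
        - B l ^+ 2 * (i == k)%:R)).
      by apply: eq_bigr => l _; rewrite /G; ring.
    by rewrite sumrB big_split/= !sum_delta -mulr_suml; ring.
  transitivity (\sum_k (B j * B i + (2 * (B i * B k)) * (j == k)%:R
     - (\sum_l B l ^+ 2) * (i == k)%:R * (j == k)%:R
     - (B k * B i) * (j == k)%:R - B k ^+ 2 * d + (B k * B j) * (i == k)%:R)).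
    apply: eq_bigr => k _; rewrite row col /G eqxx mulr1 (eq_sym k j) -/d; ring.
  rewrite !big_split/= !sumrN !sum_delta sumr_const card_ord -mulr_natl -mulr_suml.
  rewrite -[(i == j)%:R]/d; ring.
rewrite S1; under [X in _ + X]eq_bigr do rewrite sumrB.
by rewrite sumrB S2 S3; ring.
Qed.

Lemma schouten_trace (B : 'I_4 -> R) (h : 'I_4 -> 'I_4 -> R) :
  \sum_i (- 2 * (h i i - B i * B i) - (\sum_k h k k + 2 * \sum_k B k ^+ 2)) =
  - 6 * (\sum_k h k k + \sum_k B k ^+ 2).
Proof.
rewrite sumrB -mulr_sumr sumrB sumr_const card_ord -mulr_natl.
under [X in _ * (_ - X)]eq_bigr do rewrite -expr2.
by set a := \sum_k h k k; set b := \sum_k _; ring.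
Qed.

(** Expansion of the squared norm of s a (x) a - N A, which is nonnegative, with N = |a|^2: when |A|
    <= s it leaves 2 s N A(a, a) <= 2 s^2 N^2. *)
Lemma newton_tensor_ge0 a A (s : R) : (forall i j, A i j = A j i) -> 0 < s ->
  \sum_i \sum_j A i j ^+ 2 <= s ^+ 2 ->
  \sum_i \sum_j A i j * a i * a j <= s * \sum_i a i * a i.
Proof.
move=> As s0 hA; set N := \sum_i a i * a i.
have N0 : 0 <= N by apply: sumr_ge0 => i _; rewrite -expr2 sqr_ge0.
have [NE|Np] := eqVneq N 0.
  have a0 i : a i = 0.
    move/eqP: NE; rewrite psumr_eq0; last by move=> k _; rewrite -expr2 sqr_ge0.
    by move=> /allP /(_ i (mem_index_enum i)); rewrite /= mulf_eq0 orbb => /eqP.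
  by rewrite NE mulr0 big1// => i _; rewrite big1// => j _; rewrite a0 mulr0 mul0r.
have {}Np : 0 < N by rewrite lt0r Np.
set Q := \sum_i _; set A2 := \sum_i _ in hA.
have : 0 <= \sum_i \sum_j (s * (a i * a j) - N * A i j) ^+ 2.
  by apply: sumr_ge0 => i _; apply: sumr_ge0 => j _; exact: sqr_ge0.
have -> : \sum_i \sum_j (s * (a i * a j) - N * A i j) ^+ 2 =
    s ^+ 2 * (\sum_i \sum_j (a i * a i) * (a j * a j)) - 2 * s * N * Q + N ^+ 2 * A2.
  clearbody N; rewrite /Q /A2 !mulr_sumr -sumrB -big_split; apply: eq_bigr => i _ /=.
  by rewrite !mulr_sumr -sumrB -big_split; apply: eq_bigr => j _ /=; ring.
have -> : \sum_i \sum_j (a i * a i) * (a j * a j) = N * N.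
  by rewrite /N mulr_suml; apply: eq_bigr => i _; rewrite mulr_sumr.
move=> h; have h2 := ler_wpM2l (sqr_ge0 N) hA.
have sN : 0 < 2 * s * N by rewrite !mulr_gt0.
rewrite -(ler_pM2l sN); lra.
Qed.

(** A is the tensor A_g for a = df and h = D^2 f with f = - w, and T is twice its sigma_2. T > 0
    says |A|^2 < (tr A)^2, so [newton_tensor_ge0] applies with s = tr A; there A(a, a) = Q + N^2 /
    2. *)
Lemma gamma2_pointwise a h : (forall i j, h i j = h j i) ->
  let N := \sum_i a i * a i in let L := \sum_i h i i in
  let Q := \sum_i \sum_j h i j * a i * a j in
  let A i j := a i * a j + h i j - 2^-1 * N * (i == j)%:R in
  let T := L ^+ 2 - \sum_i \sum_j h i j ^+ 2 - N * L - 2 * Q in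
  \sum_i A i i = L - N /\
  (\sum_i A i i) ^+ 2 - \sum_i \sum_j A i j * A j i = T /\
  (0 < L - N -> 0 < T -> 3 / 2 * N ^+ 2 <= L * N - Q).
Proof.
move=> hs N L Q A T.
have E1 : \sum_i A i i = L - N.
  by rewrite /A /N /L !sum4 !eqxx !mulr1; field.
have As i j : A i j = A j i by rewrite /A mulrC hs eq_sym.
have EA : \sum_i \sum_j A i j * A j i = \sum_i \sum_j A i j ^+ 2.
  by apply: eq_bigr => i _; apply: eq_bigr => j _; rewrite (As j i) expr2.
have row (F : 'I_4 -> R) i : \sum_j F j * (i == j)%:R = F i by exact: sum_delta.
have E2 : \sum_i \sum_j A i j ^+ 2 = \sum_i \sum_j h i j ^+ 2 + 2 * Q + N ^+ 2 - N * L.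
  have row1 i : \sum_j A i j ^+ 2 = \sum_j (a i * a j + h i j) ^+ 2
      - N * (a i * a i + h i i) + 4^-1 * N ^+ 2.
    transitivity (\sum_j ((a i * a j + h i j) ^+ 2
      + (4^-1 * N ^+ 2 - N * (a i * a j + h i j)) * (i == j)%:R)).
      by apply: eq_bigr => j _; rewrite /A; case: (i == j) => /=;
        rewrite ?mulr1 ?mulr0; field.
    by rewrite big_split/= row; ring.
  under eq_bigr do rewrite row1.
  rewrite big_split/= sumrB sumr_const card_ord -mulr_natl -mulr_sumr big_split/= -/N -/L.
  have -> : \sum_i \sum_j (a i * a j + h i j) ^+ 2 = N * N + 2 * Q + \sum_i \sum_j h i j ^+ 2.
    rewrite {1}/N mulr_suml /Q mulr_sumr -!big_split; apply: eq_bigr => i _ /=.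
    rewrite /N !mulr_sumr -!big_split; apply: eq_bigr => j _ /=; ring.
  by field.
have E3 : (\sum_i A i i) ^+ 2 - \sum_i \sum_j A i j * A j i = T.
  by rewrite EA E1 E2 /T; ring.
split=> //; split=> // s0 T0.
have hA : \sum_i \sum_j A i j ^+ 2 <= (L - N) ^+ 2.
  by rewrite -EA -E1; move: T0; rewrite -E3 subr_gt0 => /ltW.
have := newton_tensor_ge0 a As s0 hA.
have -> : \sum_i \sum_j A i j * a i * a j = Q + 2^-1 * N ^+ 2.
  transitivity (\sum_i (\sum_j h i j * a i * a j + (a i * a i) * N - 2^-1 * N * (a i * a i))).
    apply: eq_bigr => i _; rewrite {1}/N mulr_sumr -big_split/=.
    rewrite -[2^-1 * N * _](row (fun j => 2^-1 * N * (a i * a j)) i) -sumrB.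
    by apply: eq_bigr => j _; rewrite /A; ring.
  by rewrite sumrB big_split/= -mulr_suml -mulr_sumr -/N -/Q; field.
rewrite -/N; lra.
Qed.

End schouten_algebra.

Section conformal_schouten.
Context {R : realType}.
Local Notation V := 'rV[R]_4.
Local Notation e_ i := (delta_mx 0 i : V).
Variables (U : set V) (w : V -> R).
Hypothesis Uopen : forall x, U x -> \forall y \near x, U y.
Hypothesis wC2 : C2_on U w.

Local Notation b i := (partial i w).
Local Notation H i j := (partial j (partial i w)).
Local Notation g := (conformal_flat w).

Lemma conformal_flatE y (i j : 'I_4) : g y i j = expR (2 * w y) * (i == j)%:R.
Proof. by rewrite /conformal_flat !mxE. Qed.

Lemma invmx_conformal_flat y : invmx (g y) = expR (- (2 * w y)) *: 1%:M.
Proof. by rewrite /conformal_flat !scalemx1 invmx_scalar expRN. Qed.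

Lemma partial_conformal_flat y (i j k : 'I_4) : U y ->
  partial i (fun z => g z j k) y = expR (2 * w y) * (2 * b i y) * (j == k)%:R.
Proof.
move=> Uy; rewrite /partial (_ : (fun z => g z j k) = fun z => (j == k)%:R * expR (2 * w z)).
  have [_ Dw _ _] := wC2; have Dwi := Dw i y Uy.
  have D1 : is_derive y (e_ i) w (b i y) by split.
  have D2 : is_derive (w y) 1 (fun s : R => (j == k)%:R * expR (2 * s))
      ((j == k)%:R * (expR (2 * w y) * 2)).
    have Z2 := @is_deriveZ R R R _ 2 (w y) 1 _ (is_derive_id _ _).
    have E2 := @is_derive1_comp R expR (fun s : R => 2 * s) (w y) _ _ (is_derive_expR _) Z2.
    have F2 := @is_deriveZ R R R _ (j == k)%:R (w y) 1 _ E2.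
    by apply: (is_derive_eq F2); rewrite [2 *: 1]mulr1.
  have [_ ->] := is_derive_comp_real D2 D1.
rewrite /partial; ring.
by apply/funext => z; rewrite conformal_flatE mulrC.
Qed.

Lemma christoffel_conformal y (k i j : 'I_4) : U y -> christoffel g k i j y =
  b i y * (j == k)%:R + b j y * (i == k)%:R - b k y * (i == j)%:R.
Proof.
move=> Uy; rewrite /christoffel (bigD1 k)//= big1; last first.
  move=> l lk; rewrite invmx_conformal_flat !mxE eq_sym (negbTE lk).
  by rewrite mulr0 mul0r.
rewrite addr0 invmx_conformal_flat !mxE eqxx !partial_conformal_flat//.
have E0 : expR (- (2 * w y)) * expR (2 * w y) = 1 by rewrite -expRD addNr expR0.
transitivity (expR (- (2 * w y)) * expR (2 * w y) *
  (b i y * (j == k)%:R + b j y * (i == k)%:R - b k y * (i == j)%:R)).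
  rewrite mulr1n; set e := expR _; set e' := expR _.
  set bi := b i y; set bj := b j y; set bk := b k y.
  by field.
by rewrite E0 mul1r.
Qed.

Lemma partial_christoffel x (m k i j : 'I_4) : U x -> partial m (christoffel g k i j) x =
  H i m x * (j == k)%:R + H j m x * (i == k)%:R - H k m x * (i == j)%:R.
Proof.
move=> Ux; have [_ _ Db _] := wC2.
have D a : is_derive x (e_ m) (b a) (H a m x).
  by have [_ Da] := Db a; split => //; exact: Da.
pose F y := (j == k)%:R * b i y + (i == k)%:R * b j y - (i == j)%:R * b k y.
have -> : partial m (christoffel g k i j) x = partial m F x.
  apply: near_eq_derive; near=> y.
  rewrite christoffel_conformal /F; last by near: y; exact: Uopen.
  by rewrite ![b _ y * _]mulrC.
have Z c a := @is_deriveZ R V R _ c x (e_ m) _ (D a).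
have := is_deriveB (is_deriveD (Z (j == k)%:R i) (Z (i == k)%:R j)) (Z (i == j)%:R k).
case=> _ DF; rewrite -[LHS]/('D_(e_ m) F x).
by rewrite [LHS]DF; congr (_ + _ - _); rewrite [LHS]mulrC.
Unshelve. all: end_near.
Qed.

(** Discharged later by [C2_sym], once w is known to agree near each point with a function that is
    C^2 on the whole space. *)
Hypothesis sym : forall x i j, U x -> H i j x = H j i x.

Lemma ricci_conformal x (i j : 'I_4) : U x -> ricci g x i j =
  - 2 * (H i j x - b i x * b j x)
  - (\sum_k H k k x + 2 * \sum_k b k x ^+ 2) * (i == j)%:R.
Proof.
move=> Ux; rewrite /ricci mxE.
have hs a c : H a c x = H c a x by exact: sym.
rewrite -(ricci_algebra (fun k => b k x) i j hs); congr (_ + _).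
  by apply: eq_bigr => k _; rewrite !partial_christoffel.
apply: eq_bigr => k _; apply: eq_bigr => l _.
by rewrite !christoffel_conformal.
Qed.

Lemma schouten_endo_conformal x (i j : 'I_4) : U x -> schouten_endo g x i j =
  expR (- (2 * w x)) *
  (b i x * b j x - H i j x - 2^-1 * (\sum_k b k x ^+ 2) * (i == j)%:R).
Proof.
move=> Ux; rewrite /schouten_endo invmx_conformal_flat -scalemxAl mul1mx mxE; congr (_ * _).
have Z (c d : R) (A1 A2 : 'M[R]_4) : (c *: (A1 - d *: A2)) i j = c * (A1 i j - d * A2 i j).
  by rewrite !mxE.
rewrite /schouten Z conformal_flatE.
have E0 : expR (- (2 * w x)) * expR (2 * w x) = 1 by rewrite -expRD addNr expR0.
have -> : scalar_curvature g x = expR (- (2 * w x)) *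
    (- 6 * (\sum_k H k k x + \sum_k b k x ^+ 2)).
  rewrite /scalar_curvature invmx_conformal_flat -scalemxAl mul1mx mxtraceZ; congr (_ * _).
  rewrite /mxtrace; under eq_bigr do rewrite ricci_conformal// eqxx mulr1.
  exact: (schouten_trace (fun k => b k x) (fun i j => H i j x)).
rewrite ricci_conformal//.
set N := \sum_k b k x ^+ 2; set Lp := \sum_k H k k x; set dl := (i == j)%:R.
set e := expR (- (2 * w x)) in E0 *; set e2 := expR (2 * w x) in E0 *.
transitivity (2^-1 * (- 2 * (H i j x - b i x * b j x) - (Lp + 2 * N) * dl
   + e * e2 * (Lp + N) * dl)); last by rewrite E0; field.
by field.
Qed.

End conformal_schouten.

(** * Localization and conclusion *)

Section cutoff_extension.
Context {R : realType}.
Local Notation V := 'rV[R]_4.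
Local Notation e_ i := (delta_mx 0 i : V).
Implicit Types (f g c w : V -> R) (df dg dc : 'I_4 -> V -> R).
Implicit Types (ddf ddc : 'I_4 -> 'I_4 -> V -> R) (U : set V).

Lemma partial_near f g i x : {near x, f =1 g} -> partial i f x = partial i g x.
Proof. by move=> fg; apply: near_eq_derive. Qed.

Lemma C1_partial f df i x : C1 f df -> partial i f x = df i x.
Proof. by case=> _ _ Df; have [_] := Df i x. Qed.

Lemma C1_near0 f df i (x : V) : C1 f df -> (\forall y \near x, f y = 0) ->
  \forall y \near x, df i y = 0.
Proof.
move=> Cf /near_join f0; near=> y; rewrite -(C1_partial i y Cf).
have -> : partial i f y = partial i (fun=> 0) y by apply: partial_near; near: y.
exact: derive_cst.
Unshelve. all: end_near.
Qed.

(** Every point lies in U or has a neighbourhood where c vanishes. In the latter case the product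
    and its candidate derivatives are zero there, whatever values g and dg take outside U. *)
Lemma C1_M_local U c dc g dg : C1 c dc ->
  (forall x, U x \/ \forall y \near x, c y = 0) ->
  continuous_on U g -> (forall i, continuous_on U (dg i)) ->
  (forall i x, U x -> is_derive x (e_ i) g (dg i x)) ->
  C1 (fun x => c x * g x) (fun i x => dc i x * g x + c x * dg i x).
Proof.
move=> Cc Uc cg cdg Dg; have [[cc] cdc Dc] := Cc.
have dc0 i (x : V) : (\forall y \near x, c y = 0) -> \forall y \near x, dc i y = 0.
  exact: C1_near0 Cc.
split.
- split=> x; have [Ux|x0] := Uc x.
    by apply: continuousM; [exact: cc|exact: cg].
  by apply: (@near_cst_continuous V R 0); apply: filterS x0 => y ->; rewrite mul0r.
- move=> i; have [cdi] := cdc i; split=> x; have [Ux|x0] := Uc x.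
    apply: (@continuousD R R V (fun x => dc i x * g x) (fun x => c x * dg i x)); apply: continuousM; [exact: cdi|exact: cg|exact: cc|exact: cdg].
  apply: (@near_cst_continuous V R 0); near=> y.
  have -> : c y = 0 by near: y.
  have -> : dc i y = 0 by near: y; exact: dc0.
  by rewrite !mul0r addr0.
- move=> i x; have [Ux|x0] := Uc x.
    have H := is_deriveM (Dc i x) (Dg i x Ux); apply: (is_derive_eq H).
    by rewrite addrC; congr (_ + _); rewrite [LHS]mulrC.
  rewrite (nbhs_singleton (dc0 i x x0)) (nbhs_singleton x0) !mul0r addr0.
  apply: (@near_eq_is_derive _ _ _ (fun=> 0)).
    by apply: filterS x0 => y ->; rewrite mul0r.
Unshelve. all: end_near.
Qed.

Lemma C2_comp (k dk ddk : R -> R) f df ddf : C2 f df ddf ->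
  (forall a : R, is_derive a 1 k (dk a)) -> (forall a : R, is_derive a 1 dk (ddk a)) ->
  continuous ddk ->
  C2 (fun x => k (f x)) (fun i x => dk (f x) * df i x)
    (fun i j x => ddk (f x) * df j x * df i x + dk (f x) * ddf i j x).
Proof.
move=> [Cf Cdf] Dk Ddk cddk.
have cdk : continuous dk.
  by move=> a; have [/derivable1_diffP/differentiable_continuous] := Ddk a.
split; first exact: C1_comp Cf (fun x => Dk (f x)) (fun x => cdk (f x)).
by move=> i; exact: C1_M (C1_comp Cf (fun x => Ddk (f x)) (fun x => cddk (f x))) (Cdf i).
Qed.

Lemma C2_cutoff (p : V) (a s : R) : a < s -> exists c dc ddc,
  [/\ C2 c dc ddc, forall x, sqd p x <= a -> c x = 1 & forall x, s <= sqd p x -> c x = 0].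
Proof.
(* k is C^2 with k(0) = 0 and k(t) = 1 for t >= (s - a)^3; the latter is a lower bound of
   [bump 3 p s] where sqd p x <= a. *)
move=> as_; pose m := (s - a)^-1 ^+ 3; pose k t := 1 - posp 3 (1 - m * t).
have m0 : 0 < m by rewrite exprn_gt0// invr_gt0 subr_gt0.
pose l t := 1 - m * t.
have Dl (t : R) : is_derive t 1 l (- m).
  have H := is_deriveB (is_derive_cst (1 : R) t 1) (@is_deriveZ R R R _ m t 1 _ (is_derive_id _ _)).
  by apply: (is_derive_eq H); rewrite sub0r; congr (- _); exact: mulr1.
have Dc n (t : R) : is_derive t 1 (fun t => posp n.+2 (l t)) (n.+2%:R * posp n.+1 (l t) * - m).
  exact: (@is_derive1_comp R (posp n.+2) l t _ _ (is_derive_posp n (l t)) (Dl t)).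
have Dk (t : R) : is_derive t 1 k (3 * m * posp 2 (l t)).
  have H := is_deriveB (is_derive_cst (1 : R) t 1) (Dc 1%N t).
  by apply: (is_derive_eq H); ring.
have Ddk (t : R) : is_derive t 1 (fun t => 3 * m * posp 2 (l t)) (- 6 * m ^+ 2 * posp 1 (l t)).
  have H := @is_deriveZ R R R _ (3 * m) t 1 _ (Dc 0%N t).
  by apply: (is_derive_eq H); transitivity (3 * m * (2 * posp 1 (l t) * - m)); [by []|ring].
have cl : continuous l.
  by move=> t; have [/derivable1_diffP/differentiable_continuous] := Dl t.
have cddk : continuous (fun t => - 6 * m ^+ 2 * posp 1 (l t)).
  move=> t; apply: (@continuousM R R (cst (- 6 * m ^+ 2)) (fun t => posp 1 (l t))); first exact: cst_continuous.
  by apply: (@continuous_comp R R R l); [exact: cl|exact: posp_continuous].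
have Ck := C2_comp (C2_bump 0 p s) Dk Ddk cddk.
exists (fun x => k (bump 3 p s x)); eexists; eexists; split; first exact: Ck.
  move=> x xa; rewrite /k posp_le0 ?subr0// subr_le0 bump_in; last exact: le_lt_trans as_.
  rewrite /m -exprMn exprn_ege1// ler_pdivlMl ?subr_gt0// mulr1; lra.
by move=> x /bump_out ->; rewrite /k mulr0 subr0 posp_gt0// expr1n subrr.
Qed.

(** The calculus above is for functions on the whole space. A cut-off equal to 1 on the smaller ball
    extends w by zero without changing it where the estimates are made. *)
Lemma C2_extension (p : V) (s t : R) w : s < t -> C2_on [set x | sqd p x < t] w ->
  exists f df ddf, C2 f df ddf /\ forall x, sqd p x <= s -> f x = w x.
Proof.
move=> st [cw Dw Db cH]; pose m := (s + t) / 2.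
have sm : s < m by rewrite /m; lra.
have [c [dc [ddc [Cc c1 c0]]]] := C2_cutoff p sm.
have [C1c Cdc] := Cc; pose U := [set x : V | sqd p x < t].
have D i x : U x -> is_derive x (e_ i) w (partial i w x).
  by move=> Ux; split => //; exact: Dw.
have DD i j x : U x -> is_derive x (e_ j) (partial i w) (partial j (partial i w) x).
  by move=> Ux; split => //; have [_] := Db i; exact.
have Uc x : U x \/ \forall y \near x, c y = 0.
  have [xt|tx] := ltP (sqd p x) t; [by left|right].
  have [cs] : cont (sqd p) by exact: C1_continuous (C1_sqd p).
  have : \forall y \near x, m < sqd p y.
    by apply: (cvgr_gt _ (cs x)); apply: lt_le_trans tx; rewrite /m; lra.
  by apply: filterS => y /ltW; exact: c0.
have Udc i x : U x \/ \forall y \near x, dc i y = 0.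
  by have [Ux|x0] := Uc x; [left|right; exact: C1_near0 C1c x0].
have cb i : continuous_on U (partial i w) by have [] := Db i.
have Cf := C1_M_local C1c Uc cw cb D.
have Cdf i : C1 (fun x => dc i x * w x + c x * partial i w x) _ :=
  C1_D (C1_M_local (Cdc i) (Udc i) cw cb D) (C1_M_local C1c Uc (cb i) (cH i) (DD i)).
exists (fun x => c x * w x); eexists; eexists; split; first by split; [exact: Cf|exact: Cdf].
by move=> x /c1 ->; rewrite mul1r.
Qed.

End cutoff_extension.

(** * From the equation for w to inequalities for f = - w *)

Section admissible.
Context {R : realType}.
Local Notation V := 'rV[R]_4.
Implicit Types (f K w : V -> R) (df : 'I_4 -> V -> R) (ddf : 'I_4 -> 'I_4 -> V -> R) (U : set V).

Lemma eballE (p : V) (r : R) : eball p r = [set x | edist p x < r].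
Proof.
apply/funext => x; rewrite /eball /= /edist /enorm /sqd.
by under eq_bigr do rewrite !mxE.
Qed.

Lemma edist_open (p : V) (r : R) x : edist p x < r -> \forall y \near x, edist p y < r.
Proof. by have [c] := cont_edist p; move=> xr; apply: (cvgr_lt _ (c x)). Qed.

Lemma C1_N f df : C1 f df -> C1 (fun x => - f x) (fun i x => - df i x).
Proof.
move=> /(C1_Z (-1)); under eq_fun do rewrite mulN1r.
by apply: C1_eq => i x; rewrite mulN1r.
Qed.

Lemma C2_on_sub U (W : set V) w : W `<=` U -> C2_on U w -> C2_on W w.
Proof.
move=> WU [a b c d]; split; first by move=> x /WU; exact: a.
- by move=> i x /WU; exact: b.
- by move=> i; have [c1 c2] := c i; split=> [x /WU|j x /WU]; [exact: c1|exact: c2].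
- by move=> i j x /WU; exact: d.
Qed.

(** The matrix of g^-1 A_g is e^(- 2w) times the tensor A of [gamma2_pointwise], so its sigma_1 and
    sigma_2 carry the factors e^(- 2w) and e^(- 4w). Membership in Gamma_2^+ then gives the three
    inequalities, and K > 0. *)
Lemma admissible_gamma2 U K w f df ddf : (forall x, U x -> \forall y \near x, U y) ->
  admissible_solution U K w -> C2 f df ddf -> (forall x, U x -> f x = - w x) ->
  [/\ gamma2_on U df ddf, forall x, U x -> 0 < K x
    & forall x, U x -> twice_sigma2 df ddf x = 2 * (K x * expR (4 * w x))].
Proof.
move=> Uo [wC2 hw] Cf fw; have [C1f Cdf] := Cf.
have bE x i : U x -> partial i w x = - df i x.
  move=> Ux; have := C1_partial i x (C1_N C1f) => <-; apply: partial_near.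
  by apply: filterS (Uo x Ux) => y Uy; rewrite fw// opprK.
have HE x i j : U x -> partial j (partial i w) x = - ddf i j x.
  move=> Ux; have := C1_partial j x (C1_N (Cdf i)) => <-; apply: partial_near.
  by apply: filterS (Uo x Ux) => y Uy; rewrite bE.
have sym x i j : U x -> partial j (partial i w) x = partial i (partial j w) x.
  by move=> Ux; rewrite !HE// (C2_sym i j x Cf).
have key x : U x -> let a i := df i x in let h i j := ddf i j x in
  [/\ dotp df df x <= lap ddf x,
      3 / 2 * dotp df df x ^+ 2 <= lap ddf x * dotp df df x - hes ddf df df x,
      0 < K x & twice_sigma2 df ddf x = 2 * (K x * expR (4 * w x))].
  move=> Ux a h; have [[s1 s2] sK] := hw x Ux.
  have [t1 t2] := sigma12 s1.
  have [E1 [E2 E3]] := gamma2_pointwise a (fun i j => C2_sym i j x Cf : h i j = h j i).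
  pose N := \sum_i a i * a i.
  pose A i j := a i * a j + h i j - 2^-1 * N * (i == j)%:R.
  set L := schouten_endo (conformal_flat w) x in s1 s2 sK t1 t2.
  pose e := expR (- (2 * w x)).
  have LE i j : L i j = e * A i j.
    rewrite /L (schouten_endo_conformal Uo wC2 sym)// !bE// HE//; congr (_ * (_ - _ * _ * _)).
      by rewrite mulrNN opprK.
    by apply: eq_bigr => k _; rewrite bE// sqrrN expr2.
  have e0 : 0 < e by exact: expR_gt0.
  have trL : \sum_i L i i = e * \sum_i A i i.
    by rewrite mulr_sumr; apply: eq_bigr => i _.
  have trL2 : \sum_i \sum_j L i j * L j i = e ^+ 2 * \sum_i \sum_j A i j * A j i.
    rewrite mulr_sumr; apply: eq_bigr => i _; rewrite mulr_sumr; apply: eq_bigr => j _.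
    by rewrite !LE; ring.
  have ee : e ^+ 2 * expR (4 * w x) = 1.
    by rewrite /e -expRM_natl -expRD [X in expR X](_ : _ = 0) ?expR0//; ring.
  have p1 : 0 < lap ddf x - dotp df df x.
    by move: s1; rewrite t1 trL pmulr_rgt0// E1.
  have TE : e ^+ 2 * twice_sigma2 df ddf x = 2 * K x.
    by rewrite -sK t2 trL trL2 exprMn -mulrBr E2.
  have K0 : 0 < K x by rewrite -sK.
  have T0 : 0 < twice_sigma2 df ddf x.
    by rewrite -(pmulr_rgt0 _ (exprn_gt0 2 e0)) TE mulr_gt0.
  split=> //; first by rewrite -subr_ge0 ltW.
    exact: E3.
  by rewrite mulrA -TE mulrAC ee mul1r.
split=> x /key[]// h1 h2 K0 E; split=> //.
by rewrite E !mulr_ge0 ?ltW ?expR_gt0.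
Qed.

End admissible.

Section pointwise_harnack.
Context {R : realType}.
Local Notation V := 'rV[R]_4.
Implicit Types (f K w : V -> R) (df : 'I_4 -> V -> R) (ddf : 'I_4 -> 'I_4 -> V -> R).

Lemma admissible_harnack : exists2 eps : R, 0 < eps & exists2 C : R -> R,
  (forall M, 0 < C M) & forall r x0 K w M, 0 < r ->
  (supr_on (eball x0 (2 * r)) K < +oo)%E ->
  admissible_solution (eball x0 (2 * r)) K w ->
  (supr_on (eball x0 (2 * r)) K
     * integral4 (eball x0 (2 * r)) (fun x => expR (4 * w x))%R)%E = M%:E ->
  (integral4 (eball x0 (2 * r)) (fun x => K x * expR (4 * w x))%R < eps%:E)%E ->
  forall x y, eball x0 r x -> eball x0 r y -> expR (w x) <= C M * expR (w y).
Proof.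
have [eps eps0 [th th32 SB]] := @sup_bound R.
(* [sup_bound] is stated for S = 2 K exp (4w), hence the half. *)
exists (eps / 2); first exact: divr_gt0.
have /choice [C HC] M : exists C, 0 < C /\ forall f df ddf x0 r x y, C2 f df ddf -> 0 < r ->
    gamma2_on [set x | edist x0 x < 5 / 4 * r] df ddf ->
    (forall x, edist x0 x < 5 / 4 * r -> twice_sigma2 df ddf x <= (th M * r)^-1 ^+ 4) ->
    edist x0 x < r -> edist x0 y < r -> expR (- f x) <= C * expR (- f y).
  by have [C C0 H] := harnack (th32 M); exists C.
exists C => [M|r x0 K w M r0]; first by have [] := HC M.
have [C0 {}HC] := HC M; rewrite !eballE.
set B := [set x | edist x0 x < 2 * r]; set sK := supr_on B K.
move=> Koo aw KM Keps x y xr yr.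
have sub (a : R) z : a <= 2 * r -> edist x0 z < a -> B z.
  by move=> a2 za; apply: lt_le_trans za a2.
(* The cone condition forces K > 0, so that the supremum of K is a positive real number, as
   [sup_bound] requires. *)
have Kpos z : B z -> 0 < K z by move=> /aw.2 [[_ s2] <-].
have Kle z : B z -> ((K z)%:E <= sK)%E by move=> Bz; apply: ereal_sup_ubound; exists z.
have B0 : B x0 by rewrite /B /= edistxx mulr_gt0.
have sK0 : (0 < sK)%E by apply: lt_le_trans (Kle _ B0); rewrite lte_fin Kpos.
pose K0 := fine sK.
have KE : sK = K0%:E by rewrite fineK// ge0_fin_numE// ltW.
have K0pos : 0 < K0 by rewrite -lte_fin -KE.
have {}Kle z : B z -> K z <= K0 by move=> /Kle; rewrite KE lee_fin.
pose U := [set x : V | edist x0 x < 3 / 2 * r].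
have UB : U `<=` B by move=> z; apply: sub; lra.
have [f [df [ddf [Cf fw]]]] : exists f df ddf, C2 f df ddf /\ forall z, U z -> f z = - w z.
  have wC2 : C2_on [set z | sqd x0 z < (2 * r) ^+ 2] w.
    apply: C2_on_sub aw.1 => z; rewrite /B /= edist_lt//; lra.
  have st : (3 / 2 * r) ^+ 2 < (2 * r) ^+ 2 by have r2 := mulr_gt0 r0 r0; rewrite !expr2; lra.
  have [g [dg [ddg [[Cg Cdg] gw]]]] := C2_extension st wC2.
  exists (fun z => - g z); eexists; eexists; split.
    by split; [exact: C1_N Cg|move=> i; exact: C1_N (Cdg i)].
  move=> z /ltW; rewrite edist_le; last lra.
  by move=> /gw ->.
have aU : admissible_solution U K w.
  by split; [exact: C2_on_sub UB aw.1|move=> z /UB; exact: aw.2].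
have [G _ SE] := admissible_gamma2 (@edist_open R x0 _) aU Cf fw.
have [C1f Cdf] := Cf.
have e4 z : U z -> expR (- (4 * f z)) = expR (4 * w z).
  by move=> /fw ->; rewrite mulrN opprK.
have cE : cont (fun z => expR (- (4 * f z))).
  by have := cont_expR_aff 4 0 C1f; under eq_fun do rewrite sub0r mulrN.
have cS := cont_twice_sigma2 Cf.
have b1 n p (t : R) z : 0 < t -> 0 <= bump n p t z <= t ^+ n.
  move=> t0; rewrite bump_ge0 bumpE lerXn2r ?nnegrE ?bump_ge0 ?bump1_le//; exact: ltW.
have bU n p t z : (forall x, sqd p x < t -> edist x0 x < 3 / 2 * r) ->
    bump n.+1 p t z != 0 -> U z by move=> h /bump_supp /h.
have S0 z : U z -> 0 <= twice_sigma2 df ddf z by move=> /G [].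
have bound : forall z, edist x0 z < 5 / 4 * r -> 2 * K0 * expR (- (4 * f z)) <= (th M * r)^-1 ^+ 4.
  apply: (SB _ _ _ _ _ _ _ Cf r0 K0pos G).
  - move=> z Uz; rewrite SE// e4// -mulrA ler_pM2l// ler_wpM2r ?expR_ge0//.
    exact/Kle/UB.
  - move=> p t t0 pt; have t4 : 0 < t ^+ 4 by exact: exprn_gt0.
    (* Since [bump 4 p t] is at most t^4, division by 2 t^4 brings the test integrand below K exp
       (4w). *)
    pose g z := (2 * t ^+ 4)^-1 * (twice_sigma2 df ddf z * bump 4 p t z).
    have t4' : 0 < 2 * t ^+ 4 by exact: mulr_gt0.
    have cg : ccs (fun z => twice_sigma2 df ddf z * bump 4 p t z).
      by apply: ccsM => //; exact: ccs_bump.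
    have : int4 g < eps / 2.
      rewrite -lte_fin; apply: le_lt_trans Keps; apply: int4_le_integral4.
      + exact: ccsZ.
      + move=> z; rewrite /g; have [->|/(bU _ _ _ _ pt) Uz] := eqVneq (bump 4 p t z) 0.
          by rewrite !mulr0.
        apply: mulr_ge0; first by rewrite invr_ge0 ltW.
        by apply: mulr_ge0; [exact: S0|exact: bump_ge0].
      + by move=> z Bz; rewrite mulr_ge0 ?expR_ge0// ltW// Kpos.
      + move=> z gz; have Uz : U z.
          by apply: (bU 3%N p t z pt); apply: contra_neq gz => E; rewrite /g E !mulr0.
        split; first exact: UB.
        have /andP[_ b4] := b1 4%N p t z t0.
        rewrite /g ler_pdivrMl// SE//.
        have KE0 : 0 <= 2 * (K z * expR (4 * w z)).
          by rewrite !mulr_ge0 ?expR_ge0// ltW// Kpos//; exact: UB.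
        by apply: le_trans (ler_wpM2l KE0 b4) _; rewrite le_eqVlt; apply/orP; left; apply/eqP; ring.
    rewrite /g int4Z// ltr_pdivrMl// => /ltW h; apply: le_trans h _.
    by rewrite le_eqVlt; apply/orP; left; apply/eqP; field.
  - move=> p t t0 pt; have t2 : 0 < t ^+ 2 by exact: exprn_gt0.
    pose g z := (t ^+ 2)^-1 * (expR (- (4 * f z)) * bump 2 p t z).
    have cg : ccs (fun z => expR (- (4 * f z)) * bump 2 p t z).
      by apply: ccsM => //; exact: ccs_bump.
    have : ((int4 g)%:E <= integral4 B (fun x => expR (4 * w x))%R)%E.
      apply: int4_le_integral4.
      + exact: ccsZ.
      + move=> z; apply: mulr_ge0; first by rewrite invr_ge0 ltW.
        by apply: mulr_ge0; [exact: expR_ge0|exact: bump_ge0].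
      + by move=> z _; exact: expR_ge0.
      + move=> z gz; have Uz : U z.
          by apply: (bU 1%N p t z pt); apply: contra_neq gz => E; rewrite /g E !mulr0.
        split; first exact: UB.
        have /andP[_ b2] := b1 2%N p t z t0.
        by rewrite /g ler_pdivrMl// e4// mulrC ler_wpM2r// expR_ge0.
    have K0' : (0 <= K0%:E)%E by rewrite lee_fin ltW.
    move=> /(lee_wpmul2l K0'); rewrite -KE KM KE -EFinM lee_fin /g int4Z//.
    rewrite mulrCA ler_pdivrMl//.
have H z : edist x0 z < 5 / 4 * r -> twice_sigma2 df ddf z <= (th M * r)^-1 ^+ 4.
  move=> zr; apply: le_trans (bound z zr).
  have Uz : U z by rewrite /U /=; apply: lt_le_trans zr _; lra.
  by rewrite SE// e4// -mulrA ler_pM2l// ler_wpM2r ?expR_ge0//; exact/Kle/UB.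
have G' : gamma2_on [set x | edist x0 x < 5 / 4 * r] df ddf.
  by move=> z zr; apply: G; apply: lt_le_trans zr _; lra.
have := HC _ _ _ _ _ _ _ Cf r0 G' H xr yr.
by rewrite !fw ?opprK// /U /=; [apply: lt_le_trans yr _|apply: lt_le_trans xr _]; lra.
Qed.

End pointwise_harnack.

Theorem theorem1 (R : realType) :
  exists2 eps0 : R, 0 < eps0 &
  exists2 Cstar : R -> R, (forall M : R, 0 < Cstar M) &
  forall (r : R) (x0 : 'rV[R]_4) (K w : 'rV[R]_4 -> R) (M : R),
    0 < r ->
    (0%:E <= infi_on (eball x0 (2 * r)) K)%E ->
    (supr_on (eball x0 (2 * r)) K < +oo)%E ->
    admissible_solution (eball x0 (2 * r)) K w ->
    (supr_on (eball x0 (2 * r)) K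
       * integral4 (eball x0 (2 * r)) (fun x => expR (4 * w x))%R)%E = M%:E ->
    (integral4 (eball x0 (2 * r)) (fun x => K x * expR (4 * w x))%R
       < eps0%:E)%E ->
    (supr_on (eball x0 r) (fun x => expR (w x))%R
       <= (Cstar M)%:E *
          (((r ^+ 4)^-1)%:E *
           integral4 (eball x0 (2 * r)) (fun x => expR (4 * w x))%R) `^ (4^-1)%R)%E
    /\
    (supr_on (eball x0 r) (fun x => expR (w x))%R
       <= (Cstar M)%:E * infi_on (eball x0 r) (fun x => expR (w x))%R)%E.
Proof.
have [eps eps0 [C C0 H]] := @admissible_harnack R.
have o0 : 0 < (omega : R) := omega_gt0.
(* Arises when omega m^4 <= I / r^4 is solved for m, with m a lower bound of exp w on the ball; the
   factor 1 + b then serves both conclusions. *)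
pose b := (omega : R)^-1 `^ (4^-1); have b0 : 0 < b by apply: powR_gt0; rewrite invr_gt0.
exists eps => //; exists (fun M => C M * (1 + b)).
  by move=> M; rewrite mulr_gt0// addr_gt0.
move=> r x0 K w M r0 _ Koo aw KM Keps.
have {}H := H r x0 K w M r0 Koo aw KM Keps.
have CM := C0 M; set B := eball x0 (2 * r) in Koo aw KM Keps *.
have xx0 : eball x0 r x0 by rewrite eballE /= edistxx.
have BB : eball x0 r `<=` B.
  by move=> z; rewrite /B !eballE /= => zr; apply: lt_le_trans zr _; lra.
set I := integral4 _ _; have r4 : 0 < r ^+ 4 by exact: exprn_gt0.
have I0 : (0 <= I)%E by apply: integral_ge0 => p _; rewrite lee_fin expR_ge0.
have J0 : (0 <= ((r ^+ 4)^-1)%:E * I)%E by rewrite mule_ge0// lee_fin invr_ge0 ltW.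
have lower m : 0 < m -> (forall y, eball x0 r y -> m <= expR (w y)) ->
    ((omega * m ^+ 4)%:E <= ((r ^+ 4)^-1)%:E * I)%E.
  move=> m0 hm; have r2 : 0 < r ^+ 2 by exact: exprn_gt0.
  rewrite -(lee_pmul2l _ (_ : (0 < (r ^+ 4)%:E)%E)) ?lte_fin// muleA -!EFinM divff ?gt_eqF// mul1e.
  (* The cut-off [bump 2] of squared radius r^2 is at most r^4, so c times it is at most m^4, and
     its integral is omega m^4 r^4. *)
  pose c := m ^+ 4 * (r ^+ 4)^-1; have c0 : 0 < c by rewrite mulr_gt0 ?exprn_gt0// invr_gt0.
  have -> : r ^+ 4 * (omega * m ^+ 4) = int4 (fun z => c * bump 2 x0 (r ^+ 2) z).
    rewrite int4Z ?int4_bump//; last exact: ccs_bump.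
    by rewrite /c; field; rewrite gt_eqF.
  apply: int4_le_integral4.
  - by apply: ccsZ; exact: ccs_bump.
  - by move=> z; rewrite mulr_ge0 ?bump_ge0// ltW.
  - by move=> z _; exact: expR_ge0.
  move=> z; have [->|/bump_supp zr _] := eqVneq (bump 2 x0 (r ^+ 2) z) 0.
    by rewrite mulr0 eqxx.
  have Bz : eball x0 r z by rewrite eballE /= edist_lt// ltW.
  split; first exact: BB.
  apply: (@le_trans _ _ (m ^+ 4)).
    rewrite /c -mulrA; apply: ler_piMr; first by rewrite exprn_ge0// ltW.
    rewrite ler_pdivrMl// mulr1 bumpE (exprM r 2 2).
    by rewrite lerXn2r ?nnegrE ?bump_ge0 ?bump1_le// ltW.
  by rewrite expRM_natl lerXn2r ?nnegrE ?expR_ge0 ?hm// ltW.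
(* The Harnack inequality turns the value at any x into a lower bound on the whole ball, which
   [lower] converts into volume. *)
have ratio x y : eball x0 r x -> eball x0 r y -> expR (w x) / C M <= expR (w y).
  by move=> xr yr; rewrite ler_pdivrMr// mulrC H.
split; apply: ge_ereal_sup => _ [x xr <-].
- have m0 : 0 < expR (w x) / C M by rewrite divr_gt0 ?expR_gt0.
  have q0 : (0 : R) <= 4^-1 by rewrite invr_ge0.
  set m := expR (w x) / C M in m0 *.
  have m4 : 0 <= m ^+ 4 by rewrite exprn_ge0// ltW.
  have o4 : 0 <= omega * m ^+ 4 by rewrite mulr_ge0// ltW.
  have Cb : 0 <= C M * b by rewrite mulr_ge0 ?ltW.
  set J := (((r ^+ 4)^-1)%:E * I)%E in J0 *.
  have h : (((omega * m ^+ 4)%:E `^ (4^-1)%R) <= J `^ (4^-1)%R)%E.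
    apply: gt0_ler_poweR => //; rewrite ?in_itv/= ?leey ?andbT ?lee_fin//.
    exact: lower (fun y => ratio x y xr).
  apply: (@le_trans _ _ ((C M * b)%:E * J `^ (4^-1)%R)%E); last first.
    by rewrite lee_wpmul2r ?poweR_ge0// lee_fin ler_pM2l// lerDr.
  apply: (@le_trans _ _ ((C M * b)%:E * (omega * m ^+ 4)%:E `^ (4^-1)%R)%E); last first.
    by rewrite lee_wpmul2l// lee_fin.
  rewrite poweR_EFin -EFinM lee_fin powRM//; last exact: ltW.
  rewrite -powR_mulrn ?(ltW m0)// -powRrM divff ?pnatr_eq0// powRr1 ?(ltW m0)//.
  have bo : b * omega `^ (4^-1) = 1.
    by rewrite -powRM ?invr_ge0 ?(ltW o0)// mulVf ?powR1// gt_eqF.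
  rewrite mulrA -(mulrA (C M)) bo mulr1 /m mulrCA divff ?mulr1//.
  by rewrite gt_eqF.
- apply: (@le_trans _ _ ((C M * (1 + b))%:E * (expR (w x) / C M)%:E)%E).
    rewrite -EFinM lee_fin mulrAC mulrCA divff ?mulr1 ?gt_eqF// ler_pMr ?expR_gt0//.
    by rewrite lerDl ltW.
  rewrite lee_wpmul2l//; first by rewrite lee_fin mulr_ge0 ?addr_ge0 ?ltW.
  by apply: le_ereal_inf_tmp => _ [y yr <-]; rewrite lee_fin; exact: ratio.
Qed.
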